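(* Let $C:f=0$ be a reduced plane curve of degree $d$ in $\mathbb{P}^2$, not a union of lines passing through one point, and suppose that the minimal graded free resolution of $M(f)$ has the form $$0 \to S(-b-2(d-1)) \to \bigoplus_{i=1}^{3}S(-d_i-(d-1)) \to S^3(-d+1) \to S$$ with integers $d_1\leq d_2\leq d_3$ and $b$. Then the following hold. (i) $d_1+d_2\geq d$, $\; b=d_1+d_2+d_3-2(d-1)$, and $$\tau(C)=(d-1)\sum_{i=1}^{3}d_i-\sum_{1\le i<j\le 3}d_id_j.$$ Moreover $mdr(f)=d_1$, $ct(f)=d_1+d-2$ and $st(f)=b+2d-4$. (ii) Suppose in addition that $C$ is nearly free. Then $d_1+d_2=d$, $d_2=d_3$, $b=d_2-d+2$, and $$\tau(C)=(d-1)^2-d_1(d_2-1)-1.$$ Moreover $st(f)=d_2+d-2$ and $ct(f)+st(f)=T+2=3d-4$, where $T=3(d-2)$. The curve $C$ is almost free exactly when $d_2=d_1$ for $d$ even, or $d_2=d_1+1$ for $d$ odd.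
   Context: $S=\mathbb{C}[x,y,z]$ with its standard grading, $f\in S$ is homogeneous of degree $d$, and $C\subset\mathbb{P}^2$ is the curve $f=0$. $J_f=(f_x,f_y,f_z)$ is the Jacobian ideal, $M(f)=S/J_f$ is the graded Milnor algebra, $I_f$ is the saturation of $J_f$ with respect to $\mathbf{m}=(x,y,z)$, and $N(f)=I_f/J_f$ (a graded $S$-module). $\tau(C)$ is the total Tjurina number of $C$, i.e. the sum of the local Tjurina numbers of $C$ at its singular points. $C$ is nearly free if $N(f)\neq 0$ and $\dim N(f)_k\leq 1$ for all $k$. $C$ is almost free if $\dim N(f)=1$ when $d$ is even, and $\dim N(f)=2$ when $d$ is odd. Invariants: let $f_s\in S$ be homogeneous of degree $d$ with $f_s=0$ a smooth curve. - Coincidence threshold: $ct(f)=\max\{q:\dim M(f)_k=\dim M(f_s)_k \text{ for all } k\leq q\}$. - Stability threshold: $st(f)=\min\{q:\dim M(f)_k=\tau(C)\text{ for all }k\geq q\}$. - Minimal degree of a nontrivial (essential) syzygy: $mdr(f)=\min\{q: H^2(K^*(f))_{q+2}\neq 0\}$, where $K^*(f)$ is the Koszul complex of $f_x,f_y,f_z$ with its natural grading. Concretely, $H^2(K^*(f))_{q+2}$ is the space of triples $(a,b,c)\in S_q^3$ with $af_x+bf_y+cf_z=0$, modulo the Koszul relations, i.e. those lying in the $S$-submodule generated by $(f_y,-f_x,0)$, $(f_z,0,-f_x)$, $(0,f_z,-f_y)$.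
   Formalization: The equalities mdr(f)=d_1 and ct(f)=d_1+d-2 are asserted only when C is singular, and ct(f)+st(f)=T+2 only when ct(f) exists: for smooth C (e.g. x^3+y^3+z^3=0) mdr(f) is the minimum of an empty set and ct(f) the maximum of an unbounded one. *)

(* Defs.v *)
From HB Require Import structures.
From mathcomp Require Import all_boot all_order all_algebra.
From mathcomp Require Import boolp classical_sets cardinality fsbigop reals.
From mathcomp Require Import complex.
From mathcomp Require Import mpoly.

Set Implicit Arguments.
Unset Strict Implicit.
Unset Printing Implicit Defensive.

Import Order.TTheory GRing.Theory Num.Theory.

Local Open Scope classical_set_scope.
Local Open Scope ring_scope.

Section Dimension.
(* W <= U are K-subspaces of the K-algebra A with structure map iota. *)
Variables (K : fieldType) (A : comNzRingType) (iota : K -> A).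

(* The classes of the v_i form a K-basis of U / W. *)
Definition quot_basis (U W : set A) (n : nat) (v : 'I_n -> A) : Prop :=
  [/\ forall i, U (v i),
      forall c : 'I_n -> K, W (\sum_i iota (c i) * v i) -> forall i, c i = 0
    & forall u, U u -> exists c : 'I_n -> K, W (u - \sum_i iota (c i) * v i)].

(* dim_K (U / W); the junk value 0 is taken when U / W is not
   finite-dimensional. *)
Definition quot_dim (U W : set A) : nat :=
  xget 0%N [set n | exists v : 'I_n -> A, quot_basis U W v].

End Dimension.

Section LocalTjurina.
Variable K : fieldType.

Local Notation A2 := {mpoly K[2]}.
Local Notation F2 := {fraction {mpoly K[2]}}.

(* The local ring of the affine plane at a, inside the function field. *)
Definition local_ring (a : 'I_2 -> K) : set F2 :=
  [set x | exists p s : A2, s.@[a] != 0 /\ x = tofrac p / tofrac s].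

(* The ideal generated by g, g_u, g_v in the local ring at a. *)
Definition tjurina_ideal (g : A2) (a : 'I_2 -> K) : set F2 :=
  [set x | exists r s t : F2,
     [/\ local_ring a r, local_ring a s, local_ring a t
       & x = r * tofrac g + s * tofrac (g^`M(0)) + t * tofrac (g^`M(1))]].

(* For an isolated singularity the algebraic local ring gives the same
   dimension as the ring of convergent power series. *)
Definition affine_tjurina (g : A2) (a : 'I_2 -> K) : nat :=
  quot_dim (fun c : K => tofrac (c%:MP_[2])) (local_ring a) (tjurina_ideal g a).

End LocalTjurina.

Section PlaneCurves.
Variable K : fieldType.

Local Notation S := {mpoly K[3]}.

Definition ev (f : S) (v : 'rV[K]_3) : K := f.@[fun i => v 0 i].

Definition fx (f : S) : S := f^`M(0).
Definition fy (f : S) : S := f^`M(1).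
Definition fz (f : S) : S := f^`M(2).

(* Graded piece S_k, k any integer; it is {0} for k < 0. *)
Definition graded_piece (k : int) : set S :=
  [set p | forall m, m \in msupp p -> (mdeg m)%:Z = k].

Definition squarefree (f : S) : Prop :=
  f != 0 /\ forall g h : S, f = g ^+ 2 * h -> exists c : K, g = c%:MP.

Definition reduced_curve (d : nat) (f : S) : Prop :=
  [/\ (0 < d)%N, f \is d.-homog & squarefree f].

Definition concurrent_lines (f : S) : Prop :=
  exists (p : 'rV[K]_3) (ls : seq S),
    [/\ p != 0,
        forall l, l \in ls -> [/\ l != 0, l \is 1.-homog & ev l p = 0]
      & forall v, v != 0 -> (ev f v = 0 <-> exists2 l, l \in ls & ev l v = 0)].

Definition singular_at (f : S) (v : 'rV[K]_3) : Prop :=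
  [/\ ev f v = 0, ev (fx f) v = 0, ev (fy f) v = 0 & ev (fz f) v = 0].

Definition smooth_curve (f : S) : Prop :=
  forall v, v != 0 -> ~ singular_at f v.

(* Points of the projective plane, each represented by its unique coordinate
   vector whose first nonzero entry is 1. *)
Definition proj_plane : set 'rV[K]_3 :=
  [set v | exists i : 'I_3, v 0 i = 1 /\ forall j : 'I_3, (j < i)%N -> v 0 j = 0].

Definition sing (f : S) : set 'rV[K]_3 :=
  [set v | proj_plane v /\ singular_at f v].

(* Equation of the curve in the affine chart x_i = 1. *)
Definition dehomog (i : 'I_3) (f : S) : {mpoly K[2]} :=
  f \mPo [tuple (if unlift i j is Some k then 'X_k else 1) | j < 3].

Definition chart_coord (i : 'I_3) (v : 'rV[K]_3) : 'I_2 -> K :=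
  fun k => v 0 (lift i k) / v 0 i.

Definition tjurina (f : S) (v : 'rV[K]_3) : nat :=
  if [pick i | v 0 i != 0] is Some i
  then affine_tjurina (dehomog i f) (chart_coord i v) else 0%N.

Definition total_tjurina (f : S) : nat :=
  \big[addn/0%N]_(v \in sing f) tjurina f v.

Definition jacobian_ideal (f : S) : set S :=
  [set g | exists a b c : S, g = a * fx f + b * fy f + c * fz f].

(* Saturation with respect to (x, y, z): elements g with (x, y, z)^n g in I
   for some n. *)
Definition saturation (I : set S) : set S :=
  [set g | exists n : nat, forall m : 'X_{1..3}, mdeg m = n -> I ('X_[m] * g)].

Local Notation cst := (fun c : K => c%:MP_[3]).

(* dim M(f)_k *)
Definition dim_milnor (f : S) (k : int) : nat :=
  quot_dim cst (graded_piece k) (graded_piece k `&` jacobian_ideal f).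

(* dim N(f)_k and dim N(f) *)
Definition dim_N_piece (f : S) (k : int) : nat :=
  quot_dim cst (graded_piece k `&` saturation (jacobian_ideal f))
               (graded_piece k `&` jacobian_ideal f).

Definition dim_N (f : S) : nat :=
  quot_dim cst (saturation (jacobian_ideal f)) (jacobian_ideal f).

Definition nearly_free (f : S) : Prop :=
  ~ (saturation (jacobian_ideal f) `<=` jacobian_ideal f) /\
  forall k : int, (dim_N_piece f k <= 1)%N.

Definition almost_free (d : nat) (f : S) : Prop :=
  dim_N f = if odd d then 2%N else 1%N.

Definition syzygy (f a b c : S) : Prop :=
  a * fx f + b * fy f + c * fz f = 0.

Definition koszul_syzygy (f a b c : S) : Prop :=
  exists u v w : S,
    [/\ a = u * fy f + v * fz f,
        b = w * fz f - u * fx f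
      & c = - (v * fx f) - w * fy f].

(* The defining sets of mdr and ct can be empty, resp. unbounded (they are when
   the curve is smooth), so the invariants are given as relations. *)
Definition is_min (A : set int) (q : int) : Prop :=
  A q /\ forall r, A r -> q <= r.

Definition is_max (A : set int) (q : int) : Prop :=
  A q /\ forall r, A r -> r <= q.

Definition is_mdr (f : S) (q : int) : Prop :=
  is_min [set q | exists a b c : S,
    [/\ graded_piece q a, graded_piece q b, graded_piece q c, syzygy f a b c
      & ~ koszul_syzygy f a b c]] q.

Definition is_ct (f fs : S) (q : int) : Prop :=
  is_max [set q | forall k : int, k <= q -> dim_milnor f k = dim_milnor fs k] q.

Definition is_st (f : S) (q : int) : Prop :=
  is_min [set q | forall k : int, q <= k -> dim_milnor f k = total_tjurina f] q.

(* A matrix acting on row vectors by u |-> u *m A is a degree-0 graded map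
   (+)_i S(-a i) -> (+)_j S(-b j). *)
Definition graded_map (m n : nat) (a : 'I_m -> int) (b : 'I_n -> int)
    (A : 'M[S]_(m, n)) : Prop :=
  forall i j, graded_piece (a i - b j) (A i j).

Definition minimal_map (m n : nat) (A : 'M[S]_(m, n)) : Prop :=
  forall i j, (A i j)@_0%MM = 0.

(* S / I has a minimal graded free resolution
   0 -> (+)_i S(-a3 i) -> (+)_i S(-a2 i) -> (+)_i S(-a1 i) -> S. *)
Definition has_minimal_resolution (I : set S) (n1 n2 n3 : nat)
    (a1 : 'I_n1 -> int) (a2 : 'I_n2 -> int) (a3 : 'I_n3 -> int) : Prop :=
  exists (A1 : 'M[S]_(n1, 1)) (A2 : 'M[S]_(n2, n1)) (A3 : 'M[S]_(n3, n2)),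
    [/\ [/\ graded_map a1 (fun=> 0) A1, graded_map a2 a1 A2
          & graded_map a3 a2 A3],
        [/\ minimal_map A1, minimal_map A2 & minimal_map A3]
      & [/\ forall g, I g <-> exists u : 'rV_n1, (u *m A1) 0 0 = g,
            forall u : 'rV_n1, u *m A1 = 0 <-> exists w : 'rV_n2, w *m A2 = u,
            forall u : 'rV_n2, u *m A2 = 0 <-> exists w : 'rV_n3, w *m A3 = u
          & forall u : 'rV_n3, u *m A3 = 0 -> u = 0]].

End PlaneCurves.

(* Main.v *)
Require Import Defs.
From HB Require Import structures.
From mathcomp Require Import all_boot all_order all_algebra.
From mathcomp Require Import boolp classical_sets cardinality fsbigop reals.
From mathcomp Require Import complex.
From mathcomp Require Import separable finmap.
From mathcomp Require Import mpoly.
From mathcomp Require Import ring zify.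

(** Write e = d - 1, J for the Jacobian ideal, M = S/J, and g = (g_1, g_2, g_3)
    for the last map of the resolution, whose entries have degrees
    e_i = B - e - d_i with B = b + 2e.

    Everything about the numbers dim M_k follows from one count: exactness of
    the resolution in degree k gives
      dim M_k = h(k) - 3 h(k - e) + h(k - e - d_1) + h(k - e - d_2)
                + h(k - e - d_3) - h(k - B),   h(k) = dim S_k
    [milnor_dim].  Since h agrees with the quadratic polynomial (k+1)(k+2)/2
    exactly from k = -2 on, the right hand side agrees with a polynomial for
    k >= B - 2 and exceeds it by one at k = B - 3.  Once it is known that
    dim M_k = tau(C) for large k, the vanishing of the linear coefficient is the
    formula for b, the constant term is the formula for tau(C), and B - 2 is
    st(f).  The same count for a smooth curve, whose resolution is the Koszul
    complex, first differs, for a singular curve C, in degree d_1 + e, one more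
    than ct(f).

    Two inputs are needed.  The first is local duality.  For u with
    x^n u, y^n u, z^n u in J, a staircase through the double complex of the
    resolution and the Koszul complex of x^n, y^n, z^n attaches to u a class h
    modulo (x^n, y^n, z^n) that is killed by g [chase_left, chase_right,
    chase_iff]; together with the monomial pairing on S/(x^n, y^n, z^n) this
    gives dim N(f)_k = dim (S/g)_(B - 3 - k) [saturation_dim].  Hence N(f)
    vanishes above degree B - 3, and (S/g) vanishes above the same degree because
    N(f) has no negative part.  So g generates an ideal primary to (x, y, z), its
    Koszul complex is exact [koszul_resolution], no g_i is zero, and all
    e_i > 0; with the formula for b, e_3 > 0 reads d_1 + d_2 >= d.  If C is nearly
    free, dim (S/g)_1 <= 1 forces e_2 = e_3 = 1, and then dim N(f) = e_1.

    The second input is dim M_k = tau(C) for large k [milnor_total_tjurina].  In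
    an affine chart let p be the dehomogenized equation, seen as a polynomial in
    one variable over the field of rational functions in the other one.  As f has
    no square factor, p and its derivative are coprime, so the affine Jacobian
    ideal contains a nonzero polynomial in each single variable
    [chart_eliminant].  This makes the singular points finitely many, makes their
    local algebras finite dimensional, and reduces the Nullstellensatz to
    adjoining one root after the other [nullstellensatz2].  A form that lies in J
    locally at every singular point is then in the saturation of J
    [local_global], hence in J in large degree, while forms of large degree
    realize any element of the local algebra at one singular point and vanish in
    the others [local_surjective]; filtering S_k by the points counts
    dim (S/J)_k as the sum of the local Tjurina numbers. *)

Set Implicit Arguments.
Unset Strict Implicit.
Unset Printing Implicit Defensive.

Import Order.TTheory GRing.Theory Num.Theory.
Local Open Scope classical_set_scope.
Local Open Scope ring_scope.

(** * Dimensions of quotients *)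

Section QuotientDimension.
Variables (K : fieldType) (S : comNzRingType) (iota : {rmorphism K -> S}).
Variable V : lmodType S.
Implicit Types (U W X : set V).

Definition subspace U : Prop :=
  U 0 /\ forall c u v, U u -> U v -> U (iota c *: u + v).

Definition free_mod W n (v : 'I_n -> V) : Prop :=
  forall c : 'I_n -> K, W (\sum_i iota (c i) *: v i) -> forall i, c i = 0.

Definition spans_mod U W n (v : 'I_n -> V) : Prop :=
  forall u, U u -> exists c : 'I_n -> K, W (u - \sum_i iota (c i) *: v i).

(** Dimension of U / W as a relation, so that no finiteness has to be known before
    stating it.  The vectors live in a module over a K-algebra S on which K acts
    through iota: quot_dim is the case V = S^o. *)
Definition qdim U W (n : nat) : Prop :=
  exists v : 'I_n -> V, [/\ forall i, U (v i), free_mod W v & spans_mod U W v].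

Lemma subspaceD U u v : subspace U -> U u -> U v -> U (u + v).
Proof. by case=> _ h hu hv; have := h 1 u v hu hv; rewrite rmorph1 scale1r. Qed.

Lemma subspaceZ U c u : subspace U -> U u -> U (iota c *: u).
Proof. by case=> h0 h hu; have := h c u 0 hu h0; rewrite addr0. Qed.

Lemma subspaceN U u : subspace U -> U u -> U (- u).
Proof.
by move=> h hu; rewrite -scaleN1r -(rmorph1 iota) -rmorphN; apply: subspaceZ.
Qed.

Lemma subspaceB U u v : subspace U -> U u -> U v -> U (u - v).
Proof. by move=> h hu hv; apply: subspaceD => //; apply: subspaceN. Qed.

Lemma subspace_sum U I (r : seq I) (P : pred I) (F : I -> V) :
  subspace U -> (forall i, P i -> U (F i)) -> U (\sum_(i <- r | P i) F i).
Proof.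
move=> h hF; elim/big_ind: _ => //; first by case: h.
by move=> x y; apply: subspaceD.
Qed.

Lemma subspace_comb U I (r : seq I) (P : pred I) (c : I -> K) (F : I -> V) :
  subspace U -> (forall i, P i -> U (F i)) ->
  U (\sum_(i <- r | P i) iota (c i) *: F i).
Proof.
by move=> h hF; apply: subspace_sum => // i Pi; apply: subspaceZ => //; apply: hF.
Qed.

Lemma subspace0 : subspace [set 0].
Proof. by split=> //= c u v -> ->; rewrite scaler0 addr0. Qed.

Lemma subspaceI U W : subspace U -> subspace W -> subspace (U `&` W).
Proof.
move=> [u0 hu] [w0 hw]; split=> // c u v [? ?] [? ?].
by split; [apply: hu | apply: hw].
Qed.

(** If m < n, the n x m matrix of coefficients has a nonzero vector in its left
    kernel, which is a relation between the v_i modulo W. *)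
Lemma free_le_span U W n m (v : 'I_n -> V) (w : 'I_m -> V) :
  subspace W -> (forall i, U (v i)) -> free_mod W v -> spans_mod U W w ->
  (n <= m)%N.
Proof.
move=> sW hv fv hw; rewrite leqNgt; apply/negP => ltmn.
have /choice[c hc] : forall i, exists c : 'I_m -> K, 
    W (v i - \sum_j iota (c j) *: w j) by move=> i; apply: hw.
pose C : 'M[K]_(n, m) := \matrix_(i, j) c i j.
have /rowV0Pn[x /sub_kermxP xC x0] : kermx C != 0.
  rewrite -mxrank_eq0 mxrank_ker subn_eq0 -ltnNge.
  by apply: leq_ltn_trans ltmn; apply: rank_leq_col.
have xi0 : forall i, x 0 i = 0.
  apply: fv; have -> : \sum_i iota (x 0 i) *: v i =
    \sum_i iota (x 0 i) *: (v i - \sum_j iota (c i j) *: w j).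
    apply/eqP; rewrite -subr_eq0 -sumrB.
    rewrite (eq_bigr (fun i => \sum_j iota (x 0 i * c i j) *: w j)); last first.
      move=> i _; rewrite -scalerBr opprB addrC subrK scaler_sumr.
      by apply: eq_bigr => j _; rewrite scalerA rmorphM.
    rewrite exchange_big big1 //= => j _.
    rewrite -scaler_suml -rmorph_sum.
    have := congr1 (fun M : 'M_(_, _) => M 0 j) xC; rewrite !mxE => h.
    rewrite (eq_bigr (fun i => x 0 i * C i j)) ?h ?rmorph0 ?scale0r // => i _.
    by rewrite mxE.
  exact: subspace_comb.
by case/eqP: x0; apply/rowP => i; rewrite xi0 mxE.
Qed.

Lemma qdim_uniq U W n m : subspace W -> qdim U W n -> qdim U W m -> n = m.
Proof.
move=> sW [v [hv fv pv]] [w [hw fw pw]]; apply/eqP; rewrite eqn_leq.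
by rewrite (free_le_span sW hv fv pw) (free_le_span sW hw fw pv).
Qed.

(** A family of maximal length among those free modulo W spans. *)
Lemma qdim_exists U W n : subspace U -> subspace W ->
  (forall m (v : 'I_m -> V), (forall i, U (v i)) -> free_mod W v -> (m <= n)%N) ->
  exists m, qdim U W m.
Proof.
move=> sU sW bnd.
pose P m := `[< exists v : 'I_m -> V, (forall i, U (v i)) /\ free_mod W v >].
have P0 : exists m, P m.
  exists 0%N; apply/asboolP; exists (fun=> 0); split; first by case.
  by move=> c _; case.
have Pn m : P m -> (m <= n)%N by move=> /asboolP[v [hv fv]]; apply: bnd fv.
case: (ex_maxnP P0 Pn) => m /asboolP[v [hv fv]] mx; exists m, v; split=> // u Uu.
apply: contrapT => nspan.
suff : P m.+1 by move/mx; rewrite ltnn.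
apply/asboolP; exists (fun i => if unlift ord_max i is Some j then v j else u).
split; first by move=> i; case: unlift => [j|].
move=> c; rewrite big_ord_recr /= unlift_none.
rewrite (eq_bigr (fun i : 'I_m => iota (c (lift ord_max i)) *: v i)); last first.
  move=> i _; have -> : widen_ord (leqnSn m) i = lift ord_max i.
    by apply/val_inj; rewrite /= /bump leqNgt ltn_ord.
  by rewrite liftK.
move=> hW; have cm : c ord_max = 0.
  apply: contrapT => /eqP cm; apply: nspan.
  exists (fun i => - (c ord_max)^-1 * c (lift ord_max i)).
  have := subspaceZ (c ord_max)^-1 sW hW.
  rewrite scalerDr scalerA -rmorphM mulVf // rmorph1 scale1r addrC scaler_sumr.
  congr (W (_ + _)); rewrite -sumrN; apply: eq_bigr => i _.
  by rewrite scalerA -rmorphM mulNr rmorphN scaleNr opprK.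
move: hW; rewrite cm rmorph0 scale0r addr0 => /fv hc i.
by case: (unliftP ord_max i) => [j ->|->].
Qed.

Lemma free_modS W X n (v : 'I_n -> V) : X `<=` W -> free_mod W v -> free_mod X v.
Proof. by move=> sXW h c /sXW; apply: h. Qed.

Lemma qdimD U W X n m : subspace W -> subspace X -> X `<=` W -> W `<=` U ->
  qdim U W n -> qdim W X m -> qdim U X (n + m).
Proof.
move=> sW sX XW WU [v [hv fv pv]] [w [hw fw pw]].
exists (fun i => match fintype.split i with inl j => v j | inr j => w j end); split.
- by move=> i; case: fintype.splitP => j _ //; apply: WU.
- move=> c; rewrite big_split_ord /=.
  rewrite (eq_bigr (fun j => iota (c (lshift m j)) *: v j)); last first.
    by move=> i _; rewrite -[lshift m i]/(unsplit (inl i)) unsplitK.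
  rewrite (eq_bigr (fun j => iota (c (rshift n j)) *: w j)); last first.
    by move=> i _; rewrite -[rshift n i]/(unsplit (inr i)) unsplitK.
  move=> hX.
  have cv : forall i, c (lshift m i) = 0.
    apply: fv; set s := (X in W X); set t := (X in _ (_ + X)) in hX.
    have -> : s = (s + t) - t by rewrite addrK.
    by apply: subspaceB => //; [apply: XW | apply: subspace_comb].
  move: hX; rewrite big1 => [|i _]; last by rewrite cv rmorph0 scale0r.
  rewrite add0r => /fw cw i.
  by rewrite -(splitK i) /unsplit; case: (fintype.split i).
- move=> u /pv[c hc]; have [c' hc'] := pw _ hc.
  exists (fun i => match fintype.split i with inl j => c j | inr j => c' j end).
  rewrite big_split_ord /=; move: hc'; rewrite -addrA -opprD.
  congr (X (_ - (_ + _))); apply: eq_bigr => i _.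
  - by rewrite -[lshift m i]/(unsplit (inl i)) unsplitK.
  - by rewrite -[rshift n i]/(unsplit (inr i)) unsplitK.
Qed.

(** Inside a finite-dimensional quotient every intermediate subspace has a
    dimension, and dimensions add; this is the rank-nullity theorem used below. *)
Lemma qdim_split U W X n : subspace U -> subspace W -> subspace X ->
    X `<=` W -> W `<=` U -> qdim U X n ->
  exists m p, [/\ qdim W X m, qdim U W p & n = (p + m)%N].
Proof.
move=> sU sW sX XW WU dn; have [w [hw fw pw]] := dn.
have [m dm] : exists m, qdim W X m.
  apply: (@qdim_exists _ _ n) => // m v hv fv.
  by apply: (free_le_span sX _ fv pw) => i; apply: WU.
have [p dp] : exists p, qdim U W p.
  apply: (@qdim_exists _ _ n) => // m' v hv fv.
  by apply: (free_le_span sX hv _ pw); apply: free_modS fv.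
exists m, p; split=> //; apply: (qdim_uniq sX dn).
exact: (qdimD sW sX XW WU dp dm).
Qed.

Lemma qdim0P U W : subspace W -> qdim U W 0 <-> U `<=` W.
Proof.
move=> sW; split=> [[v [_ _ pv]] u /pv[c]|UW]; first by rewrite big_ord0 subr0.
by exists (fun=> 0); split=> [[]//|c _ []//|u /UW]; exists (fun=> 0); rewrite big_ord0 subr0.
Qed.

Lemma qdim_eq_sub U U' W n : subspace U -> subspace U' -> subspace W ->
  W `<=` U -> U `<=` U' -> qdim U W n -> qdim U' W n -> U' `<=` U.
Proof.
move=> sU sU' sW WU UU' dU dU'.
have [m [p [dm dp e]]] := qdim_split sU' sU sW WU UU' dU'.
have := qdim_uniq sW dU dm; rewrite e => {}e.
by apply/(qdim0P _ sU); have -> : 0%N = p by lia.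
Qed.

End QuotientDimension.

Section Transfer.
Variables (K : fieldType).
Variables (S S' : comNzRingType) (iota : {rmorphism K -> S}) (iota' : {rmorphism K -> S'}).
Variables (V : lmodType S) (V' : lmodType S').
Variables (rel : V -> V' -> Prop).
Hypothesis rel0 : rel 0 0.
Hypothesis relP : forall c u v u' v', rel u u' -> rel v v' ->
  rel (iota c *: u + v) (iota' c *: u' + v').

Lemma rel_comb n (c : 'I_n -> K) (v : 'I_n -> V) (v' : 'I_n -> V') :
  (forall i, rel (v i) (v' i)) ->
  rel (\sum_i iota (c i) *: v i) (\sum_i iota' (c i) *: v' i).
Proof.
move=> h; elim/big_ind2: _ => // [x1 x2 y1 y2 h1 h2|i _].
  by have := relP 1 h1 h2; rewrite !rmorph1 !scale1r.
by have := relP (c i) (h i) rel0; rewrite !addr0.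
Qed.

(** The correspondence is a linear relation rather than a map because connecting
    homomorphisms and localizations are only defined modulo W or W'. *)
Lemma qdim_transfer (U W : set V) (U' W' : set V') n :
  subspace iota U -> subspace iota' U' ->
  (forall u, U u -> exists2 u', U' u' & rel u u') ->
  (forall u', U' u' -> exists2 u, U u & rel u u') ->
  (forall u u', U u -> U' u' -> rel u u' -> (W u <-> W' u')) ->
  qdim iota U W n -> qdim iota' U' W' n.
Proof.
move=> sU sU' tot sur ker [v [hv fv pv]].
have /choice[v' hv'] : forall i, exists u', U' u' /\ rel (v i) u'.
  by move=> i; have [u' ? ?] := tot _ (hv i); exists u'.
have hU' i : U' (v' i) by case: (hv' i).
have hr i : rel (v i) (v' i) by case: (hv' i).
exists v'; split=> // [c hc|u' hu'].
  by apply: fv; apply: (ker _ _ _ _ (rel_comb c hr)).2 hc; apply: subspace_comb.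
have [u hu r] := sur _ hu'; have [c hc] := pv _ hu; exists c.
have := relP (-1) (rel_comb c hr) r.
rewrite !rmorphN !rmorph1 !scaleN1r addrC [_ + u']addrC => r'.
apply: (ker _ _ _ _ r').1 hc.
  by apply: (subspaceB sU) => //; apply: subspace_comb.
by apply: (subspaceB sU') => //; apply: subspace_comb.
Qed.

End Transfer.

Section QuotDim.
Variables (K : fieldType) (A : comNzRingType) (iota : {rmorphism K -> A}).

Lemma quot_dimE (U W : set A) n :
  subspace iota (W : set A^o) -> qdim iota (U : set A^o) W n ->
  quot_dim iota U W = n.
Proof.
move=> sW dn; rewrite /quot_dim; apply: (qdim_uniq sW _ dn).
exact: (@xgetPex _ 0%N [set n | exists v : 'I_n -> A, quot_basis iota U W v]
  (ex_intro _ n dn)).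
Qed.

End QuotDim.

(** * Graded pieces of the polynomial ring *)

Section Grading.
Variable K : fieldType.
Local Notation S := {mpoly K[3]}.
Implicit Types (p q : S) (k e : int).

(** Component of degree k, for an integer k, so that degree shifts need no side
    conditions. *)
Definition hcomp k p : S :=
  match k with Posz d => pihomog mdeg d p | Negz _ => 0 end.

Lemma graded_posE (d : nat) p : graded_piece d p <-> p \is d.-homog.
Proof.
split=> [h|/dhomogP h m /h ->//]; apply/dhomogP => m /h.
by move=> /eqP; rewrite eqz_nat => /eqP.
Qed.

Lemma graded_negE (d : nat) p : graded_piece (Negz d) p <-> p = 0.
Proof.
split=> [h|-> m]; last by rewrite msupp0.
by apply: msuppnil0; case E : (msupp p) => [//|m s]; have := h m; rewrite E inE eqxx => /(_ isT).
Qed.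

Lemma graded_lt0 k p : k < 0 -> graded_piece k p -> p = 0.
Proof. by case: k => // k _ /graded_negE. Qed.

Lemma graded0 k : graded_piece k (0 : S).
Proof. by move=> m; rewrite msupp0. Qed.

Lemma hcomp_graded k p : graded_piece k (hcomp k p).
Proof. by case: k => d /=; [apply/graded_posE/pihomogP|apply: graded0]. Qed.

Arguments hcomp_graded : clear implicits.

Lemma hcomp_id k p : graded_piece k p -> hcomp k p = p.
Proof.
by case: k => d /=; [move/graded_posE/pihomog_dE|move/graded_negE].
Qed.

Lemma hcompD k p q : hcomp k (p + q) = hcomp k p + hcomp k q.
Proof. by case: k => d /=; rewrite ?addr0 ?raddfD. Qed.

Lemma hcomp0 k : hcomp k 0 = 0.
Proof. by case: k => d //=; rewrite raddf0. Qed.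

Lemma hcompN k p : hcomp k (- p) = - hcomp k p.
Proof. by case: k => d /=; rewrite ?oppr0 ?raddfN. Qed.

Lemma hcompB k p q : hcomp k (p - q) = hcomp k p - hcomp k q.
Proof. by rewrite hcompD hcompN. Qed.

Lemma hcomp_sum k I (r : seq I) (P : pred I) (F : I -> S) :
  hcomp k (\sum_(i <- r | P i) F i) = \sum_(i <- r | P i) hcomp k (F i).
Proof.
by case: k => d /=; [rewrite raddf_sum | rewrite big1].
Qed.

Lemma hcompZ k (c : K) p : hcomp k (c *: p) = c *: hcomp k p.
Proof. by case: k => d /=; rewrite ?scaler0 ?linearZ. Qed.

Lemma graded_homog0 k e p : graded_piece e p -> k != e -> hcomp k p = 0.
Proof.
case: k => // d; case: e => e; last by move=> /graded_negE->; rewrite hcomp0.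
move=> /graded_posE h ne; apply: pihomog_ne0 h.
by apply: contraNneq ne => ->.
Qed.

Lemma gradedD k p q : graded_piece k p -> graded_piece k q -> graded_piece k (p + q).
Proof. by move=> hp hq; rewrite -(hcomp_id hp) -(hcomp_id hq) -hcompD; apply: hcomp_graded. Qed.

Lemma gradedN k p : graded_piece k p -> graded_piece k (- p).
Proof. by move=> hp; rewrite -(hcomp_id hp) -hcompN; apply: hcomp_graded. Qed.

Lemma gradedB k p q : graded_piece k p -> graded_piece k q -> graded_piece k (p - q).
Proof. by move=> hp hq; apply: gradedD => //; apply: gradedN. Qed.

Lemma gradedZ k (c : K) p : graded_piece k p -> graded_piece k (c *: p).
Proof. by move=> hp; rewrite -(hcomp_id hp) -hcompZ; apply: hcomp_graded. Qed.

Lemma graded_sum k I (r : seq I) (P : pred I) (F : I -> S) :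
  (forall i, P i -> graded_piece k (F i)) -> graded_piece k (\sum_(i <- r | P i) F i).
Proof.
by move=> h; elim/big_ind: _ => //; [apply: graded0 | move=> x y; apply: gradedD].
Qed.

Lemma gradedM k e p q : graded_piece k p -> graded_piece e q -> graded_piece (k + e) (p * q).
Proof.
case: k => k; last by move=> /graded_negE->; rewrite mul0r => _; apply: graded0.
case: e => e; last by move=> _ /graded_negE->; rewrite mulr0; apply: graded0.
by move=> /graded_posE hp /graded_posE hq; rewrite -PoszD; apply/graded_posE/dhomogM.
Qed.

Lemma gradedX (d n : nat) p : graded_piece d p -> graded_piece (d * n)%N (p ^+ n).
Proof. by move=> /graded_posE h; apply/graded_posE/dhomogMn. Qed.

Lemma gradedMon (m : 'X_{1..3}) : graded_piece (mdeg m) ('X_[m] : S).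
Proof. by apply/graded_posE; rewrite dhomogX. Qed.

Lemma gradedC (c : K) : graded_piece 0 (c%:MP_[3]).
Proof. by move=> m; rewrite msuppC; case: ifP; rewrite // inE => _ /eqP->; rewrite mdeg0. Qed.

Lemma graded0C p : graded_piece 0 p -> p = (p@_0%MM)%:MP.
Proof.
move=> h; apply/mpolyP => m; rewrite mcoeffC.
have [->|m0] := eqVneq m 0%MM; first by rewrite mulr1.
rewrite mulr0; apply/memN_msupp_eq0/negP => /h /eqP.
by rewrite eqz_nat mdeg_eq0 (negbTE m0).
Qed.

(** A form of degree 0 is its own constant term. *)
Lemma graded_pos k p : graded_piece k p -> p@_0%MM = 0 -> p != 0 -> 0 < k.
Proof.
move=> h p0 pn0; rewrite lt_neqAle; apply/andP; split.
  apply: contraNneq pn0 => e; rewrite -e in h.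
  by rewrite (graded0C h) p0 mpolyC0.
by case: k h => // k /graded_negE e; rewrite e eqxx in pn0.
Qed.

Lemma sum_hcomp p : exists N : nat, p = \sum_(d < N) hcomp (d : nat) p.
Proof. by exists (msize p); apply: (pihomog_partitionE (mf := mdeg)). Qed.

Lemma hcompM k e p q : graded_piece e q -> hcomp k (p * q) = hcomp (k - e) p * q.
Proof.
move=> hq; have [N ->] := sum_hcomp p; rewrite mulr_suml !hcomp_sum mulr_suml.
apply: eq_bigr => i _.
have hM := gradedM (hcomp_graded (i : nat) p) hq.
have [ek|nk] := eqVneq (k - e) (i : nat).
  have -> : k = (i : nat)%:Z + e by rewrite -ek subrK.
  by rewrite (hcomp_id hM) addrK (hcomp_id (hcomp_graded _ _)).
rewrite (graded_homog0 hM); last by apply: contra_neq nk => ->; rewrite addrK.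
by rewrite (graded_homog0 (hcomp_graded _ p) nk) mul0r.
Qed.

Definition iotaS : {rmorphism K -> S} := @mpolyC 3 K.

Lemma iotaSE c p : iotaS c * p = c *: p.
Proof. exact: mul_mpolyC. Qed.

Lemma subspace_graded k : subspace iotaS (graded_piece k : set S^o).
Proof.
split; first exact: graded0.
move=> c u v hu hv; apply: gradedD => //.
by change (graded_piece k (iotaS c * u)); rewrite iotaSE; apply: gradedZ.
Qed.

Definition dimS k : nat := if k is Posz d then 'C(d + 2, 2) else 0%N.

Lemma qdim_graded k : qdim iotaS (graded_piece k : set S^o) [set 0] (dimS k).
Proof.
case: k => [d|d]; last first.
  by apply/qdim0P; [apply: subspace0 | move=> u /graded_negE].
pose T := dhomog 3 K d.
have dT : \dim {:T} = 'C(d + 2, 2).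
  by rewrite dimvf /dim /= -bin_sub ?leq_addr // addKn.
pose X := vbasis {:T}.
rewrite /= -dT; exists (fun i => mpoly_of_dhomog X`_i); split.
- by move=> i; apply/graded_posE; case: (X`_i).
- move=> c /= hc i; have := basis_free (vbasisP {:T}) => /freeP; apply.
  apply/val_inj; rewrite linear_sum /= -[RHS]hc; apply: eq_bigr => j _.
  exact: esym (iotaSE _ _).
- move=> u /graded_posE hu; pose u' : T := DHomog hu.
  have := coord_vbasis (memvf u') => /(congr1 val); rewrite linear_sum /= => {1}->.
  exists (fun i => coord (vbasis {:T}) i u'); apply/eqP; rewrite subr_eq0; apply/eqP.
  by apply: eq_bigr => i _; exact: esym (iotaSE _ _).
Qed.

(** The polynomial (k + 1)(k + 2) / 2 vanishes at -1 and -2 but not at -3; this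
    is what determines the stability threshold. *)
Lemma dimSE k : -2 <= k -> (2 * dimS k)%:Z = (k + 1) * (k + 2).
Proof.
case: k => [d _|[|[|d]] //]; rewrite /dimS addn2 bin2 /= mul2n.
have e : odd (d.+2 * d.+1) = false by rewrite oddM /=; case: (odd d).
by have := odd_double_half (d.+2 * d.+1); rewrite e; lia.
Qed.

Lemma dimS_lt0 k : k < 0 -> dimS k = 0%N.
Proof. by case: k. Qed.

Lemma subspaceSI (I : set S) k : subspace iotaS (I : set S^o) ->
  subspace iotaS ((graded_piece k `&` I) : set S^o).
Proof. by move=> h; apply: subspaceI => //; apply: subspace_graded. Qed.

End Grading.

(* graded_piece unfolds to a product, whose variables would be taken as arguments *)
Arguments graded0 : clear implicits.
Arguments graded0 {K} k.
Arguments gradedD : clear implicits.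
Arguments gradedD {K k p q} _ _.
Arguments gradedN : clear implicits.
Arguments gradedN {K k p} _.
Arguments gradedB : clear implicits.
Arguments gradedB {K k p q} _ _.
Arguments gradedZ : clear implicits.
Arguments gradedZ {K k} c {p} _.
Arguments graded_sum : clear implicits.
Arguments graded_sum {K k I r P F} _.
Arguments gradedM : clear implicits.
Arguments gradedM {K k e p q} _ _.
Arguments gradedX : clear implicits.
Arguments gradedX {K d} n {p} _.
Arguments gradedMon : clear implicits.
Arguments gradedMon {K} m.
Arguments gradedC : clear implicits.
Arguments gradedC {K} c.
Arguments hcomp_graded : clear implicits.
Arguments hcomp_graded {K} k p.

(** * Graded free modules and Hilbert functions *)

Section FreeModules.
Variable K : fieldType.
Local Notation S := {mpoly K[3]}.
Local Notation iotaS := (@iotaS K).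

(** The degree k part of the free module that is the direct sum of the S(-a j). *)
Definition gvec n (a : 'I_n -> int) (k : int) : set 'rV[S]_n :=
  [set u | forall j, graded_piece (k - a j) (u 0 j)].

Definition compv n (a : 'I_n -> int) (k : int) (u : 'rV[S]_n) : 'rV[S]_n :=
  \row_j hcomp (k - a j) (u 0 j).

Section OneModule.
Variables (n : nat) (a : 'I_n -> int) (k : int).
Implicit Types u v : 'rV[S]_n.

Lemma compv_gvec u : gvec a k (compv a k u).
Proof. by move=> j; rewrite mxE; apply: hcomp_graded. Qed.

Lemma compv_id u : gvec a k u -> compv a k u = u.
Proof. by move=> h; apply/rowP => j; rewrite mxE hcomp_id. Qed.

Lemma compvD u v : compv a k (u + v) = compv a k u + compv a k v.
Proof. by apply/rowP => j; rewrite !mxE hcompD. Qed.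

Lemma compvB u v : compv a k (u - v) = compv a k u - compv a k v.
Proof. by apply/rowP => j; rewrite !mxE hcompB. Qed.

Lemma compvZ e p u : graded_piece e p -> compv a k (p *: u) = p *: compv a (k - e) u.
Proof.
move=> hp; apply/rowP => j; rewrite !mxE mulrC (hcompM _ _ hp) mulrC.
by congr (_ * hcomp _ _); ring.
Qed.

Lemma subspace_gvec : subspace iotaS (gvec a k).
Proof.
split=> [j|c u v hu hv j]; rewrite !mxE; first exact: graded0.
by apply: gradedD => //; rewrite iotaSE; apply: gradedZ.
Qed.

(** The vectors supported on the first t coordinates filter the module, with
    quotients the degree k parts of the S(-a t). *)
Lemma qdim_gvec : qdim iotaS (gvec a k) [set 0] (\sum_j dimS (k - a j)).
Proof.
pose F t : set 'rV[S]_n := [set u | gvec a k u /\ forall j : 'I_n, (t <= j)%N -> u 0 j = 0].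
have sF t : subspace iotaS (F t).
  split=> [|c u v [hu u0] [hv v0]].
    by split=> [|j _]; [case: subspace_gvec | rewrite mxE].
  split; first by case: subspace_gvec => _; apply.
  by move=> j tj; rewrite !mxE u0 // v0 // mulr0 addr0.
have main t : (t <= n)%N -> qdim iotaS (F t) [set 0] (\sum_(j < n | (j < t)%N) dimS (k - a j)).
  elim: t => [_|t ih ltn].
    rewrite big_pred0 //; apply/qdim0P; first exact: subspace0.
    by move=> u [_ h]; apply/rowP => j; rewrite mxE h.
  pose t' := Ordinal ltn.
  rewrite (bigD1 t') //=.
  rewrite (eq_bigl (fun j : 'I_n => (j < t)%N)); last first.
    by move=> j; rewrite -val_eqE /=; lia.
  apply: (@qdimD _ _ _ _ _ (F t)) => //; first exact: subspace0.
  - by move=> u ->; case: (sF t).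
  - by move=> u [hu u0]; split=> // j tj; apply: u0; lia.
  (* the t-th coordinate identifies F (t + 1) / F t with S_(k - a t) *)
  - pose rel (p : S^o) (u : 'rV[S]_n) := u 0 t' = p.
    apply: (@qdim_transfer _ _ _ iotaS iotaS S^o _ rel _ _ (graded_piece (k - a t')) [set 0]).
    - by rewrite /rel mxE.
    - by move=> c p q u v; rewrite /rel !mxE => -> ->.
    - exact: subspace_graded.
    - exact: sF.
    - move=> p hp; exists (\row_j (if j == t' then p else 0)); last by rewrite /rel mxE eqxx.
      split=> j; rewrite mxE; first by case: eqP => [->|_] //; apply: graded0.
      by move=> tj; case: eqP => // e; rewrite e /= ltnn in tj.
    - by move=> u [hu u0]; exists (u 0 t').
    - move=> p u hp [hu u0] r; split => [p0|[_ h]].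
        split=> // j tj; have [->|ne] := eqVneq j t'; first by rewrite r p0.
        by apply: u0; rewrite ltn_neqAle tj andbT; apply: contra_neq ne => e; apply/val_inj.
      by rewrite -r; apply: h.
    - exact: qdim_graded.
  - by apply: ih; apply: ltnW.
have := main n (leqnn n).
have -> : F n = gvec a k.
  by apply/seteqP; split=> [u []|u hu] //; split=> // j; rewrite leqNgt ltn_ord.
by congr qdim; apply: eq_bigl => j; rewrite ltn_ord.
Qed.

End OneModule.

Lemma compv_mulmx n m (a : 'I_n -> int) (b : 'I_m -> int) (A : 'M[S]_(n, m)) k u :
  graded_map a b A -> compv b k (u *m A) = compv a k u *m A.
Proof.
move=> hA; apply/rowP => j; rewrite !mxE hcomp_sum; apply: eq_bigr => i _.
rewrite (hcompM _ _ (hA i j)) mxE; congr (hcomp _ _ * _); ring.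
Qed.

Lemma gvec_mulmx n m (a : 'I_n -> int) (b : 'I_m -> int) (A : 'M[S]_(n, m)) k u :
  graded_map a b A -> gvec a k u -> gvec b k (u *m A).
Proof.
by move=> hA hu; rewrite -(compv_id hu) -(compv_mulmx _ _ hA); apply: compv_gvec.
Qed.

Definition imv n m (A : 'M[S]_(n, m)) (U : set 'rV[S]_n) : set 'rV[S]_m :=
  [set w | exists2 u, U u & u *m A = w].

Definition kerv n m (A : 'M[S]_(n, m)) (U : set 'rV[S]_n) : set 'rV[S]_n :=
  [set u | U u /\ u *m A = 0].

Lemma subspace_kerv n m (A : 'M[S]_(n, m)) U :
  subspace iotaS U -> subspace iotaS (kerv A U).
Proof.
move=> sU; split=> [|c u v [hu u0] [hv v0]]; split.
- by case: sU.
- by rewrite mul0mx.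
- by case: sU => _; apply.
- by rewrite mulmxDl -scalemxAl u0 v0 scaler0 addr0.
Qed.

Lemma subspace_imv n m (A : 'M[S]_(n, m)) U :
  subspace iotaS U -> subspace iotaS (imv A U).
Proof.
move=> sU; split=> [|c _ _ [u hu <-] [v hv <-]].
  by exists 0; [case: sU | rewrite mul0mx].
exists (iotaS c *: u + v); first by case: sU => _; apply.
by rewrite mulmxDl -scalemxAl.
Qed.

Lemma qdim_imv n m (A : 'M[S]_(n, m)) U N z : subspace iotaS U ->
  qdim iotaS U [set 0] N -> qdim iotaS (kerv A U) [set 0] z ->
  exists2 p, qdim iotaS (imv A U) [set 0] p & N = (p + z)%N.
Proof.
move=> sU dN dz; have sk := subspace_kerv A sU.
have zk : [set 0] `<=` kerv A U by move=> _ ->; case: sk.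
have kU : kerv A U `<=` U by move=> u [].
have [z' [p [dz' dp ->]]] := qdim_split sU sk (subspace0 _ _) zk kU dN.
rewrite (qdim_uniq (subspace0 _ _) dz dz'); exists p => //.
apply: (@qdim_transfer _ _ _ iotaS iotaS _ _ (fun u w => u *m A = w)) dp => //.
- by rewrite mul0mx.
- by move=> c u v _ _ <- <-; rewrite mulmxDl -scalemxAl.
- exact: subspace_imv.
- by move=> u hu; exists (u *m A) => //; exists u.
- by move=> u w hu _ <-; split=> [[]|/= h] //; split.
Qed.

Section HilbertFunction.
Variables (I : set S) (n1 n2 n3 : nat).
Variables (a1 : 'I_n1 -> int) (a2 : 'I_n2 -> int) (a3 : 'I_n3 -> int).
Variables (A1 : 'M[S]_(n1, 1)) (A2 : 'M[S]_(n2, n1)) (A3 : 'M[S]_(n3, n2)).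

(** Minimality is a separate predicate, so that Koszul complexes of forms of
    arbitrary degrees qualify. *)
Definition graded_resolution : Prop :=
  [/\ graded_map a1 (fun=> 0) A1, graded_map a2 a1 A2 & graded_map a3 a2 A3] /\
  [/\ forall g, I g <-> exists u : 'rV_n1, (u *m A1) 0 0 = g,
      forall u : 'rV_n1, u *m A1 = 0 <-> exists w : 'rV_n2, w *m A2 = u,
      forall u : 'rV_n2, u *m A2 = 0 <-> exists w : 'rV_n3, w *m A3 = u
    & forall u : 'rV_n3, u *m A3 = 0 -> u = 0].

Hypothesis res : graded_resolution.

Lemma res_subspace : subspace iotaS (I : set S^o).
Proof.
have [_ [hI _ _ _]] := res; split=> [|c _ _ /hI[u <-] /hI[v <-]]; apply/hI.
  by exists 0; rewrite mul0mx mxE.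
by exists (iotaS c *: u + v); rewrite mulmxDl -scalemxAl !mxE.
Qed.

(** The alternating sum of dimensions along the resolution in degree k. *)
Lemma res_dim k : exists2 p, qdim iotaS (graded_piece k : set S^o) (graded_piece k `&` I) p &
  p%:Z = (dimS k)%:Z - (\sum_i dimS (k - a1 i))%:Z + (\sum_i dimS (k - a2 i))%:Z
         - (\sum_i dimS (k - a3 i))%:Z.
Proof.
have [[g1 g2 g3] [hI e1 e2 e3]] := res.
have s0 n := @subspace0 _ _ iotaS ('rV[S]_n).
have k3 : qdim iotaS (kerv A3 (gvec a3 k)) [set 0] 0.
  by apply/qdim0P; [apply: s0 | move=> u [_ /e3]].
have [p3 d3 E3] := qdim_imv (subspace_gvec a3 k) (qdim_gvec a3 k) k3.
have i3 : imv A3 (gvec a3 k) = kerv A2 (gvec a2 k).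
  apply/seteqP; split=> [_ [u hu <-]|u [hu /e2[w hw]]].
    by split; [apply: gvec_mulmx hu | apply/e2; exists u].
  exists (compv a3 k w); first exact: compv_gvec.
  by rewrite -(compv_mulmx _ _ g3) hw compv_id.
rewrite i3 in d3; have [p2 d2 E2] := qdim_imv (subspace_gvec a2 k) (qdim_gvec a2 k) d3.
have i2 : imv A2 (gvec a2 k) = kerv A1 (gvec a1 k).
  apply/seteqP; split=> [_ [u hu <-]|u [hu /e1[w hw]]].
    by split; [apply: gvec_mulmx hu | apply/e1; exists u].
  exists (compv a2 k w); first exact: compv_gvec.
  by rewrite -(compv_mulmx _ _ g2) hw compv_id.
rewrite i2 in d2; have [p1 d1 E1] := qdim_imv (subspace_gvec a1 k) (qdim_gvec a1 k) d2.
have dI : qdim iotaS ((graded_piece k `&` I) : set S^o) [set 0] p1.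
  have sI := subspaceSI k res_subspace.
  apply: (@qdim_transfer _ _ _ iotaS iotaS 'rV[S]_1 S^o (fun (w : 'rV[S]_1) (p : S^o) => w 0 0 = p)) d1.
  - by rewrite mxE.
  - by move=> c u v _ _ <- <-; rewrite !mxE.
  - exact/subspace_imv/subspace_gvec.
  - exact: sI.
  - move=> _ [u hu <-]; exists ((u *m A1) 0 0) => //; split; last by apply/hI; exists u.
    by have h := gvec_mulmx g1 hu; rewrite -(subr0 k); apply: (h 0).
  - move=> p [hp /hI[u hu]]; exists (compv a1 k u *m A1).
      by exists (compv a1 k u) => //; apply: compv_gvec.
    by rewrite -(compv_mulmx _ _ g1) mxE subr0 hu hcomp_id.
  - move=> u p _ _ <-; split=> [->|h]; first by rewrite mxE.
    by apply/rowP => j; rewrite ord1 mxE.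
have z1 : ([set 0] : set S^o) `<=` graded_piece k `&` I.
  by move=> _ ->; case: (subspaceSI k res_subspace).
have [m [p [dm dp e]]] := qdim_split (subspace_graded K k) (subspaceSI k res_subspace)
  (@subspace0 _ _ iotaS S^o) z1 (@subIsetl _ _ _) (qdim_graded _ k).
have em := qdim_uniq (@subspace0 _ _ iotaS S^o) dm dI.
by exists p => //; lia.
Qed.

End HilbertFunction.
End FreeModules.

(** * Resolutions against a regular sequence *)

Section RegularSequence.
Variables (S : idomainType) (X : 'I_3 -> S).
Local Notation x := (X 0).
Local Notation y := (X 1).
Local Notation z := (X 2%:R).

(** The Koszul complex of x, y, z is exact in positive homological degrees: one
    clause for each of its terms, from the left.  In the second clause the other
    two components follow by cancelling x. *)
Definition koszul_regular : Prop :=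
  [/\ x != 0, forall a b, y * a = x * b -> exists e, a = x * e
    & forall a b c, z * a - y * b + x * c = 0 ->
      exists c1 c2 c3, [/\ a = y * c1 - x * c2, b = z * c1 - x * c3 & c = z * c2 - y * c3]].

Hypothesis reg : koszul_regular.

Lemma reg_scale_inj r (u v : 'rV[S]_r) : x *: u = x *: v -> u = v.
Proof.
have [x0 _ _] := reg; move=> /rowP e; apply/rowP => j; apply: (mulfI x0).
by have := e j; rewrite !mxE.
Qed.

Lemma reg_cross r (u v : 'rV[S]_r) : y *: u = x *: v -> exists w, u = x *: w.
Proof.
have [_ cr _] := reg; move=> /rowP e.
have /choice[w hw] : forall k, exists w, u 0 k = x * w.
  by move=> k; have := e k; rewrite !mxE => /cr.
by exists (\row_k w k); apply/rowP => k; rewrite !mxE.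
Qed.

Lemma reg_koszul r (a b c : 'rV[S]_r) : z *: a - y *: b + x *: c = 0 ->
  exists c1 c2 c3, [/\ a = y *: c1 - x *: c2, b = z *: c1 - x *: c3 & c = z *: c2 - y *: c3].
Proof.
have [_ _ ks] := reg; move=> /rowP e.
have /choice[w hw] : forall k, exists w : S * S * S,
   [/\ a 0 k = y * w.1.1 - x * w.1.2, b 0 k = z * w.1.1 - x * w.2 
     & c 0 k = z * w.1.2 - y * w.2].
  move=> k; have := e k; rewrite !mxE => /ks[c1 [c2 [c3 h]]].
  by exists (c1, c2, c3).
exists (\row_k (w k).1.1), (\row_k (w k).1.2), (\row_k (w k).2).
by split; apply/rowP => k; rewrite !mxE; have [? ? ?] := hw k.
Qed.

(** Membership in (x, y, z) F for a free module F. *)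
Definition in_regular r (u : 'rV[S]_r) : Prop :=
  exists a b c, u = x *: a + y *: b + z *: c.

Variables (n0 n1 n2 n3 : nat).
Variables (A1 : 'M[S]_(n1, n0)) (A2 : 'M[S]_(n2, n1)) (A3 : 'M[S]_(n3, n2)).
Hypothesis exact1 : forall u : 'rV_n1, u *m A1 = 0 <-> exists w : 'rV_n2, w *m A2 = u.
Hypothesis exact2 : forall u : 'rV_n2, u *m A2 = 0 <-> exists w : 'rV_n3, w *m A3 = u.
Hypothesis exact3 : forall u : 'rV_n3, u *m A3 = 0 -> u = 0.

(** A staircase in the double complex of the resolution F and the Koszul complex
    of x, y, z.  It starts with u in F_0 such that x u, y u, z u lie in the image
    of F_1 and ends with h in F_3; both ends compute
    Tor_3(S / (x, y, z), coker A1). *)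
Definition chase_data (u : 'rV[S]_n0) (a0 a1 a2 : 'rV[S]_n1)
    (b01 b02 b12 : 'rV[S]_n2) (h : 'rV[S]_n3) : Prop :=
  [/\ x *: u = a0 *m A1, y *: u = a1 *m A1 & z *: u = a2 *m A1] /\
  [/\ y *: a0 - x *: a1 = b01 *m A2, z *: a0 - x *: a2 = b02 *m A2,
      z *: a1 - y *: a2 = b12 *m A2 & z *: b01 - y *: b02 + x *: b12 = h *m A3].

Definition chase u h : Prop := exists a0 a1 a2 b01 b02 b12, chase_data u a0 a1 a2 b01 b02 b12 h.

Lemma chase_in u h : chase u h -> in_regular (h *m A3).
Proof.
move=> [_ [_ [_ [b01 [b02 [b12 [_ [_ _ _ <-]]]]]]]].
by exists b12, (- b02), b01; apply/rowP => j; rewrite !mxE; ring.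
Qed.

Lemma chaseD c u h u' h' : chase u h -> chase u' h' -> chase (c *: u + u') (c *: h + h').
Proof.
move=> [a0 [a1 [a2 [b01 [b02 [b12 [[e1 e2 e3] [e4 e5 e6 e7]]]]]]]].
move=> [a0' [a1' [a2' [b01' [b02' [b12' [[e1' e2' e3'] [e4' e5' e6' e7']]]]]]]].
exists (c *: a0 + a0'), (c *: a1 + a1'), (c *: a2 + a2'), (c *: b01 + b01'), (c *: b02 + b02'), (c *: b12 + b12').
split; split; rewrite mulmxDl -scalemxAl.
- by rewrite -e1 -e1' scalerDr !scalerA mulrC.
- by rewrite -e2 -e2' scalerDr !scalerA mulrC.
- by rewrite -e3 -e3' scalerDr !scalerA mulrC.
- by rewrite -e4 -e4'; apply/rowP => j; rewrite !mxE; ring.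
- by rewrite -e5 -e5'; apply/rowP => j; rewrite !mxE; ring.
- by rewrite -e6 -e6'; apply/rowP => j; rewrite !mxE; ring.
- by rewrite -e7 -e7'; apply/rowP => j; rewrite !mxE; ring.
Qed.

Lemma chase0 : chase 0 0.
Proof.
by exists 0, 0, 0, 0, 0, 0; split; split; rewrite ?scaler0 ?mul0mx ?subr0 ?addr0.
Qed.

(** Each step lifts, by exactness of F, a Koszul combination that the previous map
    of F kills. *)
Lemma chase_left u : (forall i, exists a, X i *: u = a *m A1) -> exists h, chase u h.
Proof.
move=> hu; have [a0 e0] := hu 0; have [a1 e1] := hu 1; have [a2 e2] := hu 2%:R.
have lift i j (a b : 'rV_n1) : X i *: u = a *m A1 -> X j *: u = b *m A1 ->
    exists w, X j *: a - X i *: b = w *m A2.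
  move=> ei ej; have [w <-] : exists w : 'rV_n2, w *m A2 = X j *: a - X i *: b.
    by apply/exact1; rewrite mulmxBl -!scalemxAl -ei -ej !scalerA mulrC subrr.
  by exists w.
have [b01 f01] := lift _ _ _ _ e0 e1.
have [b02 f02] := lift _ _ _ _ e0 e2.
have [b12 f12] := lift _ _ _ _ e1 e2.
have [h eh] : exists h : 'rV_n3, h *m A3 = z *: b01 - y *: b02 + x *: b12.
  apply/exact2; rewrite mulmxDl mulmxBl -!scalemxAl -f01 -f02 -f12.
  by apply/rowP => j; rewrite !mxE; ring.
by exists h, a0, a1, a2, b01, b02, b12.
Qed.

(** The same staircase climbed backwards, now lifting along the Koszul complex. *)
Lemma chase_right h : in_regular (h *m A3) -> exists u, chase u h.
Proof.
move=> [b12 [b02' [b01 e]]]; pose b02 := - b02'.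
have eh : z *: b01 - y *: b02 + x *: b12 = h *m A3.
  by rewrite e; apply/rowP => j; rewrite !mxE; ring.
have /reg_koszul[a0 [a1 [a2 [f01 f02 f12]]]] :
    z *: (b01 *m A2) - y *: (b02 *m A2) + x *: (b12 *m A2) = 0.
  by rewrite !scalemxAl -mulmxBl -mulmxDl eh; apply/exact2; exists h.
have c0 (w : 'rV_n2) : w *m A2 *m A1 = 0 by apply/exact1; exists w.
have e01 : y *: (a0 *m A1) = x *: (a1 *m A1).
  by apply/eqP; rewrite -subr_eq0 !scalemxAl -mulmxBl -f01 c0.
have e02 : z *: (a0 *m A1) = x *: (a2 *m A1).
  by apply/eqP; rewrite -subr_eq0 !scalemxAl -mulmxBl -f02 c0.
have [u eu] := reg_cross e01.
exists u, a0, a1, a2, b01, b02, b12; split; split=> //.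
  by apply: reg_scale_inj; rewrite -e01 eu !scalerA mulrC.
by apply: reg_scale_inj; rewrite -e02 eu !scalerA mulrC.
Qed.

(** The two ends of a staircase vanish together: modifying the a_i by elements of
    F_2, and the b_ij by elements of F_3, moves a zero from one end to the other. *)
Lemma chase_iff u h : chase u h -> (exists a, a *m A1 = u) <-> in_regular h.
Proof.
move=> [a0 [a1 [a2 [b01 [b02 [b12 [[e0 e1 e2] [f01 f02 f12 g]]]]]]]].
split=> [[a ea]|[p12 [p02' [p01 eh]]]].
  have lift i (b : 'rV_n1) : X i *: u = b *m A1 ->
      exists w : 'rV_n2, w *m A2 = b - X i *: a.
    by move=> eb; apply/exact1; rewrite mulmxBl -scalemxAl ea eb subrr.
  have [c0 k0] := lift _ _ e0; have [c1 k1] := lift _ _ e1; have [c2 k2] := lift _ _ e2.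
  have [p01 l01] : exists p : 'rV_n3, p *m A3 = b01 - (y *: c0 - x *: c1).
    apply/exact2; rewrite !mulmxBl -!scalemxAl k0 k1 -f01.
    by apply/rowP => j; rewrite !mxE; ring.
  have [p02 l02] : exists p : 'rV_n3, p *m A3 = b02 - (z *: c0 - x *: c2).
    apply/exact2; rewrite !mulmxBl -!scalemxAl k0 k2 -f02.
    by apply/rowP => j; rewrite !mxE; ring.
  have [p12 l12] : exists p : 'rV_n3, p *m A3 = b12 - (z *: c1 - y *: c2).
    apply/exact2; rewrite !mulmxBl -!scalemxAl k1 k2 -f12.
    by apply/rowP => j; rewrite !mxE; ring.
  exists p12, (- p02), p01; apply/eqP; rewrite -subr_eq0; apply/eqP; apply: exact3.
  rewrite mulmxBl !mulmxDl -!scalemxAl mulNmx l01 l02 l12 -g.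
  by apply/rowP => j; rewrite !mxE; ring.
have /reg_koszul[c0 [c1 [c2 [k01 k02 k12]]]] :
    z *: (b01 - p01 *m A3) - y *: (b02 + p02' *m A3) + x *: (b12 - p12 *m A3) = 0.
  apply/eqP; rewrite -[X in X == _](subrK (h *m A3)) {2}eh -g !mulmxDl -!scalemxAl; apply/eqP.
  by apply/rowP => j; rewrite !mxE; ring.
have c0A (w : 'rV_n3) : w *m A3 *m A2 = 0 by apply/exact2; exists w.
have e : y *: (a0 - c0 *m A2) = x *: (a1 - c1 *m A2).
  apply/eqP; rewrite -subr_eq0.
  have -> : y *: (a0 - c0 *m A2) - x *: (a1 - c1 *m A2) = 
     (y *: a0 - x *: a1) - (y *: c0 - x *: c1) *m A2.
    by rewrite mulmxBl -!scalemxAl; apply/rowP => j; rewrite !mxE; ring.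
  by rewrite f01 -k01 mulmxBl c0A subr0 subrr.
have [d ed] := reg_cross e.
exists d; apply: reg_scale_inj.
have c0B (w : 'rV_n2) : w *m A2 *m A1 = 0 by apply/exact1; exists w.
by rewrite e0 scalemxAl -ed mulmxBl c0B subr0.
Qed.

End RegularSequence.

(** * Powers of the variables form a regular sequence *)

Section PowersOfVariables.
Variable K : fieldType.
Local Notation S := {mpoly K[3]}.
Variable n : nat.
Implicit Types (p q : S) (m : 'X_{1..3}).

Definition Xp (i : 'I_3) : S := 'X_i ^+ n.

Lemma XpE i : Xp i = 'X_[U_(i) *+ n].
Proof. exact: mpolyXn. Qed.

Lemma Xp_neq0 i : Xp i != 0.
Proof. by rewrite XpE -msupp_eq0 msuppX. Qed.

Lemma msupp_XpM i p m : m \in msupp (Xp i * p) ->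
  exists2 m', m' \in msupp p & m = (U_(i) *+ n + m')%MM.
Proof. by rewrite mulrC XpE (perm_mem (msuppMX _ _)) => /mapP. Qed.

Lemma Xp_coeff_lt i p m : (m i < n)%N -> (Xp i * p)@_m = 0.
Proof.
move=> h; apply/memN_msupp_eq0/negP => /msupp_XpM[m' _ e].
by move: h; rewrite e mnmDE mulmnE mnm1E eqxx mul1n; lia.
Qed.

Lemma Xp_divide i p : (forall m, m \in msupp p -> (n <= m i)%N) ->
  exists q, p = Xp i * q.
Proof.
move=> h; exists (\sum_(m <- msupp p) p@_m *: 'X_[m - U_(i) *+ n]).
rewrite mulr_sumr [LHS]mpolyE; apply: eq_big_seq => m /h hm.
rewrite -scalerAr XpE -mpolyXD; congr (_ *: 'X_[_]); apply/mnmP => j.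
rewrite mnmDE mnmBE mulmnE mnm1E; have [<-|_] := eqVneq i j; last by lia.
by rewrite mul1n subnKC.
Qed.

Definition mon_restr (P : pred 'X_{1..3}) p : S := \sum_(m <- msupp p | P m) p@_m *: 'X_[m].

Lemma mon_restrE P p m : (mon_restr P p)@_m = if P m then p@_m else 0.
Proof.
rewrite /mon_restr raddf_sum /= -big_filter.
have [mp|mp] := boolP (m \in [seq i <- msupp p | P i]).
  rewrite (bigD1_seq m) ?filter_uniq ?msupp_uniq //= mcoeffZ mcoeffX eqxx mulr1.
  rewrite mem_filter in mp; case/andP: mp => -> _.
  rewrite big1 ?addr0 // => i ne; rewrite mcoeffZ mcoeffX.
  by rewrite (negbTE ne) mulr0.
rewrite big_seq big1 => [|i ip]; last first.
  by rewrite mcoeffZ mcoeffX; case: eqP => [e|_]; rewrite ?mulr0 // -e ip in mp *.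
move: mp; rewrite mem_filter; case: ifP => //= _ mp.
by rewrite memN_msupp_eq0.
Qed.

Lemma mon_restrD P p : p = mon_restr (predC P) p + mon_restr P p.
Proof.
by apply/mpolyP => m; rewrite mcoeffD !mon_restrE /=; case: (P m); rewrite ?addr0 ?add0r.
Qed.

Lemma Xp_divmod i p : exists q r, p = Xp i * q + r /\
  forall m, m \in msupp r -> m \in msupp p /\ (m i < n)%N.
Proof.
pose P := fun m : 'X_{1..3} => (m i < n)%N.
have [q hq] : exists q, mon_restr (predC P) p = Xp i * q.
  apply: Xp_divide => m; rewrite mcoeff_msupp mon_restrE /= /P -leqNgt.
  by case: ifP; rewrite ?eqxx.
exists q, (mon_restr P p); split; first by rewrite -hq -mon_restrD.
by move=> m; rewrite !mcoeff_msupp mon_restrE /P; case: ifP; rewrite ?eqxx.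
Qed.

(** Divide p by x_j^n with remainder r.  No monomial of x_i^n r is divisible by
    x_j^n, while x_i^n r is a multiple of x_j^n; so r = 0. *)
Lemma Xp_cross i j p q : i != j -> Xp i * p = Xp j * q ->
  exists e, p = Xp j * e /\ q = Xp i * e.
Proof.
move=> ne e; have [a [r [ep hr]]] := Xp_divmod j p.
have e' : Xp i * r = Xp j * (q - Xp i * a).
  by rewrite mulrBr -e ep; ring.
have r0 : r = 0.
  apply/eqP; apply: contraT => rn0.
  have : Xp i * r != 0 by rewrite mulf_neq0 ?Xp_neq0.
  rewrite -msupp_eq0; case E : (msupp (Xp i * r)) => [//|m s] _.
  have mX : m \in msupp (Xp i * r) by rewrite E inE eqxx.
  have mj : (m j < n)%N.
    have [m' /hr[_ h] ->] := msupp_XpM mX.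
    by rewrite mnmDE mulmnE mnm1E (negbTE ne) mul0n.
  by move: mX; rewrite mcoeff_msupp e' Xp_coeff_lt // eqxx.
exists a; move: ep; rewrite r0 addr0 => ep; split=> //.
by apply: (mulfI (Xp_neq0 j)); rewrite -e ep; ring.
Qed.

Local Notation x := (Xp 0).
Local Notation y := (Xp 1).
Local Notation z := (Xp 2%:R).

(** Remove from a all monomials divisible by x^n or y^n.  For the rest s, no
    monomial of z^n s is divisible by x^n or y^n, while the relation puts z^n s in
    the ideal of x^n and y^n; so s = 0, and the two-variable case remains. *)
Lemma Xp_koszul (a b c : S) : z * a - y * b + x * c = 0 ->
  exists c1 c2 c3, [/\ a = y * c1 - x * c2, b = z * c1 - x * c3 & c = z * c2 - y * c3].
Proof.
move=> e; have [q [r' [ea hr']]] := Xp_divmod 0 a.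
have [r [s [er hs]]] := Xp_divmod 1 r'.
have zs : z * s = y * (b - z * r) - x * (c + z * q).
  by apply/eqP; rewrite -subr_eq0; apply/eqP; rewrite -[RHS]e ea er; ring.
have s0 : s = 0.
  apply/eqP; apply: contraT => sn0.
  have : z * s != 0 by rewrite mulf_neq0 ?Xp_neq0.
  rewrite -msupp_eq0; case E : (msupp (z * s)) => [//|m l] _.
  have mX : m \in msupp (z * s) by rewrite E inE eqxx.
  have [m0 m1] : (m 0%R < n)%N /\ (m 1%R < n)%N.
    have [m' /hs[/hr'[_ h0] h1] ->] := msupp_XpM mX.
    by rewrite !mnmDE !mulmnE !mnm1E !mul0n !add0n.
  by move: mX; rewrite mcoeff_msupp zs mcoeffB !Xp_coeff_lt // subr0 eqxx.
have [|t [et1 et2]] := @Xp_cross 1 0 (b - z * r) (c + z * q) isT.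
  by apply/eqP; rewrite -subr_eq0 -zs s0 mulr0.
exists r, (- q), (- t); split.
- by rewrite ea er s0; ring.
- by rewrite -[LHS](subrK (z * r)) et1; ring.
- by rewrite -[LHS](addrK (z * q)) et2; ring.
Qed.

Lemma Xp_regular : koszul_regular Xp.
Proof.
split; first exact: Xp_neq0.
  by move=> a b /(@Xp_cross 1 0 _ _ isT)[e [? _]]; exists e.
exact: Xp_koszul.
Qed.

End PowersOfVariables.

Lemma ord3_ind (P : 'I_3 -> Prop) : P 0 -> P 1 -> P 2%:R -> forall i, P i.
Proof.
by move=> p0 p1 p2 [[|[|[|//]]] h]; [move: p0 | move: p1 | move: p2];
  congr P; apply/val_inj.
Qed.

Lemma sum3E (V : nmodType) (F : 'I_3 -> V) : \sum_i F i = F 0 + F 1 + F 2%:R.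
Proof.
rewrite !big_ord_recl big_ord0 addr0 addrA; congr (F _ + F _ + F _); exact/val_inj.
Qed.

Lemma row3P (T : Type) (u v : 'rV[T]_3) : u 0 0 = v 0 0 -> u 0 1 = v 0 1 ->
  u 0 2%:R = v 0 2%:R -> u = v.
Proof. by move=> h0 h1 h2; apply/rowP; apply: ord3_ind. Qed.

Section Depth.
Variables (S : idomainType) (X : 'I_3 -> S).
Hypothesis reg : koszul_regular X.

Lemma rV0_all (r : nat) (u v : 'rV[S]_0) : u = v.
Proof. by apply/rowP; case. Qed.

(** A staircase for a resolution of length two ends in F_3 = 0, so its other end is
    0 as well: the cokernel of A1 has no element killed by x, y and z. *)
Lemma depth2 n0 n1 n2 (A1 : 'M[S]_(n1, n0)) (A2 : 'M[S]_(n2, n1)) (u : 'rV_n0) :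
  (forall u : 'rV_n1, u *m A1 = 0 <-> exists w : 'rV_n2, w *m A2 = u) ->
  (forall u : 'rV_n2, u *m A2 = 0 -> u = 0) ->
  (forall i, exists a, X i *: u = a *m A1) -> exists a, a *m A1 = u.
Proof.
move=> ex1 inj hu; pose A3 : 'M[S]_(0, n2) := 0.
have ex2 (w : 'rV_n2) : w *m A2 = 0 <-> exists w' : 'rV_0, w' *m A3 = w.
  split=> [/inj->|[w' <-]]; first by exists 0; rewrite mul0mx.
  by rewrite mulmx0 mul0mx.
have [h ch] := chase_left (X := X) ex1 ex2 hu.
apply/(chase_iff reg ex1 ex2 _ ch); first by move=> w _; apply: rV0_all.
by exists 0, 0, 0; apply: rV0_all.
Qed.

Lemma depth1 n0 n1 (A1 : 'M[S]_(n1, n0)) (u : 'rV_n0) :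
  (forall u : 'rV_n1, u *m A1 = 0 -> u = 0) ->
  (forall i, exists a, X i *: u = a *m A1) -> exists a, a *m A1 = u.
Proof.
move=> inj; apply: (@depth2 _ _ _ _ (0 : 'M_(0, n1))); last by move=> w _; apply: rV0_all.
move=> w; split=> [/inj->|[w' <-]]; first by exists 0; rewrite mul0mx.
by rewrite mulmx0 mul0mx.
Qed.

End Depth.

(** * Exactness of the Koszul complex *)

Section Koszul.
Variables (S : idomainType) (X : 'I_3 -> S).
Variables g0 g1 g2 : S.

Definition ideal3 : set S := [set p | exists a b c, p = a * g0 + b * g1 + c * g2].

Definition koszul1 : 'M[S]_(3, 1) := \matrix_(i, j) [:: g0; g1; g2]`_i.

(** The rows are the Koszul relations of g_0, g_1, g_2 for the pairs 01, 02, 12. *)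
Definition koszul2 : 'M[S]_3 := \matrix_(i, j)
  nth 0 (nth [::] [:: [:: g1; - g0; 0]; [:: g2; 0; - g0]; [:: 0; g2; - g1]] i) j.

Definition koszul3 : 'M[S]_(1, 3) := \matrix_(i, j) [:: g2; - g1; g0]`_j.

Lemma koszul1E (u : 'rV_3) j : (u *m koszul1) 0 j = u 0 0 * g0 + u 0 1 * g1 + u 0 2%:R * g2.
Proof. by rewrite mxE sum3E !mxE. Qed.

Lemma koszul2E (u : 'rV_3) : u *m koszul2 = \row_j
  [:: u 0 0 * g1 + u 0 1 * g2; - u 0 0 * g0 + u 0 2%:R * g2; 
      - u 0 1 * g0 - u 0 2%:R * g1]`_j.
Proof.
by apply: row3P; rewrite !mxE sum3E !mxE /= ?mulr0; ring.
Qed.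

Lemma koszul3E (u : 'rV_1) : u *m koszul3 = \row_j
  [:: u 0 0 * g2; - u 0 0 * g1; u 0 0 * g0]`_j.
Proof.
by apply: row3P; rewrite !mxE big_ord1 !mxE //= ; ring.
Qed.

Hypothesis reg : koszul_regular X.
Hypothesis gX : forall i, ideal3 (X i).

(** Some g_j is nonzero because x lies in the ideal they generate. *)
Lemma koszul3_inj (u : 'rV_1) : u *m koszul3 = 0 -> u = 0.
Proof.
rewrite koszul3E => /rowP h; apply/rowP => j; rewrite ord1 mxE.
apply: contrapT => /eqP u0; have [/eqP x0 _ _] := reg; apply: x0.
have [a [b [c ->]]] := gX 0.
have := h 0; have := h 1; have := h 2%:R; rewrite !mxE /= => /eqP e2 /eqP e1 /eqP e0.
by move: e0 e1 e2; rewrite !mulf_eq0 oppr_eq0 (negbTE u0) /= => /eqP-> /eqP-> /eqP->; ring.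
Qed.

(** Multiplication by each g_j, hence by x, y and z, sends a cycle to a boundary;
    then [depth1] makes the cycle itself a boundary. *)
Lemma koszul2_exact (u : 'rV_3) : u *m koszul2 = 0 <-> exists w : 'rV_1, w *m koszul3 = u.
Proof.
split=> [|[w <-]]; last first.
  by rewrite koszul3E koszul2E; apply: row3P; rewrite !mxE /=; ring.
rewrite koszul2E => /rowP h.
have := h 0; have := h 1; have := h 2%:R; rewrite !mxE /= => {h} e2 e1 e0.
apply: (depth1 reg koszul3_inj) => i; have [c0 [c1 [c2 ->]]] := gX i.
exists (c0 * u 0 2%:R - c1 * u 0 1 + c2 * u 0 0)%:M.
rewrite koszul3E; apply: row3P; rewrite !mxE /= !mulr1n; apply: subr0_eq.
- transitivity (c1 * (u 0 0 * g1 + u 0 1 * g2) - c0 * (- u 0 0 * g0 + u 0 2%:R * g2)).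
    by ring.
  by rewrite e0 e1; ring.
- transitivity (c2 * (u 0 0 * g1 + u 0 1 * g2) - c0 * (- u 0 1 * g0 - u 0 2%:R * g1)).
    by ring.
  by rewrite e0 e2; ring.
- transitivity (c2 * (- u 0 0 * g0 + u 0 2%:R * g2) - c1 * (- u 0 1 * g0 - u 0 2%:R * g1)).
    by ring.
  by rewrite e1 e2; ring.
Qed.

(** As for [koszul2_exact], one step further down the complex. *)
Lemma koszul1_exact (u : 'rV_3) : u *m koszul1 = 0 <-> exists w : 'rV_3, w *m koszul2 = u.
Proof.
split=> [/rowP/(_ 0)|[w <-]]; last first.
  by apply/rowP => j; rewrite ord1 koszul1E koszul2E !mxE /=; ring.
rewrite koszul1E mxE => e.
apply: (depth2 reg koszul2_exact koszul3_inj) => i.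
have [c0 [c1 [c2 ->]]] := gX i.
exists (\row_j [:: - c0 * u 0 1 + c1 * u 0 0; - c0 * u 0 2%:R + c2 * u 0 0;
   - c1 * u 0 2%:R + c2 * u 0 1]`_j).
rewrite koszul2E; apply: row3P; rewrite !mxE /=; apply: subr0_eq.
- transitivity (c0 * (u 0 0 * g0 + u 0 1 * g1 + u 0 2%:R * g2)); first by ring.
  by rewrite e mulr0.
- transitivity (c1 * (u 0 0 * g0 + u 0 1 * g1 + u 0 2%:R * g2)); first by ring.
  by rewrite e mulr0.
- transitivity (c2 * (u 0 0 * g0 + u 0 1 * g1 + u 0 2%:R * g2)); first by ring.
  by rewrite e mulr0.
Qed.

End Koszul.

Section KoszulResolution.
Variable K : fieldType.
Local Notation S := {mpoly K[3]}.
Variables (g0 g1 g2 : S) (n : nat).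
Hypothesis gX : forall i, ideal3 g0 g1 g2 (Xp K n i).
Variables e0 e1 e2 : int.
Hypotheses (gr0 : graded_piece e0 g0) (gr1 : graded_piece e1 g1) (gr2 : graded_piece e2 g2).

(** Forms whose ideal contains powers of the variables are resolved by their
    Koszul complex. *)
Lemma koszul_resolution : graded_resolution (ideal3 g0 g1 g2) (fun i : 'I_3 => [:: e0; e1; e2]`_i)
  (fun i : 'I_3 => [:: e0 + e1; e0 + e2; e1 + e2]`_i) (fun _ : 'I_1 => e0 + e1 + e2)
  (koszul1 g0 g1 g2) (koszul2 g0 g1 g2) (koszul3 g0 g1 g2).
Proof.
have reg := Xp_regular K n.
have add a b c (p : S) : graded_piece a p -> a = b - c -> graded_piece (b - c) p.
  by move=> h <-.
split; split.
- by apply: ord3_ind => j; rewrite mxE subr0.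
- apply: ord3_ind; apply: ord3_ind; rewrite mxE /=; try exact: graded0;
    try apply: gradedN; (apply: add; [eassumption | ring]).
- move=> j; apply: ord3_ind; rewrite mxE /=; try apply: gradedN;
    (apply: add; [eassumption | ring]).
- move=> p; split=> [[a [b [c ->]]]|[u <-]].
    by exists (\row_j [:: a; b; c]`_j); rewrite koszul1E !mxE.
  by rewrite koszul1E; exists (u 0 0), (u 0 1), (u 0 2%:R).
- exact: (koszul1_exact reg gX).
- exact: (koszul2_exact reg gX).
- exact: (koszul3_inj reg gX).
Qed.

End KoszulResolution.

(** * The monomial pairing *)

Section Apolarity.
Variable K : fieldType.
Local Notation S := {mpoly K[3]}.
Local Notation iotaS := (@iotaS K).
Variable n : nat.
Hypothesis n_gt0 : (0 < n)%N.

Definition Xideal : set S := ideal3 (Xp K n 0) (Xp K n 1) (Xp K n 2%:R).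

(** (x^n, y^n, z^n) is a monomial ideal. *)
Lemma XidealP (p : S) : Xideal p <-> forall m, m \in msupp p -> exists i, (n <= m i)%N.
Proof.
split=> [[a [b [c ->]]] m|h].
  rewrite mcoeff_msupp => hm; apply: contrapT => hn.
  have lt i : (m i < n)%N by rewrite ltnNge; apply/negP => ?; apply: hn; exists i.
  move: hm; rewrite !mcoeffD ![_ * Xp _ _ _]mulrC.
  by rewrite !Xp_coeff_lt ?lt // !addr0 eqxx.
pose P (i : 'I_3) := fun m : 'X_{1..3} => (n <= m i)%N.
have div (i : 'I_3) (q : S) : exists c, mon_restr (P i) q = c * Xp K n i.
  have [m|c ->] := @Xp_divide K n i (mon_restr (P i) q); last by exists c; rewrite mulrC.
  by rewrite mcoeff_msupp mon_restrE /P; case: ifP; rewrite ?eqxx.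
rewrite (mon_restrD (P 0) p); set p1 := mon_restr (predC _) p.
rewrite (mon_restrD (P 1) p1); set p2 := mon_restr (predC _) p1.
rewrite (mon_restrD (P 2%:R) p2).
have [a ->] := div 0 p; have [b ->] := div 1 p1; have [c ->] := div 2%:R p2.
suff -> : mon_restr (predC (P 2%:R)) p2 = 0 by exists a, b, c; ring.
apply/mpolyP => m; rewrite /p2 /p1 !mon_restrE mcoeff0 /= /P.
case: ifP => // h2; case: ifP => // h1; case: ifP => // h0.
apply/memN_msupp_eq0/negP => hm; have [t] := h m hm; move: t; apply: ord3_ind => hi.
- by rewrite hi in h0.
- by rewrite hi in h1.
- by rewrite hi in h2.
Qed.

Lemma Xp_inP r (u : 'rV[S]_r) : in_regular (Xp K n) u <-> forall j, Xideal (u 0 j).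
Proof.
split=> [[a [b [c ->]]] j|h].
  by exists (a 0 j), (b 0 j), (c 0 j); rewrite !mxE; ring.
have /choice[w hw] : forall j, exists w : S * S * S, u 0 j =
    w.1.1 * Xp K n 0 + w.1.2 * Xp K n 1 + w.2 * Xp K n 2%:R.
  by move=> j; have [a [b [c ->]]] := h j; exists (a, b, c).
exists (\row_k (w k).1.1), (\row_k (w k).1.2), (\row_k (w k).2).
by apply/rowP => j; rewrite !mxE hw; ring.
Qed.

Definition top_mon : 'X_{1..3} := [multinom n.-1 | _ < 3].

(** The coefficient of u h at the socle monomial of S / (x^n, y^n, z^n). *)
Definition pairing (u h : S) : K := (u * h)@_top_mon.

Lemma pairingDl c u v h : pairing (c *: u + v) h = c * pairing u h + pairing v h.
Proof. by rewrite /pairing mulrDl mcoeffD -scalerAl mcoeffZ. Qed.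

Lemma pairingDr c u v h : pairing h (c *: u + v) = c * pairing h u + pairing h v.
Proof. by rewrite /pairing mulrDr mcoeffD -scalerAr mcoeffZ. Qed.

Lemma pairing0r h : pairing h 0 = 0.
Proof. by rewrite /pairing mulr0 mcoeff0. Qed.

Lemma pairing0l h : pairing 0 h = 0.
Proof. by rewrite /pairing mul0r mcoeff0. Qed.

Lemma pairing_suml I (r : seq I) (c : I -> K) (F : I -> S) h :
  pairing (\sum_(i <- r) c i *: F i) h = \sum_(i <- r) c i * pairing (F i) h.
Proof.
elim: r => [|i r ih]; first by rewrite !big_nil pairing0l.
by rewrite !big_cons pairingDl ih.
Qed.

Lemma pairing_sumr I (r : seq I) (c : I -> K) (F : I -> S) h :
  pairing h (\sum_(i <- r) c i *: F i) = \sum_(i <- r) c i * pairing h (F i).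
Proof.
elim: r => [|i r ih]; first by rewrite !big_nil pairing0r.
by rewrite !big_cons pairingDr ih.
Qed.

Lemma pairingMl a u h : pairing (a * u) h = pairing a (u * h).
Proof. by rewrite /pairing mulrA. Qed.

Lemma pairingX m h : (m <= top_mon)%MM -> pairing 'X_[m] h = h@_(top_mon - m).
Proof.
move=> le; rewrite /pairing mulrC.
by rewrite -{1}(submK le) addmC mcoeffMX.
Qed.

Variables (i j : int).
Hypothesis ij : i + j = 3 * (n%:Z - 1).

Lemma mdeg_top : (mdeg top_mon)%:Z = i + j.
Proof. by rewrite ij mdegE sum3E !mnmE; lia. Qed.

Lemma le_topP (m : 'X_{1..3}) : reflect (forall t, (m t < n)%N) (m <= top_mon)%MM.
Proof.
apply: (iffP mnm_lepP) => h t; have := h t; rewrite mnmE; lia.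
Qed.

Lemma mdeg_top_sub (m : 'X_{1..3}) : (m <= top_mon)%MM -> (mdeg (top_mon - m)%MM)%:Z = i + j - (mdeg m)%:Z.
Proof. by move=> le; rewrite -mdeg_top -{2}(submK le) mdegD; lia. Qed.

(** A monomial of h outside the ideal divides the socle monomial, and pairing h
    with the complementary monomial reads off its coefficient. *)
Lemma XidealE h : graded_piece i h ->
  Xideal h <-> forall u, graded_piece j u -> pairing u h = 0.
Proof.
move=> hi; split=> [/XidealP hX u _|hp].
  apply/memN_msupp_eq0/negP => ht.
  have [|t] := (XidealP (u * h)).1 _ top_mon ht; last by rewrite mnmE; lia.
  by have [a [b [c ->]]] := (XidealP h).2 hX; exists (u * a), (u * b), (u * c); ring.
apply/XidealP => m hm; apply: contrapT => hn.
have le : (m <= top_mon)%MM.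
  by apply/le_topP => t; rewrite ltnNge; apply/negP => ?; apply: hn; exists t.
have := hp 'X_[top_mon - m].
rewrite pairingX ?lem_subr // submBA // addmC addmK => h0.
move: (hm); rewrite mcoeff_msupp h0 ?eqxx //.
have : (mdeg (top_mon - m)%MM)%:Z = j by rewrite mdeg_top_sub // (hi _ hm) addrAC subrr add0r.
by move=> <-; apply: gradedMon.
Qed.

Hypothesis ltjn : j < n%:Z.

(** The bound j < n makes every monomial of degree j a divisor of the socle
    monomial, so h can be written down coefficient by coefficient. *)
Lemma pairing_repr (phi : S -> K) :
  (forall c u v, graded_piece j u -> graded_piece j v -> phi (c *: u + v) = c * phi u + phi v) ->
  exists2 h, graded_piece i h & forall u, graded_piece j u -> pairing u h = phi u.
Proof.
move=> lin; have phi0 : phi 0 = 0.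
  have := lin 1 0 0 (graded0 j) (graded0 j); rewrite scale1r addr0 mul1r.
  by move=> /eqP; rewrite -subr_eq subrr eq_sym => /eqP.
have phi_sum (I : Type) (r : seq I) (P : pred I) (c : I -> K) (F : I -> S) :
    (forall t, P t -> graded_piece j (F t)) ->
    phi (\sum_(t <- r | P t) c t *: F t) = \sum_(t <- r | P t) c t * phi (F t).
  move=> hF; elim: r => [|t r ih]; first by rewrite !big_nil.
  rewrite !big_cons; case: ifP => // Pt; rewrite lin ?ih //; first exact: hF.
  by apply: graded_sum => t' Pt'; apply/gradedZ/hF.
have jle (m : 'X_{1..3}) : (mdeg m)%:Z = j -> (m <= top_mon)%MM.
  move=> mj; apply/le_topP => t; suff : (m t <= mdeg m)%N by lia.
  by rewrite mdegE (bigD1 t) //= leq_addr.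
(* bounds the degrees of the divisors of the socle monomial *)
pose N := (mdeg top_mon).+1.
pose h : S := \sum_(m : 'X_{1..3 < N} | (mdeg m)%:Z == j) phi 'X_[m] *: 'X_[top_mon - m].
have hh : graded_piece i h.
  apply: graded_sum => m /eqP mj; apply: gradedZ.
  have -> : i = (mdeg (top_mon - m)%MM)%:Z by rewrite mdeg_top_sub ?jle // mj; ring.
  exact: gradedMon.
exists h => // u hu.
rewrite [u in LHS]mpolyE [u in RHS]mpolyE pairing_suml.
rewrite [X in phi X]big_seq phi_sum; last first.
  by move=> m /hu <-; apply: gradedMon.
rewrite [LHS]big_seq; apply: eq_bigr => m /hu mj; congr (_ * _).
have le := jle m mj.
rewrite pairingX // /h raddf_sum /=.
have ltN : (mdeg m < N)%N.
  by rewrite /N ltnS -(submK le) mdegD leq_addl.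
rewrite (bigD1 (BMultinom ltN)) /= ?mj ?eqxx // mcoeffZ mcoeffX eqxx mulr1.
rewrite big1 ?addr0 // => m' /andP[/eqP m'j ne].
rewrite mcoeffZ mcoeffX; case: eqP => [e|_]; last by rewrite mulr0.
case/eqP: ne; apply/val_inj => /=.
have subK (m1 : 'X_{1..3}) : (m1 <= top_mon -> top_mon - (top_mon - m1) = m1)%MM.
  by move=> le1; rewrite submBA // addmC addmK.
by rewrite -(subK _ (jle _ m'j)) e subK.
Qed.

End Apolarity.

(** * Local duality *)

Section LocalDuality.
Variable K : fieldType.
Local Notation S := {mpoly K[3]}.
Local Notation iotaS := (@iotaS K).
Variables (I : set S) (n1 n2 : nat) (a1 : 'I_n1 -> int) (a2 : 'I_n2 -> int) (b : int).
Variables (A1 : 'M[S]_(n1, 1)) (A2 : 'M[S]_(n2, n1)) (A3 : 'M[S]_(1, n2)).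
Hypothesis res : graded_resolution I a1 a2 (fun _ : 'I_1 => b) A1 A2 A3.

Definition last_ideal : set S := [set p | exists c : 'I_n2 -> S, p = \sum_l c l * A3 0 l].

Lemma subspace_last : subspace iotaS (last_ideal : set S^o).
Proof.
split=> [|c _ _ [u ->] [v ->]]; first by exists (fun=> 0); rewrite big1 // => l _; rewrite mul0r.
exists (fun l => iotaS c * u l + v l).
rewrite -[LHS]/(iotaS c * _ + _) mulr_sumr -big_split; apply: eq_bigr => l _.
by rewrite /=; ring.
Qed.

Lemma last_idealM p q : last_ideal q -> last_ideal (p * q).
Proof.
move=> [c ->]; exists (fun l => p * c l); rewrite mulr_sumr.
by apply: eq_bigr => l _; rewrite mulrA.
Qed.

Lemma last_ideal_gen l : last_ideal (A3 0 l).
Proof.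
exists (fun l' => if l' == l then 1 else 0); rewrite (bigD1 l) //= eqxx mul1r.
by rewrite big1 ?addr0 // => l' /negbTE ->; rewrite mul0r.
Qed.

Lemma gradedA3 l : graded_piece (b - a2 l) (A3 0 l).
Proof. by case: res => [[_ _ h] _]. Qed.

Arguments gradedA3 : clear implicits.

Lemma resM p q : I q -> I (p * q).
Proof.
have [_ [hI _ _ _]] := res; move=> /hI[u <-]; apply/hI; exists (p *: u).
by rewrite -scalemxAl mxE.
Qed.

Section FixedPower.
Variables (n : nat) (k : int).
Hypothesis n_gt0 : (0 < n)%N.

(** The forms of degree k that the powers of the variables multiply into I; for
    large n these are the forms of degree k in the saturation of I. *)
Definition torsion : set S := [set u | graded_piece k u /\ forall i, I (Xp K n i * u)].

Lemma subspace_torsion : subspace iotaS (torsion : set S^o).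
Proof.
have sI := res_subspace res.
split=> [|c u v [hu iu] [hv iv]]; split.
- exact: graded0.
- by move=> i; rewrite mulr0; case: sI.
- by case: (subspace_graded K k) => _; apply.
- move=> i; have [_ h] := sI; have := h c _ _ (iu i) (iv i); congr I.
  rewrite -[RHS]/(Xp K n i * (iotaS c * u + v)) -[LHS]/(iotaS c * _ + _).
  by ring.
Qed.

(** The other end of the staircases that start in [torsion]. *)
Definition ann : set S := [set h | graded_piece (k + 3 * n%:Z - b) h /\
  forall l, Xideal n (h * A3 0 l)].

Definition ann0 : set S := [set h | graded_piece (k + 3 * n%:Z - b) h /\ Xideal n h].

Lemma subspace_ann : subspace iotaS (ann : set S^o).
Proof.
split=> [|c u v [hu iu] [hv iv]]; split.
- exact: graded0.
- by move=> l; exists 0, 0, 0; ring.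
- by case: (subspace_graded K (k + 3 * n%:Z - b)) => _; apply.
- move=> l; have [p0 [p1 [p2 e]]] := iu l; have [q0 [q1 [q2 f]]] := iv l.
  exists (iotaS c * p0 + q0), (iotaS c * p1 + q1), (iotaS c * p2 + q2).
  rewrite -[LHS]/((iotaS c * u + v) * _) mulrDl -mulrA e f; ring.
Qed.

Lemma gradedXp i : graded_piece n%:Z (Xp K n i).
Proof. by rewrite XpE; have := @gradedMon K (U_(i) *+ n)%MM; rewrite mdegMn mdeg1 mul1n. Qed.

Arguments gradedXp : clear implicits.

Lemma chase_hcomp (u : 'rV[S]_1) h : @chase _ (Xp K n) _ _ _ _ A1 A2 A3 u h ->
  @chase _ (Xp K n) _ _ _ _ A1 A2 A3 (compv (fun _ : 'I_1 => 0) k u) (compv (fun _ : 'I_1 => b) (k + 3 * n%:Z) h).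
Proof.
have [[g1 g2 g3] _] := res.
move=> [x0 [x1 [x2 [b01 [b02 [b12 [[e0 e1 e2] [f01 f02 f12 f]]]]]]]].
exists (compv a1 (k + n%:Z) x0), (compv a1 (k + n%:Z) x1), (compv a1 (k + n%:Z) x2).
exists (compv a2 (k + 2 * n%:Z) b01), (compv a2 (k + 2 * n%:Z) b02), (compv a2 (k + 2 * n%:Z) b12).
have c1 i (v : 'rV[S]_1) : Xp K n i *: compv (fun _ => 0) k v = compv (fun _ => 0) (k + n%:Z) (Xp K n i *: v).
  by rewrite (compvZ _ _ _ (gradedXp i)) addrK.
have c2 i (v : 'rV[S]_n1) : Xp K n i *: compv a1 (k + n%:Z) v = compv a1 (k + 2 * n%:Z) (Xp K n i *: v).
  by rewrite (compvZ _ _ _ (gradedXp i)); congr (_ *: compv _ _ _); ring.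
have c3 i (v : 'rV[S]_n2) : Xp K n i *: compv a2 (k + 2 * n%:Z) v = compv a2 (k + 3 * n%:Z) (Xp K n i *: v).
  by rewrite (compvZ _ _ _ (gradedXp i)); congr (_ *: compv _ _ _); ring.
split; split.
- by rewrite c1 e0 (compv_mulmx _ _ g1).
- by rewrite c1 e1 (compv_mulmx _ _ g1).
- by rewrite c1 e2 (compv_mulmx _ _ g1).
- by rewrite !c2 -compvB f01 (compv_mulmx _ _ g2).
- by rewrite !c2 -compvB f02 (compv_mulmx _ _ g2).
- by rewrite !c2 -compvB f12 (compv_mulmx _ _ g2).
- by rewrite !c3 -compvB -compvD f (compv_mulmx _ _ g3).
Qed.

Lemma mulA3E (h : 'rV[S]_1) l : (h *m A3) 0 l = h 0 0 * A3 0 l.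
Proof. by rewrite mxE big_ord1. Qed.

(** The staircase identifies torsion modulo I with the annihilator of the last map
    modulo (x^n, y^n, z^n). *)
Lemma torsion_ann m : qdim iotaS (ann : set S^o) ann0 m ->
  qdim iotaS (torsion : set S^o) (graded_piece k `&` I) m.
Proof.
have [_ [hI ex1 ex2 ex3]] := res.
pose rel (h u : S^o) := @chase _ (Xp K n) _ _ _ _ A1 A2 A3 (const_mx u) (const_mx h).
apply: (@qdim_transfer _ _ _ iotaS iotaS _ _ rel).
- by have := chase0 (Xp K n) A1 A2 A3; congr chase; apply/rowP => i; rewrite !mxE.
- move=> c h h' u u' r r'; have := chaseD (iotaS c) r r'; congr chase.
  + by apply/rowP => i; rewrite !mxE.
  + by apply/rowP => i; rewrite !mxE.
- exact: subspace_ann.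
- exact: subspace_torsion.
- move=> h [gh hX].
  have [|u ch] := chase_right (A3 := A3) (Xp_regular K n) ex1 ex2 (h := const_mx h).
    by apply/Xp_inP => l; rewrite mulA3E mxE.
  exists (hcomp k (u 0 0)).
    split=> [|i]; first exact: hcomp_graded.
    have [x0 [x1 [x2 [_ [_ [_ [[e0 e1 e2] _]]]]]]] := chase_hcomp ch.
    have : exists x, Xp K n i *: compv (fun=> 0) k u = x *m A1.
      by move: i; apply: ord3_ind; [exists x0 | exists x1 | exists x2].
    move=> [x ex]; apply/hI; exists x; rewrite -ex !mxE subr0 //.
  have := chase_hcomp ch; rewrite /rel; congr chase; apply/rowP => i; rewrite !mxE.
    by rewrite ord1 subr0.
  by rewrite hcomp_id.
- move=> u [gu iu].
  have [|h ch] := chase_left ex1 ex2 (u := const_mx u) (X := Xp K n).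
    move=> i; have /hI[x ex] := iu i; exists x; apply/rowP => j.
    by rewrite ord1 ex !mxE.
  exists (hcomp (k + 3 * n%:Z - b) (h 0 0)).
    split; first exact: hcomp_graded.
    have /Xp_inP hX := chase_in (chase_hcomp ch).
    by move=> l; have := hX l; rewrite mulA3E mxE.
  have := chase_hcomp ch; rewrite /rel; congr chase; apply/rowP => i; rewrite !mxE.
    by rewrite subr0 hcomp_id.
  by rewrite ord1.
- move=> h u [gh _] [gu _] ch.
  have iff := chase_iff (Xp_regular K n) ex1 ex2 ex3 ch; split=> [[_ hX]|[_ /hI[x ex]]].
    split=> //; have [|x ex] := iff.2 _; last by apply/hI; exists x; rewrite ex mxE.
    by apply/Xp_inP => l; rewrite mxE.
  have ex' : x *m A1 = const_mx u by apply/rowP => l; rewrite ord1 ex mxE.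
  by have /Xp_inP/(_ 0) := iff.1 (ex_intro _ x ex'); rewrite mxE.
Qed.

Variable j : int.
Hypothesis jk : j = b - 3 - k.
Hypothesis ltjn : j < n%:Z.

(** The annihilator of the last map is the orthogonal of its ideal for the
    pairing, so a basis of S_j modulo that ideal has a dual basis in it. *)
Lemma ann_dual m : qdim iotaS (graded_piece j : set S^o) (graded_piece j `&` last_ideal) m ->
  qdim iotaS (ann : set S^o) ann0 m.
Proof.
move=> [v [hv fv pv]].
have sJ := subspaceSI j subspace_last.
set i := k + 3 * n%:Z - b.
have ij : i + j = 3 * (n%:Z - 1) by rewrite /i jk; ring.
have annP h : ann h <-> graded_piece i h /\ forall u, graded_piece j u -> last_ideal u -> pairing n u h = 0.
  split=> [[gh hX]|[gh hp]]; split=> //.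
    move=> u gu [c eu]; rewrite eu.
    have ->: \sum_l c l * A3 0 l = \sum_l (1 : K) *: (c l * A3 0 l).
      by apply: eq_bigr => l _; rewrite scale1r.
    rewrite pairing_suml big1 // => l _; rewrite mul1r.
    have /XidealP hX' := hX l; apply/memN_msupp_eq0/negP => ht.
    have [|t] := (@XidealP K n (c l * A3 0 l * h)).1 _ (top_mon n) ht.
      have [p0 [p1 [p2 e]]] := hX l; exists (c l * p0), (c l * p1), (c l * p2).
      by rewrite -mulrA [A3 0 l * h]mulrC e; ring.
    by rewrite mnmE; lia.
  move=> l; have gl := gradedM gh (gradedA3 l).
  apply/(@XidealE _ n n_gt0 _ (j - (b - a2 l)) _ _ gl); first by rewrite -ij; ring.
  move=> u gu; rewrite mulrC -pairingMl; apply: hp.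
    by have := gradedM gu (gradedA3 l); rewrite subrK.
  by apply: last_idealM; apply: last_ideal_gen.
have /choice[cf hcf] : forall u, exists c : 'I_m -> K, graded_piece j u ->
    (graded_piece j `&` last_ideal) (u - \sum_s iotaS (c s) * v s).
  move=> u; have [gu|ngu] := pselect (graded_piece j u); last by exists (fun=> 0).
  by have [c hc] := pv u gu; exists c.
have cfE u (c : 'I_m -> K) : graded_piece j u -> last_ideal (u - \sum_s iotaS (c s) * v s) -> cf u = c.
  move=> gu hc; apply/funext => s; apply/eqP; rewrite -subr_eq0; apply/eqP.
  pose c' := fun s => cf u s - c s; rewrite -/(c' s); move: s; apply: fv; split.
    apply: graded_sum => s _; have := gradedZ (c' s) (hv s).
    by rewrite -iotaSE.
  have [_ h] := hcf u gu; have [_ sl] := subspace_last.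
  have := sl (-1) _ _ h hc; congr last_ideal.
  rewrite -[LHS]/(iotaS (-1) * _ + _) rmorphN1 mulN1r opprB addrA subrK -sumrB.
  by apply: eq_bigr => s _; rewrite -[RHS]/(iotaS _ * _) rmorphB mulrBl.
have cflin s c u w : graded_piece j u -> graded_piece j w -> 
    cf (c *: u + w) s = c * cf u s + cf w s.
  move=> gu gw; rewrite (@cfE _ (fun s => c * cf u s + cf w s)) //.
    by apply: gradedD => //; apply: gradedZ.
  have [_ h] := hcf u gu; have [_ h'] := hcf w gw; have [_ sl] := subspace_last.
  have := sl c _ _ h h'; congr last_ideal.
  rewrite -iotaSE.
  have -> : \sum_s iotaS (c * cf u s + cf w s) * v s =
      iotaS c * (\sum_s iotaS (cf u s) * v s) + \sum_s iotaS (cf w s) * v s.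
    rewrite mulr_sumr -big_split; apply: eq_bigr => t _ /=.
    by rewrite rmorphD rmorphM mulrDl mulrA.
  by rewrite -[LHS]/(iotaS c * _ + _) mulrBr opprD addrACA.
have /choice[h hh] : forall s, exists h, graded_piece i h /\
    forall u, graded_piece j u -> pairing n u h = cf u s.
  move=> s; have [h gh hp] := pairing_repr n_gt0 ij ltjn (cflin s).
  by exists h.
have gh s : graded_piece i (h s) by case: (hh s).
have ph s u : graded_piece j u -> pairing n u (h s) = cf u s by case: (hh s) => _; apply.
have sumE (c : 'I_m -> K) (F : 'I_m -> S) : \sum_s iotaS (c s) *: (F s : S^o) = \sum_s c s *: F s.
  by apply: eq_bigr => s _; rewrite -iotaSE.
have cf0 u : graded_piece j u -> last_ideal u -> cf u = fun=> 0.
  move=> gu lu; apply: cfE => //; rewrite big1 ?subr0 // => s _.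
  by rewrite rmorph0 mul0r.
have cfv s : cf (v s) = fun t => (s == t)%:R.
  apply: cfE; first exact: hv.
  rewrite (bigD1 s) //= eqxx rmorph1 mul1r big1 ?addr0 ?subrr.
    by case: subspace_last.
  by move=> t; rewrite eq_sym => /negbTE->; rewrite rmorph0 mul0r.
exists h; split.
- move=> s; apply/annP; split=> // u gu lu; rewrite ph // cf0 //.
- move=> c; rewrite sumE => -[gs hX] s.
  have := (XidealE n_gt0 ij gs).1 hX _ (hv s); rewrite pairing_sumr (bigD1 s) //=.
  rewrite ph // cfv eqxx mulr1 big1 ?addr0 // => t ne.
  by rewrite ph // cfv eq_sym (negbTE ne) mulr0.
- move=> g /annP[gg hg]; exists (fun s => pairing n (v s) g).
  rewrite sumE; have gd : graded_piece i (g - \sum_s pairing n (v s) g *: h s).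
    by apply: gradedB => //; apply: graded_sum => s _; apply: gradedZ.
  split=> //; apply/(XidealE n_gt0 ij gd) => u gu.
  rewrite addrC -scaleN1r pairingDr pairing_sumr mulN1r addrC; apply/eqP; rewrite subr_eq0; apply/eqP.
  have [gr lr] := hcf u gu.
  have := hg _ gr lr.
  have -> : u - \sum_s iotaS (cf u s) * v s = (-1) *: (\sum_s cf u s *: v s) + u.
    by rewrite scaleN1r [RHS]addrC; congr (_ - _); apply: eq_bigr => s _; rewrite iotaSE.
  rewrite pairingDl pairing_suml mulN1r addrC => /eqP; rewrite subr_eq0 => /eqP ->.
  by apply: eq_bigr => s _; rewrite ph // mulrC.
Qed.

End FixedPower.

Lemma saturationP u : saturation I u <->
  exists n0, forall n, (n0 <= n)%N -> forall i, I (Xp K n i * u).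
Proof.
split=> [[n0 hn0]|[n /(_ n (leqnn n)) hu]].
  exists n0 => n le i; have -> : Xp K n i * u = Xp K (n - n0) i * (Xp K n0 i * u).
    by rewrite mulrA /Xp -exprD subnK.
  by apply: resM; rewrite XpE; apply: hn0; rewrite mdegMn mdeg1 mul1n.
(* a monomial of degree 3 n has some exponent at least n *)
exists (3 * n)%N => m hm.
have [i le] : exists i, (n <= m i)%N.
  apply: contrapT => hn.
  have lt i : (m i < n)%N by rewrite ltnNge; apply/negP => ?; apply: hn; exists i.
  by move: hm; rewrite mdegE sum3E; have := lt 0; have := lt 1; have := lt 2%:R; lia.
have -> : 'X_[m] = 'X_[m - U_(i) *+ n] * Xp K n i.
  rewrite XpE -mpolyXD; congr 'X_[_]; apply/mnmP => t.
  rewrite mnmDE mnmBE mulmnE mnm1E; have [<-|_] := eqVneq i t; last by lia.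
  by rewrite mul1n subnK.
by rewrite -mulrA; apply: resM.
Qed.

Lemma torsion_le n n' k u : (n <= n')%N -> torsion n k u -> torsion n' k u.
Proof.
move=> le [gu hu]; split=> // i.
have -> : Xp K n' i * u = Xp K (n' - n) i * (Xp K n i * u).
  by rewrite mulrA /Xp -exprD subnK.
exact: resM.
Qed.

Lemma saturation_torsion k u : graded_piece k u -> saturation I u ->
  exists n0, forall n, (n0 <= n)%N -> torsion n k u.
Proof. by move=> gu /saturationP[n0 hn0]; exists n0 => n /hn0. Qed.

Lemma torsion_saturation n k u : torsion n k u -> saturation I u.
Proof.
by move=> tu; apply/saturationP; exists n => n' le; case: (torsion_le le tu).
Qed.

Lemma subspace_saturation : subspace iotaS (saturation I : set S^o).
Proof.
have [I0 hI] := res_subspace res.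
split=> [|c u v /saturationP[n hu] /saturationP[n' hv]]; apply/saturationP.
  by exists 0%N => n _ i; rewrite mulr0.
exists (maxn n n') => m; rewrite geq_max => /andP[/hu iu /hv iv] i.
have := hI c _ _ (iu i) (iv i); congr I.
rewrite -[RHS]/(Xp K m i * (iotaS c * u + v)) -[LHS]/(iotaS c * _ + _).
by ring.
Qed.

(** Local duality for S / I.  By [ann_dual] the dimension of [torsion] does not
    depend on n once n > b - 3 - k, so there it is the whole saturation. *)
Theorem saturation_dim k m :
  qdim iotaS (graded_piece (b - 3 - k) : set S^o) (graded_piece (b - 3 - k) `&` last_ideal) m ->
  qdim iotaS ((graded_piece k `&` saturation I) : set S^o) (graded_piece k `&` I) m.
Proof.
move=> dm; set j := b - 3 - k.
have dT n : (0 < n)%N -> j < n%:Z -> qdim iotaS (torsion n k : set S^o) (graded_piece k `&` I) m.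
  by move=> n0 jn; apply: torsion_ann => //; apply: (ann_dual n0 (erefl _) jn).
have [N [N0 jN]] : exists N, (0 < N)%N /\ j < N%:Z.
  by exists (`|j|.+1)%N; split=> //; lia.
suff <- : torsion N k = graded_piece k `&` saturation I by apply: dT.
apply/seteqP; split=> [u tu|u [gu su]].
  by split; [case: tu | apply: torsion_saturation tu].
have [n0 hn0] := saturation_torsion gu su.
pose n := maxn n0 N.
have sI := subspaceSI k (res_subspace res).
have sub : (torsion N k : set S^o) `<=` torsion n k.
  by move=> w; apply: torsion_le; rewrite /n leq_maxr.
have inc : (graded_piece k `&` I : set S^o) `<=` torsion N k.
  by move=> w [gw iw]; split=> // i; apply: resM.
apply: (qdim_eq_sub (subspace_torsion N k) (subspace_torsion n k) sI inc sub (n := m)).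
- exact: dT.
- by apply: dT; rewrite /n; lia.
- by apply: hn0; apply: leq_maxl.
Qed.

Lemma last_dim j : exists m, qdim iotaS (graded_piece j : set S^o) (graded_piece j `&` last_ideal) m.
Proof.
have sJ := subspaceSI j subspace_last.
have z : ([set 0] : set S^o) `<=` graded_piece j `&` last_ideal by move=> _ ->; case: sJ.
have [m [p [_ dp _]]] := qdim_split (subspace_graded K j) sJ
  (@subspace0 _ _ iotaS S^o) z (@subIsetl _ _ _) (qdim_graded K j).
by exists p.
Qed.

(** The dual degree b - 3 - k is negative. *)
Lemma saturation_high k u : b - 3 < k -> graded_piece k u -> saturation I u -> I u.
Proof.
move=> lt gu su; have [m dm] := last_dim (b - 3 - k).
have m0 : m = 0%N.
  apply: (qdim_uniq (subspaceSI _ subspace_last) dm).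
  apply/qdim0P; first exact: subspaceSI subspace_last.
  move=> w gw; have -> : w = 0 by apply: graded_lt0 gw; lia.
  by case: (subspaceSI (b - 3 - k) subspace_last).
move: (saturation_dim dm); rewrite m0 => /(qdim0P _ (subspaceSI k (res_subspace res))) h.
by case: (h u).
Qed.

(** The dual degree b - 3 - j is negative, and S has no form of negative degree
    to be in the saturation. *)
Lemma last_ideal_high j u : b - 3 < j -> graded_piece j u -> last_ideal u.
Proof.
move=> lt gu; pose k := b - 3 - j.
have ej : b - 3 - k = j by rewrite /k; ring.
have [m dm] := last_dim j.
have := saturation_dim (k := k) (m := m); rewrite ej => /(_ dm) dk.
have m0 : m = 0%N.
  have sI := subspaceSI k (res_subspace res).
  apply: (qdim_uniq sI dk); apply/(qdim0P _ sI) => w [gw _].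
  have -> : w = 0 by apply: graded_lt0 gw; rewrite /k; lia.
  by case: sI.
move: dm; rewrite m0 => /(qdim0P _ (subspaceSI j subspace_last)) h.
by case: (h u gu).
Qed.

End LocalDuality.

(** * Affine charts *)

Section Charts.
Variable K : fieldType.
Local Notation S := {mpoly K[3]}.
Local Notation A2 := {mpoly K[2]}.
Variable i : 'I_3.
Implicit Types (s u f : S) (q : A2) (k : nat).

Lemma dehomogD s u : dehomog i (s + u) = dehomog i s + dehomog i u.
Proof. exact: rmorphD. Qed.

Lemma dehomogM s u : dehomog i (s * u) = dehomog i s * dehomog i u.
Proof. exact: rmorphM. Qed.

Lemma dehomog0 : dehomog i (0 : S) = 0.
Proof. exact: rmorph0. Qed.

Lemma dehomog1 : dehomog i (1 : S) = 1.
Proof. exact: rmorph1. Qed.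

Lemma dehomogXn s k : dehomog i (s ^+ k) = dehomog i s ^+ k.
Proof. exact: rmorphXn. Qed.

Lemma dehomogZ c s : dehomog i (c *: s) = c *: dehomog i s.
Proof. exact: linearZ. Qed.

Lemma dehomogC (c : K) : dehomog i (c%:MP_[3]) = c%:MP_[2].
Proof. exact: comp_mpolyC. Qed.

Lemma dehomog_sum I (r : seq I) (P : pred I) (F : I -> S) :
  dehomog i (\sum_(j <- r | P j) F j) = \sum_(j <- r | P j) dehomog i (F j).
Proof. exact: rmorph_sum. Qed.

Definition chart_mon (m : 'X_{1..3}) : 'X_{1..2} := [multinom m (lift i k) | k < 2].

Definition proj_mon k (m : 'X_{1..2}) : 'X_{1..3} :=
  [multinom (if unlift i j is Some t then m t else (k - mdeg m)%N) | j < 3].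

Lemma sum_lift (V : nmodType) (F : 'I_3 -> V) : \sum_j F j = F i + \sum_(k < 2) F (lift i k).
Proof.
rewrite (bigD1 i) //=; congr (_ + _).
rewrite (reindex_omap (lift i) (unlift i)) /=; last first.
  by move=> j ne; case: (unliftP i j) => [t ->//|e]; rewrite e eqxx in ne.
by apply: eq_bigl => k; rewrite eq_sym neq_lift /= liftK eqxx.
Qed.

Lemma mdeg_chart m : mdeg m = (m i + mdeg (chart_mon m))%N.
Proof.
by rewrite !mdegE sum_lift; congr (_ + _)%N; apply: eq_bigr => k _; rewrite mnmE.
Qed.

Lemma dehomog_mon m : dehomog i ('X_[m] : S) = 'X_[chart_mon m].
Proof.
rewrite /dehomog comp_mpolyX (bigD1 i) //= tnth_mktuple unlift_none expr1n mul1r.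
rewrite (reindex_omap (lift i) (unlift i)) /=; last first.
  by move=> j ne; case: (unliftP i j) => [t ->//|e]; rewrite e eqxx in ne.
rewrite [RHS]mpolyXE_id; apply: eq_big => [k|k _].
  by rewrite eq_sym neq_lift /= liftK eqxx.
by rewrite tnth_mktuple liftK mnmE.
Qed.

Lemma chart_proj_mon k m : chart_mon (proj_mon k m) = m.
Proof. by apply/mnmP => t; rewrite !mnmE liftK. Qed.

Lemma proj_chart_mon (m : 'X_{1..3}) : proj_mon (mdeg m) (chart_mon m) = m.
Proof.
apply/mnmP => j; rewrite !mnmE; case: (unliftP i j) => [t ->|->].
  by rewrite mnmE.
by rewrite mdeg_chart; lia.
Qed.

Lemma mdeg_proj_mon k m : (mdeg m <= k)%N -> mdeg (proj_mon k m) = k.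
Proof. by move=> le; rewrite mdeg_chart chart_proj_mon mnmE unlift_none; lia. Qed.

(** Homogenization in degree k; the truncated subtraction in [proj_mon] is harmless
    as long as the degree of q is at most k. *)
Definition rehomog k q : S := \sum_(m <- msupp q) q@_m *: 'X_[proj_mon k m].

Lemma rehomogK k q : dehomog i (rehomog k q) = q.
Proof.
rewrite /rehomog dehomog_sum [RHS]mpolyE; apply: eq_bigr => m _.
by rewrite dehomogZ dehomog_mon chart_proj_mon.
Qed.

Lemma rehomog_graded k q : (msize q <= k.+1)%N -> graded_piece k (rehomog k q).
Proof.
move=> le; rewrite /rehomog big_seq; apply: graded_sum => m hm.
rewrite -[X in graded_piece X%:Z _](@mdeg_proj_mon k m).
  by apply/gradedZ/gradedMon.
by rewrite -ltnS; apply: leq_trans le; apply: msize_mdeg_lt.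
Qed.

(** In a fixed degree, dehomogenization is injective on monomials. *)
Lemma dehomog_coeff k s m : graded_piece k s -> mdeg m = k ->
  (dehomog i s)@_(chart_mon m) = s@_m.
Proof.
move=> hs hm; rewrite {1}[s]mpolyE dehomog_sum raddf_sum /=.
have zero m' : m' \in msupp s -> m' != m -> (dehomog i (s@_m' *: 'X_[m']))@_(chart_mon m) = 0.
  move=> /hs/eqP; rewrite eqz_nat => /eqP e ne; rewrite dehomogZ dehomog_mon mcoeffZ mcoeffX.
  case: eqP => [ee|_]; last by rewrite mulr0.
  by case/eqP: ne; rewrite -[m']proj_chart_mon -[m]proj_chart_mon ee e hm.
have [hm'|hm'] := boolP (m \in msupp s).
  rewrite (bigD1_seq m) ?msupp_uniq //= big_seq_cond big1 => [|m' /andP[]]; last exact: zero.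
  by rewrite addr0 dehomogZ dehomog_mon mcoeffZ mcoeffX eqxx mulr1.
rewrite big_seq big1 ?(memN_msupp_eq0 hm') // => m' h; apply: zero => //.
by apply: contraNneq hm' => <-.
Qed.

Lemma dehomog_inj k s u : graded_piece k s -> graded_piece k u ->
  dehomog i s = dehomog i u -> s = u.
Proof.
move=> hs hu e; apply/mpolyP => m; have [hm|hm] := eqVneq (mdeg m) k.
  by rewrite -(dehomog_coeff hs hm) -(dehomog_coeff hu hm) e.
have z v : graded_piece k v -> v@_m = 0.
  by move=> hv; apply/memN_msupp_eq0/negP => /hv/eqP; rewrite eqz_nat (negbTE hm).
by rewrite !z.
Qed.

Lemma msize_dehomog k s : graded_piece k s -> (msize (dehomog i s) <= k.+1)%N.
Proof.
move=> hs; rewrite [s]mpolyE dehomog_sum big_seq; apply: (leq_trans (msize_sum _ _ _)).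
apply/bigmax_leqP_seq => m _ hm; rewrite dehomogZ dehomog_mon.
apply: (leq_trans (msizeZ_le _ _)); rewrite msizeX ltnS.
have /eqP := hs m hm; rewrite eqz_nat => /eqP <-.
by rewrite mdeg_chart leq_addl.
Qed.

Lemma dehomog_var : dehomog i ('X_i : S) = 1.
Proof.
rewrite dehomog_mon -mpolyX0; congr 'X_[_]; apply/mnmP => k.
by rewrite !mnmE (negbTE (neq_lift i k)).
Qed.

Lemma dehomog_deriv f (t : 'I_2) : (dehomog i f)^`M(t) = dehomog i (f^`M(lift i t)).
Proof.
rewrite [f]mpolyE dehomog_sum !raddf_sum /= dehomog_sum; apply: eq_bigr => m _.
rewrite dehomogZ dehomog_mon !mderivZ !mderivX !dehomogZ dehomog_mon; congr (_ *: (_ *: 'X_[_])).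
  by rewrite mnmE.
apply/mnmP => k; rewrite !mnmE; congr (_ - _)%N.
by rewrite (inj_eq lift_inj).
Qed.

Definition chart_point (a : 'I_2 -> K) : 'rV[K]_3 :=
  \row_j (if unlift i j is Some k then a k else 1).

Lemma dehomog_ev s (a : 'I_2 -> K) : (dehomog i s).@[a] = ev s (chart_point a).
Proof.
rewrite /dehomog comp_mpoly_meval /ev; apply: meval_eq => j.
rewrite tnth_mktuple mxE; case: unlift => [t|]; first by rewrite mevalXU.
by rewrite meval1.
Qed.

End Charts.

Section HomogeneousForms.
Variable K : fieldType.
Local Notation S := {mpoly K[3]}.

Lemma euler (d : nat) (f : S) : graded_piece d f -> \sum_j 'X_j * f^`M(j) = d%:R *: f.
Proof.
move=> hf; rewrite [in RHS](mpolyE f) scaler_sumr.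
under eq_bigr => j _ do rewrite [f in mderiv _ f](mpolyE f) raddf_sum mulr_sumr /=.
rewrite exchange_big /=; apply: eq_big_seq => m /hf/eqP; rewrite eqz_nat => /eqP <-.
rewrite mdegE natr_sum scaler_suml; apply: eq_bigr => j _.
rewrite mderivZ mderivX -!scalerAr scalerA mulrC -scalerA; have [->|mj] := eqVneq (m j) 0%N.
  by rewrite !scale0r.
congr (_ *: (_ *: _)); rewrite -mpolyXD addmC submK //.
by apply/mnm_lepP => t; rewrite mnm1E; case: eqP => [<-|//]; rewrite lt0n.
Qed.

Lemma ev_scale (d : nat) (s : S) (c : K) v : graded_piece d s -> ev s (c *: v) = c ^+ d * ev s v.
Proof.
move=> hs; rewrite /ev !mevalE mulr_sumr; apply: eq_big_seq => m /hs/eqP.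
rewrite eqz_nat => /eqP <-; rewrite mulrCA; congr (_ * _).
rewrite mdegE -prodrXr -big_split; apply: eq_bigr => j _.
by rewrite mxE exprMn.
Qed.

Lemma graded_deriv (d : nat) (f : S) j : graded_piece d f -> graded_piece (d%:Z - 1) (f^`M(j)).
Proof.
move=> hf m; rewrite mcoeff_msupp mcoeff_deriv => h.
have : (m + U_(j))%MM \in msupp f.
  by rewrite mcoeff_msupp; apply: contraNneq h => ->; rewrite mul0rn.
by move=> /hf; rewrite mdegD mdeg1; lia.
Qed.

End HomogeneousForms.

(** * Eliminants and square factors in two variables *)

Section Bivariate.
Variable K : closedFieldType.
Local Notation P2 := {poly {poly K}}.

(** A polynomial over K[t] that vanishes at t = a is divisible by t - a. *)
Lemma coef_divide (P : P2) (a : K) : map_poly (horner_eval a) P = 0 ->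
  exists P', P = ('X - a%:P) *: P'.
Proof.
move=> h; have /choice[q hq] : forall i, exists q, P`_i = q * ('X - a%:P).
  move=> i; apply/factor_theorem/eqP.
  by have := congr1 (fun p : {poly K} => p`_i) h; rewrite coef_map coef0.
exists (\poly_(i < size P) q i); apply/polyP => i; rewrite coefZ coef_poly.
by case: ltnP => [_|le]; [rewrite hq mulrC | rewrite mulr0 nth_default].
Qed.

(** Gauss's lemma in the form needed here: denominators are cancelled one linear
    factor t - a at a time, since setting t = a shows that t - a divides H or Q. *)
Lemma square_factor_integral (c : {poly K}) (G H Q : P2) : c != 0 -> c *: G = H ^+ 2 * Q ->
  exists H' Q', G = H' ^+ 2 * Q' /\ size H' = size H.
Proof.
have [n] := ubnP (size c); elim: n c H Q => // n ih c H Q; rewrite ltnS => szc c0 e.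
have [/closed_rootP[a /factor_theorem[c' ec]]|sz1] := boolP (size c != 1%N); last first.
  have /size_poly1P[c1 c10 ec] : size c == 1%N by rewrite -[_ == _]negbK.
  exists H, ((c1^-1)%:P *: Q); split=> //; rewrite -scalerAr -e ec scalerA -polyCM.
  by rewrite mulVf // scale1r.
have X0 : 'X - a%:P != 0 :> {poly K} by rewrite polyXsubC_eq0.
have c'0 : c' != 0 by apply: contraNneq c0 => c'0; rewrite ec c'0 mul0r.
have szc' : (size c' < n)%N.
  by move: szc; rewrite ec size_Mmonic ?monicXsubC // size_XsubC addn2.
have canc (U V : P2) : ('X - a%:P) *: U = ('X - a%:P) *: V -> U = V.
  move=> /eqP; rewrite -subr_eq0 -scalerBr -mul_polyC mulf_eq0 polyC_eq0 (negbTE X0) /= subr_eq0.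
  by move/eqP.
have /eqP : map_poly (horner_eval a) H ^+ 2 * map_poly (horner_eval a) Q = 0.
  rewrite -rmorphXn -rmorphM -e -mul_polyC rmorphM /= map_polyC /= /horner_eval.
  by rewrite ec hornerM hornerXsubC subrr mulr0 mul0r.
rewrite mulf_eq0 expf_eq0 /= => /orP[] /eqP /coef_divide[P' eP].
  have [|H' [Q' [eG sz]]] := ih c' P' (('X - a%:P) *: Q) szc' c'0.
    apply: canc; rewrite scalerA mulrC -ec e eP exprZn expr2.
    by rewrite -scalerAl -scalerAr !scalerA.
  by exists H', Q'; split=> //; rewrite sz eP size_scale.
apply: (ih c' H P' szc' c'0).
by apply: canc; rewrite scalerA mulrC -ec e eP scalerAr.
Qed.

Hypothesis char0 : forall n, (n.+1)%:R != 0 :> K.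

Lemma deriv_neq0 (P : P2) : (1 < size P)%N -> P^`() != 0.
Proof.
move=> sz; apply/eqP => /polyP/(_ (size P).-2); rewrite coef_deriv coef0.
have -> : ((size P).-2.+1 = (size P).-1)%N by case: (size P) sz => [|[]].
rewrite -mulr_natr => /eqP; rewrite mulf_eq0 => /orP[].
  by rewrite -/(lead_coef P) lead_coef_eq0 => /eqP P0; rewrite P0 size_poly0 in sz.
by rewrite -polyC1 -polyCMn polyC_eq0; apply/negP; case: (size P) sz => [|[|m]] // _; apply: char0.
Qed.

(** A polynomial over K(t) that is not coprime to its derivative has a multiple
    factor, in characteristic 0; both alternatives are stated without
    denominators. *)
Lemma separable_or_square (G : P2) : G != 0 ->
  (exists A B (c : {poly K}), c != 0 /\ A * G + B * G^`() = c%:P) \/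
  (exists H Q, G = H ^+ 2 * Q /\ (1 < size H)%N).
Proof.
move=> G0; have [|nsep] := boolP (separable_poly G).
  rewrite unlock => /Bezout_coprimepP[[A B] /=]; rewrite -size_poly_eq1.
  by move=> /size_poly1P[c c0 e]; left; exists A, B, c.
right; have [sq|nsq] := pselect (forall u : P2, size u != 1%N -> ~~ (u ^+ 2 %| G)).
  case/negP: nsep; apply/separable_polyP; split; first exact/poly_square_freeP.
  by move=> u _; apply: deriv_neq0.
have [H [szH dH]] : exists H : P2, size H != 1%N /\ H ^+ 2 %| G.
  apply: contrapT => hn; apply: nsq => u szu; apply/negP => du; apply: hn.
  by exists u.
have H0 : H != 0.
  by apply: contraTneq dH => ->; rewrite expr0n /= dvd0p.
move: dH; rewrite Pdiv.Idomain.dvdp_eq => /eqP; rewrite mulrC.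
move=> /square_factor_integral[|H' [Q' [eG sz]]].
  by rewrite expf_neq0 // lead_coef_eq0 expf_neq0.
exists H', Q'; split=> //; rewrite sz ltn_neqAle eq_sym szH lt0n size_poly_eq0.
by [].
Qed.

Local Notation A2 := {mpoly K[2]}.
Variable j : 'I_2.
Let j' : 'I_2 := lift j ord0.

Lemma ord2P (t : 'I_2) : t = j \/ t = j'.
Proof.
case: (unliftP j t) => [k ->|->]; [right|by left].
by rewrite /j'; congr lift; apply/val_inj; case: k => [[]].
Qed.

(** K[x_0, x_1] as polynomials in x_j with coefficients in K[x_j']. *)
Definition to_biv : A2 -> P2 :=
  mmap (polyC \o polyC : {rmorphism K -> P2}) (fun t => if t == j then 'X else 'X%:P).

Definition of_biv (P : P2) : A2 := (map_poly (horner_alg ('X_j' : A2)) P).['X_j].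

Lemma to_biv_M p q : to_biv (p * q) = to_biv p * to_biv q.
Proof. exact: rmorphM. Qed.
Lemma to_biv_D p q : to_biv (p + q) = to_biv p + to_biv q.
Proof. exact: rmorphD. Qed.
Lemma to_biv_C c : to_biv c%:MP = c%:P%:P.
Proof. exact: mmapC. Qed.
Lemma to_biv_X t : to_biv 'X_t = if t == j then 'X else 'X%:P.
Proof. by rewrite /to_biv mmapX mmap1U. Qed.

Lemma of_biv_M P Q : of_biv (P * Q) = of_biv P * of_biv Q.
Proof. by rewrite /of_biv rmorphM hornerM. Qed.
Lemma of_biv_D P Q : of_biv (P + Q) = of_biv P + of_biv Q.
Proof. by rewrite /of_biv rmorphD hornerD. Qed.
Lemma of_biv_C p : of_biv p%:P = horner_alg ('X_j' : A2) p.
Proof. by rewrite /of_biv map_polyC hornerC. Qed.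
Lemma of_biv_X : of_biv 'X = 'X_j.
Proof. by rewrite /of_biv map_polyX hornerX. Qed.

Lemma mpoly_gen_ind n (R : comNzRingType) (P : {mpoly R[n]} -> Prop) :
  (forall c, P c%:MP) -> (forall t, P 'X_t) -> (forall p q, P p -> P q -> P (p + q)) ->
  (forall p q, P p -> P q -> P (p * q)) -> forall p, P p.
Proof.
move=> hC hX hD hM p; rewrite [p]mpolyE; elim/big_ind: _ => [|p1 p2|m _].
- by rewrite -mpolyC0.
- exact: hD.
rewrite -mul_mpolyC; apply: (hM) => //.
rewrite mpolyXE_id; elim/big_ind: _ => [|p1 p2|t _].
- by rewrite -mpolyC1.
- exact: hM.
elim: (m t) => [|k ih]; first by rewrite expr0 -mpolyC1.
by rewrite exprS; apply: hM.
Qed.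

Lemma to_bivK p : of_biv (to_biv p) = p.
Proof.
elim/mpoly_gen_ind: p => [c|t|p q ep eq|p q ep eq].
- by rewrite to_biv_C of_biv_C /horner_alg /horner_morph map_polyC hornerC /= alg_mpolyC.
- rewrite to_biv_X; case: eqP => [->|ne]; first exact: of_biv_X.
  rewrite of_biv_C /horner_alg /horner_morph map_polyX hornerX.
  by case: (ord2P t) => // ->.
- by rewrite to_biv_D of_biv_D ep eq.
- by rewrite to_biv_M of_biv_M ep eq.
Qed.

Lemma to_biv_alg p : to_biv (horner_alg ('X_j' : A2) p) = p%:P.
Proof.
elim/poly_ind: p => [|p c ih]; first by rewrite rmorph0 polyC0; apply: rmorph0.
rewrite rmorphD rmorphM /= to_biv_D to_biv_M ih polyCD polyCM; congr (_ * _ + _).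
  rewrite /horner_alg /horner_morph map_polyX hornerX to_biv_X.
  by rewrite eq_sym (negbTE (neq_lift _ _)).
by rewrite /horner_alg /horner_morph map_polyC hornerC /= alg_mpolyC to_biv_C.
Qed.

Lemma of_bivK P : to_biv (of_biv P) = P.
Proof.
elim/poly_ind: P => [|P c ih].
  by rewrite /of_biv rmorph0 horner0; apply: rmorph0.
rewrite of_biv_D of_biv_M of_biv_X of_biv_C to_biv_D to_biv_M to_biv_alg ih.
by rewrite to_biv_X eqxx.
Qed.

Lemma to_biv_deriv p : to_biv (p^`M(j)) = (to_biv p)^`().
Proof.
elim/mpoly_gen_ind: p => [c|t|p q ep eq|p q ep eq].
- by rewrite mderivC [in RHS]to_biv_C derivC; apply: rmorph0.
- rewrite mderivX to_biv_X mnm1E; case: eqP => [->|ne].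
    rewrite derivX scale1r (_ : (_ - _)%MM = 0%MM) ?mpolyX0; first exact: rmorph1.
    by apply/mnmP => k; rewrite mnmBE subnn mnm0E.
  by rewrite scale0r derivC; apply: rmorph0.
- by rewrite mderivD !to_biv_D derivD ep eq.
- by rewrite mderivM !(to_biv_D, to_biv_M) derivM ep eq.
Qed.

(** Either the ideal of g and its derivative in x_j contains a nonzero polynomial
    in the other variable, or g has a square factor. *)
Theorem eliminant_or_square (g : A2) : g != 0 ->
  (exists (A B : A2) (c : {poly K}), c != 0 /\
     A * g + B * g^`M(j) = horner_alg ('X_j' : A2) c) \/
  (exists h q : A2, g = h ^+ 2 * q /\ forall c, h <> c%:MP).
Proof.
move=> g0; have G0 : to_biv g != 0.
  by apply: contraNneq g0 => e; rewrite -(to_bivK g) e /of_biv rmorph0 horner0.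
case: (separable_or_square G0) => [[A [B [c [c0 e]]]]|[H [Q [e sz]]]].
  left; exists (of_biv A), (of_biv B), c; split=> //.
  by rewrite -of_biv_C -e -to_biv_deriv of_biv_D !of_biv_M !to_bivK.
right; exists (of_biv H), (of_biv Q); split.
  by rewrite expr2 -!of_biv_M -expr2 -e to_bivK.
move=> c ec; have := of_bivK H; rewrite ec to_biv_C => eH.
by move: sz; rewrite -eH ltnNge size_polyC_leq1.
Qed.

End Bivariate.

(** * Ideals of finite colength in the plane *)

Section AffinePoints.
Variable K : closedFieldType.
Local Notation A2 := {mpoly K[2]}.

Definition ideal_axiom (R : comNzRingType) (b : set R) : Prop :=
  [/\ b 0, forall p q, b p -> b q -> b (p + q) & forall p q, b q -> b (p * q)].

Lemma ord2_ind (P : 'I_2 -> Prop) : P 0 -> P 1 -> forall t, P t.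
Proof. by move=> p0 p1 [[|[|//]] h]; [move: p0|move: p1]; congr P; apply/val_inj. Qed.

Lemma taylor2 (p : A2) (a : 'I_2 -> K) :
  exists p0 p1, p = p.@[a]%:MP + ('X_0 - (a 0)%:MP) * p0 + ('X_1 - (a 1)%:MP) * p1.
Proof.
elim/mpoly_gen_ind: p => [c|t|p q [p0 [p1 ep]] [q0 [q1 eq]]|p q [p0 [p1 ep]] [q0 [q1 eq]]].
- by exists 0, 0; rewrite mevalC !mulr0 !addr0.
- move: t; apply: ord2_ind; rewrite mevalXU; [exists 1, 0 | exists 0, 1];
  by rewrite mulr0 mulr1 ?addr0 addrC subrK.
- by exists (p0 + q0), (p1 + q1); rewrite mevalD mpolyCD {1}ep {1}eq; ring.
- exists (p0 * q + p.@[a]%:MP * q0), (p1 * q + p.@[a]%:MP * q1).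
  rewrite mevalM mpolyCM {1}ep !mulrDr !mulrDl {1}eq; ring.
Qed.

Notation inX t := (horner_alg ('X_t : A2)).

Lemma inX_var t : inX t 'X = 'X_t.
Proof. by rewrite /horner_alg /horner_morph map_polyX hornerX. Qed.

Lemma inX_C t c : inX t c%:P = c%:MP.
Proof. by rewrite /horner_alg /horner_morph map_polyC hornerC /= alg_mpolyC. Qed.

Lemma inX_ev t c a : (inX t c).@[a] = c.[a t].
Proof.
elim/poly_ind: c => [|p c ih]; first by rewrite rmorph0 meval0 horner0.
by rewrite rmorphD rmorphM /= inX_var inX_C mevalD mevalM mevalXU mevalC hornerMXaddC ih.
Qed.

(** If adding x_t - alpha to b always gives the unit ideal, then the linear factors
    of c can be cancelled from its membership in b one after the other. *)
Lemma proper_root (b : set A2) t (c : {poly K}) : ideal_axiom b -> c != 0 -> b (inX t c) ->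
  (forall al, exists p q, b p /\ 1 = p + q * ('X_t - al%:MP)) -> b 1.
Proof.
move=> [b0 bD bM] c0 bc hal; have [n] := ubnP (size c).
elim: n c c0 bc => // n ih c c0 bc; rewrite ltnS => szc.
have [/closed_rootP[al /factor_theorem[c' ec]]|sz1] := boolP (size c != 1%N); last first.
  have /size_poly1P[c1 c10 ec] : size c == 1%N by rewrite -[_ == _]negbK.
  by have := bM (c1^-1)%:MP _ bc; rewrite ec inX_C -mpolyCM mulVf.
have c'0 : c' != 0 by apply: contraNneq c0 => c'0; rewrite ec c'0 mul0r.
have [p [q [bp e]]] := hal al.
apply: (ih c' c'0).
  have -> : inX t c' = inX t c' * p + q * inX t c.
    rewrite -[LHS]mulr1 e ec rmorphM rmorphB /= inX_var inX_C; ring.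
  by apply: bD; [apply: bM | apply: bM].
by move: szc; rewrite ec size_Mmonic ?monicXsubC // size_XsubC addn2.
Qed.

Lemma ideal_add_gen (b : set A2) l : ideal_axiom b ->
  ideal_axiom [set p | exists p0 q, b p0 /\ p = p0 + q * l].
Proof.
move=> [b0 bD bM]; split.
- by exists 0, 0; rewrite mul0r addr0.
- move=> p q [p0 [p1 [hp ->]]] [q0 [q1 [hq ->]]]; exists (p0 + q0), (p1 + q1).
  by split; [apply: bD | ring].
- by move=> p q [q0 [q1 [hq ->]]]; exists (p * q0), (p * q1); split; [apply: bM | ring].
Qed.

(** The Nullstellensatz for ideals of finite colength in the plane: adjoin a root
    of c_0, then one of c_1, keeping the ideal proper; at the point so obtained
    all elements of b vanish. *)
Lemma nullstellensatz2 (b : set A2) (c : 'I_2 -> {poly K}) : ideal_axiom b ->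
  (forall t, c t != 0 /\ b (inX t (c t))) ->
  (forall a : 'I_2 -> K, exists2 p, b p & p.@[a] != 0) -> b 1.
Proof.
move=> ib hc hz; have [b0 bD bM] := ib.
have [c0 bc0] := hc 0; have [c1 bc1] := hc 1.
apply: (proper_root ib c0 bc0) => al.
(* b with the root alpha of c_0 adjoined as first coordinate *)
set b' := [set p | exists p0 q, b p0 /\ p = p0 + q * ('X_0 - al%:MP)].
suff [p [q [? e]]] : b' 1 by exists p, q.
have ib' : ideal_axiom b' by apply: ideal_add_gen.
have bb' p : b p -> b' p by exists p, 0; rewrite mul0r addr0.
apply: (proper_root ib' c1 (bb' _ bc1)) => be.
pose a : 'I_2 -> K := fun t => if t == 0 then al else be.
have [p bp pa] := hz a; have [p0 [p1 ep]] := taylor2 p a.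
pose u : A2 := (p.@[a]^-1)%:MP.
exists (u * (p - ('X_0 - al%:MP) * p0)), (- u * p1); split.
  exists (u * p), (- u * p0); split; [exact: bM | by ring].
rewrite ep /a eqxx /= -/a.
transitivity (u * (p.@[a])%:MP); last by ring.
by rewrite /u -mpolyCM mulVf.
Qed.

(** Membership in the extension of b to the local ring at a. *)
Definition loc (b : set A2) (a : 'I_2 -> K) (p : A2) : Prop :=
  exists s, s.@[a] != 0 /\ b (s * p).

Lemma loc_ideal b a : ideal_axiom b -> ideal_axiom (loc b a).
Proof.
move=> [b0 bD bM]; split.
- by exists 1; rewrite meval1 oner_neq0 mulr0.
- move=> p q [s [sa hs]] [r [ra hr]]; exists (s * r); rewrite mevalM mulf_neq0 //.
  split=> //; have -> : s * r * (p + q) = r * (s * p) + s * (r * q) by ring.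
  by apply: bD; apply: bM.
- move=> p q [s [sa hs]]; exists s; split=> //.
  have -> : s * (p * q) = p * (s * q) by ring.
  exact: bM.
Qed.

(** The part of c prime to x_t - a_t is a unit at a. *)
Lemma loc_nilp b a t c : ideal_axiom b -> c != 0 -> b (inX t c) ->
  exists N, loc b a (('X_t - (a t)%:MP) ^+ N).
Proof.
move=> [b0 bD bM] c0 bc; have [m [q qa ec]] := multiplicity_XsubC c (a t).
exists m, (inX t q); rewrite inX_ev; rewrite c0 /= in qa; split=> //.
by move: bc; rewrite ec rmorphM rmorphXn rmorphB /= inX_var inX_C.
Qed.

End AffinePoints.

Lemma clear_denom3 (F : fieldType) (g g0 g1 x x' y y' z z' : F) :
  x' != 0 -> y' != 0 -> z' != 0 ->
  x' * y' * z' * (x / x' * g + y / y' * g0 + z / z' * g1) =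
  x * y' * z' * g + x' * y * z' * g0 + x' * y' * z * g1.
Proof. by move=> hx hy hz; field; rewrite hx hy hz. Qed.

Lemma common_denom3 (F : fieldType) (g g0 g1 x y z s : F) : s != 0 ->
  s * (x / s * g + y / s * g0 + z / s * g1) = x * g + y * g0 + z * g1.
Proof. by move=> hs; field. Qed.

(** * From local to global membership in the Jacobian ideal *)

Section SingularPoints.
Variable K : numClosedFieldType.
Local Notation S := {mpoly K[3]}.
Local Notation A2 := {mpoly K[2]}.
Notation inX t := (horner_alg ('X_t : A2)).
Variables (d : nat) (f : S).
Hypothesis d_gt0 : (0 < d)%N.
Hypothesis f_graded : graded_piece d f.

(** The dehomogenized Jacobian ideal. *)
Definition chart_jac (i : 'I_3) : set A2 :=
  [set q | exists P : 'I_3 -> A2, q = \sum_j P j * dehomog i (f^`M(j))].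

Lemma jacP g : jacobian_ideal f g <-> exists P : 'I_3 -> S, g = \sum_j P j * f^`M(j).
Proof.
split=> [[a [b [c ->]]]|[P ->]]; last by exists (P 0), (P 1), (P 2%:R); rewrite sum3E.
exists (fun j => [:: a; b; c]`_j); rewrite sum3E //.
Qed.

Lemma chart_jac_ideal i : ideal_axiom (chart_jac i).
Proof.
split.
- by exists (fun=> 0); rewrite big1 // => j _; rewrite mul0r.
- move=> p q [P ->] [Q ->]; exists (fun j => P j + Q j).
  by rewrite -big_split; apply: eq_bigr => j _; rewrite mulrDl.
- move=> p q [Q ->]; exists (fun j => p * Q j); rewrite mulr_sumr.
  by apply: eq_bigr => j _; rewrite mulrA.
Qed.

Lemma jac_ideal : ideal_axiom (jacobian_ideal f).
Proof.
split.
- by exists 0, 0, 0; rewrite !mul0r !addr0.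
- move=> p q [a [b [c ->]]] [a' [b' [c' ->]]]; exists (a + a'), (b + b'), (c + c'); ring.
- move=> p q [a [b [c ->]]]; exists (p * a), (p * b), (p * c); ring.
Qed.

Lemma chart_jac_gen i j : chart_jac i (dehomog i (f^`M(j))).
Proof.
exists (fun j' => if j' == j then 1 else 0); rewrite (bigD1 j) //= eqxx mul1r.
by rewrite big1 ?addr0 // => j' /negbTE ->; rewrite mul0r.
Qed.

(** Euler's relation, dehomogenized. *)
Lemma chart_jac_eq i : chart_jac i (dehomog i f).
Proof.
have [_ _ cM] := chart_jac_ideal i.
have d0 : d%:R != 0 :> K by rewrite pnatr_eq0 -lt0n.
have -> : dehomog i f = (d%:R^-1)%:MP * \sum_j dehomog i 'X_j * dehomog i (f^`M(j)).
  transitivity (dehomog i (d%:R^-1 *: (d%:R *: f))).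
    by rewrite scalerA mulVf // scale1r.
  rewrite -(euler f_graded) dehomogZ dehomog_sum mul_mpolyC; congr (_ *: _).
  by apply: eq_bigr => j _; rewrite dehomogM.
by apply: cM; exists (fun j => dehomog i 'X_j).
Qed.

Lemma jac_chart i u : jacobian_ideal f u -> chart_jac i (dehomog i u).
Proof.
move=> /jacP[P ->]; exists (fun j => dehomog i (P j)); rewrite dehomog_sum.
by apply: eq_bigr => j _; rewrite dehomogM.
Qed.

(** By Euler's relation the derivative along the coordinate set to 1 is a
    combination of the equation and the two affine derivatives. *)
Lemma chart_jacP i q : chart_jac i q <-> exists r s t : A2,
  q = r * dehomog i f + s * (dehomog i f)^`M(0) + t * (dehomog i f)^`M(1).
Proof.
have [c0 cD cM] := chart_jac_ideal i.
split=> [[P ->]|[r [s [t ->]]]]; last first.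
  apply: (cD); first apply: (cD); apply: (cM).
  - exact: chart_jac_eq.
  - by rewrite dehomog_deriv; apply: chart_jac_gen.
  - by rewrite dehomog_deriv; apply: chart_jac_gen.
pose D t := dehomog i (f^`M(lift i t)).
have e : dehomog i (f^`M(i)) = d%:R *: dehomog i f - (dehomog i 'X_(lift i 0) * D 0 + dehomog i 'X_(lift i 1) * D 1).
  rewrite -dehomogZ -(euler f_graded) (sum_lift i) /= big_ord_recl big_ord1 !dehomogD.
  rewrite !dehomogM dehomog_var mul1r.
  have -> : lift ord0 ord0 = 1 :> 'I_2 by apply/val_inj.
  have -> : ord0 = 0 :> 'I_2 by apply/val_inj.
  by rewrite /D addrK.
rewrite (sum_lift i) big_ord_recl big_ord1 e.
have -> : lift ord0 ord0 = 1 :> 'I_2 by apply/val_inj.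
have -> : ord0 = 0 :> 'I_2 by apply/val_inj.
rewrite -/(D 0) -/(D 1) !dehomog_deriv -/(D 0) -/(D 1) -mul_mpolyC.
move: (D 0) (D 1) (dehomog i f) (P i) (P (lift i 0)) (P (lift i 1)) (dehomog i 'X_(lift i 0)) (dehomog i 'X_(lift i 1)).
move=> D0 D1 g p p0 p1 x0 x1.
by exists (p * d%:R%:MP), (p0 - p * x0), (p1 - p * x1); ring.
Qed.

Lemma tjurina_ideal_loc (a : 'I_2 -> K) i (p : A2) :
  tjurina_ideal (dehomog i f) a (tofrac p) <-> loc (chart_jac i) a p.
Proof.
split.
- move=> [_ [_ [_ [[r [r' [ra ->]]] [s [s' [sa ->]]] [t [t' [ta ->]]]]]]] e.
  exists (r' * s' * t'); rewrite !mevalM !mulf_neq0 //; split=> //.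
  apply/chart_jacP; exists (r * s' * t'), (r' * s * t'), (r' * s' * t).
  have nz (w : A2) : w.@[a] != 0 -> tofrac w != 0.
    by rewrite tofrac_eq0; apply: contraNneq => ->; rewrite meval0.
  apply/eqP; rewrite -tofrac_eq; apply/eqP.
  rewrite !(tofracD, tofracM) e.
  by apply: clear_denom3; apply: nz.
- move=> [s [sa /chart_jacP[r0 [r1 [r2 e]]]]].
  have s0 : tofrac s != 0 by rewrite tofrac_eq0; apply: contraNneq sa => ->; rewrite meval0.
  exists (tofrac r0 / tofrac s), (tofrac r1 / tofrac s), (tofrac r2 / tofrac s); split.
  + by exists r0, s.
  + by exists r1, s.
  + by exists r2, s.
  by apply: (mulfI s0); rewrite -tofracM e !(tofracD, tofracM) common_denom3.
Qed.

(** Homogenize a representation p u = sum of P_j f_j in one common degree;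
    dehomogenization is injective there. *)
Lemma chart_jac_lift i (k : nat) (u : S) p : graded_piece k u -> chart_jac i (p * dehomog i u) ->
  exists (e : nat) s, [/\ graded_piece e s, dehomog i s = p & jacobian_ideal f (s * u)].
Proof.
move=> gu [P eP].
(* any bound on the degrees of p and of the P_j *)
pose M := (msize p + \sum_j msize (P j))%N.
have szP j : (msize (P j) <= M)%N by rewrite /M (bigD1 j) //=; lia.
have szp : (msize p <= M)%N by rewrite /M leq_addr.
exists (M + (d - 1))%N, (rehomog i (M + (d - 1)) p).
have gs : graded_piece (M + (d - 1))%N (rehomog i (M + (d - 1)) p) by apply/rehomog_graded/(leq_trans szp); lia.
split=> //; first exact: rehomogK.
apply/jacP; exists (fun j => rehomog i (M + k) (P j)).
apply: (dehomog_inj (i := i) (k := (M + (d - 1) + k)%N)).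
- by have := gradedM gs gu; rewrite -PoszD.
- apply: graded_sum => j _.
  have -> : (M + (d - 1) + k)%N%:Z = (M + k)%N%:Z + (d%:Z - 1) by lia.
  by apply: gradedM; [apply/rehomog_graded/(leq_trans (szP j)); lia | apply: graded_deriv].
rewrite dehomogM rehomogK eP dehomog_sum; apply: eq_bigr => j _.
by rewrite dehomogM rehomogK.
Qed.

(** Membership of a form in the localization of J at v, in terms that do not
    depend on a chart or on the representative v. *)
Definition locally_in (v : 'rV[K]_3) (u : S) : Prop :=
  exists (e : nat) s, [/\ graded_piece e s, ev s v != 0 & jacobian_ideal f (s * u)].

Lemma locally_inZ v c u : c != 0 -> locally_in (c *: v) u <-> locally_in v u.
Proof.
move=> c0; split=> -[e [s [gs sv hs]]]; exists e, s; split=> //.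
  by apply: contraNneq sv => h; rewrite (ev_scale _ _ gs) h mulr0.
by rewrite (ev_scale _ _ gs) mulf_neq0 // expf_neq0.
Qed.

Lemma locally_in_loc (a : 'I_2 -> K) i (k : nat) u : graded_piece k u ->
  loc (chart_jac i) a (dehomog i u) <-> locally_in (chart_point i a) u.
Proof.
move=> gu; split=> [[p [pa hp]]|[e [s [gs sv hs]]]].
  have [e [s [gs es hs]]] := chart_jac_lift gu hp.
  by exists e, s; split=> //; rewrite -dehomog_ev es.
exists (dehomog i s); rewrite dehomog_ev; split=> //.
by rewrite -dehomogM; apply: jac_chart.
Qed.

Lemma chart_pointK i (v : 'rV[K]_3) : v 0 i != 0 ->
  chart_point i (chart_coord i v) = (v 0 i)^-1 *: v.
Proof.
move=> vi; apply/rowP => j; rewrite !mxE; case: (unliftP i j) => [t ->|->].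
  by rewrite /chart_coord mulrC.
by rewrite mulVf.
Qed.

Lemma locally_in_tjurina i (v : 'rV[K]_3) (k : nat) u : v 0 i != 0 -> graded_piece k u ->
  tjurina_ideal (dehomog i f) (chart_coord i v) (tofrac (dehomog i u)) <-> locally_in v u.
Proof.
move=> vi gu; rewrite tjurina_ideal_loc (locally_in_loc _ _ gu) chart_pointK //.
by apply: locally_inZ; rewrite invr_eq0.
Qed.

Lemma normalize (v : 'rV[K]_3) : v != 0 -> exists2 c, c != 0 & proj_plane (c *: v).
Proof.
move=> v0; have [i vi mi] : exists2 i : 'I_3, v 0 i != 0 & forall j : 'I_3, (j < i)%N -> v 0 j = 0.
  have ex : exists n, [exists i : 'I_3, (val i == n) && (v 0 i != 0)].
    have [i vi] : exists i, v 0 i != 0.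
      by apply: contrapT => h; case/eqP: v0; apply/rowP => i; rewrite mxE; apply: contrapT => /eqP ?; apply: h; exists i.
    by exists (val i); apply/existsP; exists i; rewrite eqxx.
  case: (ex_minnP ex) => n /existsP[i /andP[/eqP <- vi]] mi; exists i => // j lt.
  apply: contrapT => /eqP vj; have := mi j; rewrite leqNgt lt => /(_ _)/negP; apply=> //.
  by apply/existsP; exists j; rewrite eqxx.
exists (v 0 i)^-1; first by rewrite invr_eq0.
by exists i; rewrite mxE mulVf //; split=> // j /mi e; rewrite mxE e mulr0.
Qed.

Lemma singular_atZ c v : c != 0 -> singular_at f v -> singular_at f (c *: v).
Proof.
move=> c0 [h hx hy hz].
have h' (p : S) (k : int) : graded_piece k p -> ev p v = 0 -> ev p (c *: v) = 0.
  case: k => k; last by move=> /graded_negE -> _; rewrite /ev meval0.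
  by move=> gp e; rewrite (ev_scale _ _ gp) e mulr0.
by split; [apply: h' h | apply: h' hx | apply: h' hy | apply: h' hz]; try exact: f_graded;
  apply: graded_deriv f_graded.
Qed.

Lemma singular_jac v : singular_at f v <-> forall u, jacobian_ideal f u -> ev u v = 0.
Proof.
split=> [[h hx hy hz] u [a [b [c ->]]]|h].
  rewrite /ev !mevalD !mevalM -/(ev (fx f) v) -/(ev (fy f) v) -/(ev (fz f) v).
  by rewrite hx hy hz !mulr0 !addr0.
have hx : ev (fx f) v = 0 by apply: h; exists 1, 0, 0; ring.
have hy : ev (fy f) v = 0 by apply: h; exists 0, 1, 0; ring.
have hz : ev (fz f) v = 0 by apply: h; exists 0, 0, 1; ring.
split=> //; have d0 : d%:R != 0 :> K by rewrite pnatr_eq0 -lt0n.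
apply: (mulfI d0); rewrite mulr0 -mevalZ -(euler f_graded) sum3E !mevalD !mevalM.
by rewrite -!/(ev _ v) hx hy hz !mulr0 !addr0.
Qed.

Lemma singular_chart i (a : 'I_2 -> K) : singular_at f (chart_point i a) <->
  forall q, chart_jac i q -> q.@[a] = 0.
Proof.
rewrite singular_jac; split=> [h q hq|h u hu]; last first.
  by rewrite -dehomog_ev; apply/h/jac_chart.
have g0 : graded_piece 0%N (1 : S) by rewrite -mpolyC1; apply: gradedC.
have := @chart_jac_lift i 0 1 q g0; rewrite dehomog1 mulr1 => /(_ hq)[e [s [_ <- hs]]].
by rewrite dehomog_ev; apply: h; rewrite mulr1 in hs.
Qed.

Hypothesis sqfree : forall i (h q : A2), dehomog i f = h ^+ 2 * q -> exists c, h = c%:MP.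
Hypothesis f_neq0 : f != 0.

(** Without square factors, only the first alternative of [eliminant_or_square] is
    left; it is applied with the roles of the two variables exchanged. *)
Lemma chart_eliminant i t : exists c : {poly K}, c != 0 /\ chart_jac i (inX t c).
Proof.
have char0 n : n.+1%:R != 0 :> K by rewrite pnatr_eq0.
have g0 : dehomog i f != 0.
  apply: contraNneq f_neq0 => e; apply/eqP; apply: (dehomog_inj (i := i) f_graded (graded0 _)).
  by rewrite e dehomog0.
have [[A [B [c [c0 e]]]]|[h [q [e hc]]]] := eliminant_or_square char0 (lift t ord0) g0.
  exists c; split=> //; have -> : t = lift (lift t ord0) ord0.
    by move: t {A B e}; apply: ord2_ind; apply/val_inj.
  rewrite -e; have [_ cD cM] := chart_jac_ideal i; apply: cD; apply: cM.
    exact: chart_jac_eq.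
  by rewrite dehomog_deriv; apply: chart_jac_gen.
by have [c eh] := sqfree e; case: (hc c).
Qed.

Lemma chart_zero i (b : set A2) : ideal_axiom b -> chart_jac i `<=` b ->
  (forall a, singular_at f (chart_point i a) -> exists2 p, b p & p.@[a] != 0) -> b 1.
Proof.
move=> ib sub hb; have /choice[c hc] := chart_eliminant i.
apply: (nullstellensatz2 (c := c) ib) => [t|a].
  by have [c0 h] := hc t; split=> //; apply: sub.
have [sa|nsa] := pselect (singular_at f (chart_point i a)); first exact: hb.
have [q hq qa] : exists2 q, chart_jac i q & q.@[a] != 0.
  apply: contrapT => hn; apply/nsa/singular_chart => q hq; apply: contrapT => /eqP qa.
  by apply: hn; exists q.
by exists q => //; apply: sub.
Qed.

Lemma chart_jac_power i (k : nat) u : graded_piece k u -> chart_jac i (dehomog i u) ->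
  exists e : nat, jacobian_ideal f ('X_i ^+ e * u).
Proof.
move=> gu; rewrite -[dehomog i u]mul1r => /(chart_jac_lift gu)[e [s [gs es hs]]].
exists e; suff -> : 'X_i ^+ e = s by [].
apply: (dehomog_inj (i := i) (k := e)) => //.
  have := gradedX e (gradedMon U_(i)%MM : graded_piece (mdeg U_(i)%MM) ('X_i : S)).
  by rewrite mdeg1 mul1n.
by rewrite dehomogXn dehomog_var expr1n.
Qed.

(** In each chart the ideal of the q such that q u lies in the affine Jacobian
    ideal contains the eliminants and has no zero, hence contains 1; homogenizing,
    a power of every variable multiplies u into J. *)
Lemma local_global (k : nat) u : graded_piece k u ->
  (forall v, sing f v -> locally_in v u) -> saturation (jacobian_ideal f) u.
Proof.
move=> gu hu; have [j0 jD jM] := jac_ideal.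
have /choice[e he] : forall i, exists e : nat, jacobian_ideal f ('X_i ^+ e * u).
  move=> i; apply: (chart_jac_power gu).
  (* the ideal quotient of the affine Jacobian ideal by u *)
  pose b : set A2 := [set q | chart_jac i (q * dehomog i u)].
  have [c0 cD cM] := chart_jac_ideal i.
  suff : b 1 by rewrite /b /= mul1r.
  apply: (chart_zero (i := i)).
  - split; rewrite /b /=.
    + by rewrite mul0r.
    + by move=> p q hp hq; rewrite mulrDl; apply: cD.
    + by move=> p q hq; rewrite -mulrA; apply: cM.
  - by move=> q hq; rewrite /b /= mulrC; apply: cM.
  move=> a sa; have cp0 : chart_point i a != 0.
    apply/eqP => /rowP/(_ i); rewrite !mxE unlift_none => /eqP.
    by rewrite oner_eq0.
  have [l l0 pl] := normalize cp0.
  have /hu/(locally_inZ _ _ l0)/(locally_in_loc _ _ gu)[s [sa' hs]] : sing f (l *: chart_point i a).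
    by split=> //; apply: singular_atZ.
  by exists s.
exists (\sum_i e i)%N => m hm.
have [i le] : exists i, (e i <= m i)%N.
  apply: contrapT => hn.
  have lt i : (m i < e i)%N by rewrite ltnNge; apply/negP => ?; apply: hn; exists i.
  by move: hm; rewrite mdegE !sum3E; have := lt 0; have := lt 1; have := lt 2%:R; lia.
have -> : 'X_[m] = 'X_[m - U_(i) *+ e i] * 'X_i ^+ e i :> S.
  rewrite mpolyXn -mpolyXD; congr 'X_[_]; apply/mnmP => t.
  rewrite mnmDE mnmBE mulmnE mnm1E; have [<-|_] := eqVneq i t; last by lia.
  by rewrite mul1n subnK.
by rewrite -mulrA; apply: jM.
Qed.

End SingularPoints.

(** * The local algebras of a plane curve *)

Section LocalAlgebras.
Variable K : numClosedFieldType.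
Local Notation S := {mpoly K[3]}.
Local Notation A2 := {mpoly K[2]}.
Local Notation F2 := {fraction {mpoly K[2]}}.
Local Notation iotaS := (@iotaS K).
Notation inX t := (horner_alg ('X_t : A2)).

Definition iotaF : {rmorphism K -> F2} := (@tofrac A2) \o (@mpolyC 2 K).

Lemma local_ringD a (x y : F2) : local_ring a x -> local_ring a y -> local_ring a (x + y).
Proof.
move=> [p [s [sa ->]]] [q [t [ta ->]]].
have nz (w : A2) : w.@[a] != 0 -> tofrac w != 0.
  by rewrite tofrac_eq0; apply: contraNneq => ->; rewrite meval0.
exists (p * t + q * s), (s * t); rewrite mevalM mulf_neq0 //; split=> //.
by rewrite tofracD !tofracM addf_div ?nz.
Qed.

Lemma local_ringM a (x y : F2) : local_ring a x -> local_ring a y -> local_ring a (x * y).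
Proof.
move=> [p [s [sa ->]]] [q [t [ta ->]]].
exists (p * q), (s * t); rewrite mevalM mulf_neq0 //; split=> //.
by rewrite !tofracM mulf_div.
Qed.

Lemma local_ring_poly a (p : A2) : local_ring a (tofrac p).
Proof. by exists p, 1; rewrite meval1 oner_neq0 tofrac1 divr1. Qed.

Lemma local_ring_inv a (s : A2) : s.@[a] != 0 -> local_ring a (tofrac s)^-1.
Proof. by move=> sa; exists 1, s; rewrite tofrac1 mul1r. Qed.

Lemma subspace_local a : subspace iotaF (local_ring a : set F2^o).
Proof.
split=> [|c u v hu hv]; first by rewrite -tofrac0; apply: local_ring_poly.
apply: local_ringD => //; apply: (@local_ringM a (iotaF c)) => //.
exact: local_ring_poly.
Qed.

Lemma tjurina_idealD (g : A2) a x y : tjurina_ideal g a x -> tjurina_ideal g a y -> tjurina_ideal g a (x + y).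
Proof.
move=> [r [s [t [hr hs ht ->]]]] [r' [s' [t' [hr' hs' ht' ->]]]].
exists (r + r'), (s + s'), (t + t'); split; try exact: local_ringD.
by rewrite !mulrDl addrACA [X in X + _ = _]addrACA.
Qed.

Lemma tjurina_idealM (g : A2) a x y : local_ring a x -> tjurina_ideal g a y -> tjurina_ideal g a (x * y).
Proof.
move=> hx [r [s [t [hr hs ht ->]]]].
exists (x * r), (x * s), (x * t); split; try exact: local_ringM.
by rewrite !mulrDr !mulrA.
Qed.

Lemma subspace_tjurina (g : A2) a : subspace iotaF (tjurina_ideal g a : set F2^o).
Proof.
split=> [|c u v hu hv].
  have z := local_ring_poly a 0; rewrite tofrac0 in z.
  by exists 0, 0, 0; split=> //; rewrite !mul0r !addr0.
apply: tjurina_idealD => //; apply: (@tjurina_idealM _ _ (iotaF c)) => //.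
exact: local_ring_poly.
Qed.

Lemma ideal_sum (R : comNzRingType) (b : set R) I (r : seq I) (P : pred I) (F : I -> R) :
  ideal_axiom b -> (forall i, P i -> b (F i)) -> b (\sum_(i <- r | P i) F i).
Proof. by move=> [b0 bD bM] h; elim/big_ind: _ => //. Qed.

Lemma ideal_exp_le (R : comNzRingType) (b : set R) x m n : ideal_axiom b -> (m <= n)%N ->
  b (x ^+ m) -> b (x ^+ n).
Proof. by move=> [b0 bD bM] le hx; rewrite -(subnK le) exprD; apply: bM. Qed.

(** Each term of the binomial expansion contains the m-th power of x or the n-th
    power of y. *)
Lemma ideal_nilp_comb (R : comNzRingType) (b : set R) x y p q m n : ideal_axiom b ->
  b (x ^+ m) -> b (y ^+ n) -> b ((x * p + y * q) ^+ (m + n)).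
Proof.
move=> ib hx hy; have [b0 bD bM] := ib.
rewrite exprDn; apply: ideal_sum => // i _; rewrite -mulr_natl; apply: (bM).
rewrite !exprMn; have [le|lt] := leqP n i.
  have -> : forall z w t : R, z * w * (y ^+ i * t) = z * w * t * y ^+ i by move=> z w t; ring.
  by apply: (bM); apply: ideal_exp_le le hy.
have -> : forall z w t : R, x ^+ (m + n - i) * z * (w * t) = z * w * t * x ^+ (m + n - i) by move=> z w t; ring.
by apply: bM; apply: ideal_exp_le hx => //; lia.
Qed.

Lemma msizeM_pred (p q : A2) : (msize (p * q) <= (msize p + msize q).-1)%N.
Proof.
have [->|p0] := eqVneq p 0; first by rewrite mul0r msize0.
have [->|q0] := eqVneq q 0; first by rewrite mulr0 msize0.
by rewrite msizeM.
Qed.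

Section ResidueAlgebra.
Variables (b : set A2) (a : 'I_2 -> K) (N : 'I_2 -> nat).
Hypothesis ib : ideal_axiom b.
Hypothesis nilp : forall t, loc b a (('X_t - (a t)%:MP) ^+ N t).

Lemma loc_nilp_vanish (q : A2) : q.@[a] = 0 -> loc b a (q ^+ (N 0%R + N 1%R)).
Proof.
move=> qa; have [p0 [p1 ->]] := taylor2 q a; rewrite qa mpolyC0 add0r.
by apply: ideal_nilp_comb => //; apply: loc_ideal.
Qed.

(** A unit s of the local ring is s(a) - t with t nilpotent, so that a truncated
    geometric series in t inverts it: local fractions are congruent to
    polynomials. *)
Lemma loc_inverse (s p : A2) : s.@[a] != 0 -> exists c, loc b a (s * c - p).
Proof.
move=> sa; set s0 := s.@[a] in sa; pose M := (N 0%R + N 1%R)%N.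
have [t ht] : exists t, t = s0%:MP - s by exists (s0%:MP - s).
have ta : t.@[a] = 0 by rewrite ht mevalB mevalC subrr.
pose e := \sum_(i < M) (s0%:MP) ^+ (M.-1 - i) * t ^+ i.
have es : s * e = (s0%:MP) ^+ M - t ^+ M.
  have es' : s = s0%:MP - t by rewrite ht; ring.
  by rewrite subrXX -es'.
exists ((s0 ^- M)%:MP * e * p).
have [l0 lD lM] := loc_ideal a ib.
have -> : s * ((s0 ^- M)%:MP * e * p) - p = (- (s0 ^- M)%:MP * p) * t ^+ M.
  rewrite -[LHS](_ : (s0 ^- M)%:MP * (s * e) * p - p = _); last by ring.
  have h : (s0 ^- M)%:MP * s0%:MP ^+ M = 1 :> A2.
    by rewrite -(rmorphXn (@mpolyC 2 K)) -mpolyCM mulVf ?expf_neq0.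
  by rewrite es mulrBr h; ring.
by apply: lM; apply: loc_nilp_vanish.
Qed.

Lemma msize_linear_exp t (c : K) n : (msize (('X_t - c%:MP) ^+ n : A2) <= n.+1)%N.
Proof.
elim: n => [|n ih]; first by rewrite expr0 msize1.
rewrite exprS; apply: (leq_trans (msizeM_pred _ _)).
have : (msize ('X_t - c%:MP : A2) <= 2)%N.
  apply: (leq_trans (msizeD_le _ _)); rewrite msizeN msizeX msizeC mdeg1.
  by case: (c != 0).
by move=> h; move: (leq_add h ih); rewrite add2n; move: (_ + _)%N => k; lia.
Qed.

(** In the Taylor expansion of p at a, the terms of high degree in one variable lie
    in b.  The uniform degree bound on the rest allows one degree k to serve for
    all elements of the local algebra. *)
Lemma loc_bounded_rep (p : A2) : exists c, (msize c <= (N 0%R + N 1%R).+1)%N /\ loc b a (c - p).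
Proof.
pose r := p \mPo [tuple 'X_t + (a t)%:MP | t < 2].
pose sh := [tuple 'X_t - (a t)%:MP | t < 2] : 2.-tuple A2.
have ep : p = r \mPo sh.
  elim/mpoly_gen_ind: p @r => [c|t|p q ep eq|p q ep eq] /=.
  - by rewrite !comp_mpolyC.
  - rewrite !comp_mpolyXU -!tnth_nth tnth_mktuple comp_mpolyD comp_mpolyC comp_mpolyXU.
    by rewrite -tnth_nth tnth_mktuple subrK.
  - by rewrite !comp_mpolyD -ep -eq.
  - by rewrite !rmorphM /= -ep -eq.
pose P (m : 'X_{1..2}) := (m 0%R < N 0%R)%N && (m 1%R < N 1%R)%N.
pose T (m : 'X_{1..2}) : A2 := ('X_0 - (a 0)%:MP) ^+ m 0%R * ('X_1 - (a 1)%:MP) ^+ m 1%R.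
have eT m : 'X_[m] \mPo sh = T m.
  rewrite comp_mpolyX big_ord_recl big_ord1 !tnth_mktuple /T.
  have -> : lift ord0 ord0 = 1 :> 'I_2 by apply/val_inj.
  by have -> : ord0 = 0 :> 'I_2 by apply/val_inj.
exists (\sum_(m <- msupp r | P m) r@_m *: T m); split.
  apply: (leq_trans (msize_sum _ _ _)); apply/bigmax_leqP_seq => m _ /andP[h0 h1].
  apply: (leq_trans (msizeZ_le _ _)); apply: (leq_trans (msizeM_pred _ _)).
  move: (leq_add (msize_linear_exp 0 (a 0) (m 0%R)) (msize_linear_exp 1 (a 1) (m 1%R))).
  by move: h0 h1; move: (msize _ + msize _)%N => k; lia.
rewrite {1}ep comp_mpolyEX [X in _ - X](bigID P) /=.
have -> : \sum_(m <- msupp r | P m) r@_m *: ('X_[m] \mPo sh) = \sum_(m <- msupp r | P m) r@_m *: T m.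
  by apply: eq_bigr => m _; rewrite eT.
rewrite opprD addrA subrr add0r -sumrN; apply: ideal_sum; first exact: loc_ideal.
have [l0 lD lM] := loc_ideal a ib.
move=> m; rewrite eT negb_and -!leqNgt /T -mul_mpolyC.
have il := loc_ideal a ib.
move=> /orP[le|le].
  have := ideal_exp_le il le (nilp 0).
  move: (_ ^+ m 0%R) (_ ^+ m 1%R) => x y hx.
  have -> : - ((r@_m)%:MP * (x * y)) = - ((r@_m)%:MP * y) * x by ring.
  exact: lM.
have := ideal_exp_le il le (nilp 1).
move: (_ ^+ m 0%R) (_ ^+ m 1%R) => x y hx.
have -> : - ((r@_m)%:MP * (x * y)) = - ((r@_m)%:MP * x) * y by ring.
exact: lM.
Qed.

End ResidueAlgebra.
End LocalAlgebras.

(** * The total Tjurina number as a Hilbert polynomial *)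

Section GlobalLocal.
Variable K : numClosedFieldType.
Local Notation S := {mpoly K[3]}.
Local Notation A2 := {mpoly K[2]}.
Local Notation F2 := {fraction {mpoly K[2]}}.
Local Notation iotaS := (@iotaS K).
Local Notation iotaF := (@iotaF K).
Notation inX t := (horner_alg ('X_t : A2)).

(** Two normalized vectors are not proportional, so some 2 x 2 minor of theirs is
    nonzero. *)
Lemma separating_line (v v' : 'rV[K]_3) : proj_plane v -> proj_plane v' -> v' != v ->
  exists l, [/\ graded_piece 1 l, ev l v != 0 & ev l v' = 0].
Proof.
move=> [i [vi mi]] [i' [vi' mi']] ne.
have [[j [k jk]]|nm] := pselect (exists j k, v 0 j * v' 0 k != v 0 k * v' 0 j).
  exists (v' 0 k *: 'X_j - v' 0 j *: 'X_k); split.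
  - apply: gradedB; apply: gradedZ; [have := gradedMon U_(j)%MM : graded_piece _ ('X_j : S) |
      have := gradedMon U_(k)%MM : graded_piece _ ('X_k : S)]; by rewrite mdeg1.
  - by rewrite /ev mevalB !mevalZ !mevalXU subr_eq0 mulrC [X in _ != X]mulrC.
  - by rewrite /ev mevalB !mevalZ !mevalXU mulrC subrr.
have e j k : v 0 j * v' 0 k = v 0 k * v' 0 j.
  by apply/eqP; apply: contrapT => /negP h; apply: nm; exists j, k.
have vc j : v' 0 j = v 0 j * v' 0 i by have := e i j; rewrite vi mul1r.
have c1 : v' 0 i = 1.
  have := vc i'; rewrite vi' => h.
  have [lt|gt|eq] := ltngtP i i'.
  - by have := vc i'; rewrite vi' (mi' _ lt) mulr0 => /eqP; rewrite oner_eq0.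
  - by have := vc i'; rewrite vi' (mi _ gt) mul0r => /eqP; rewrite oner_eq0.
  - by rewrite -vi'; congr (v' 0 _); apply/val_inj.
by case/eqP: ne; apply/rowP => j; rewrite vc c1 mulr1.
Qed.

Lemma isolating_form (v : 'rV[K]_3) (vs : seq 'rV[K]_3) : proj_plane v ->
  (forall w, w \in vs -> proj_plane w /\ w != v) ->
  exists (D : nat) q, [/\ graded_piece D q, ev q v != 0 & forall w, w \in vs -> ev q w = 0].
Proof.
move=> pv; elim: vs => [_|w vs ih h].
  exists 0%N, 1; split=> //; last by rewrite /ev meval1 oner_neq0.
  by rewrite -mpolyC1; apply: gradedC.
have [|D [q [gq qv qw]]] := ih; first by move=> w' hw; apply: h; rewrite inE hw orbT.
have [pw ne] := h w (mem_head _ _).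
have [l [gl lv lw]] := separating_line pv pw ne.
exists (D + 1)%N, (q * l); split.
- by rewrite PoszD; apply: gradedM.
- by rewrite /ev mevalM mulf_neq0.
- move=> w'; rewrite inE /ev mevalM => /orP[/eqP ->|/qw e].
    by rewrite -/(ev l w) lw mulr0.
  by rewrite -/(ev q w') e mul0r.
Qed.

Variables (d : nat) (f : S).
Hypothesis d_gt0 : (0 < d)%N.
Hypothesis f_graded : graded_piece d f.
Hypothesis sqfree : forall i (h q : A2), dehomog i f = h ^+ 2 * q -> exists c, h = c%:MP.
Hypothesis f_neq0 : f != 0.

Local Notation J := (jacobian_ideal f).
Local Notation LJ := (locally_in f).

(** The coordinates of a singular point are roots of the eliminants in its
    chart. *)
Lemma sing_finite : finite_set (sing f).
Proof.
have /choice[c hc] : forall i, exists c : 'I_2 -> {poly K}, forall t,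
    c t != 0 /\ chart_jac f i (inX t (c t)).
  move=> i; have /choice[c hc] := chart_eliminant d_gt0 f_graded sqfree f_neq0 i.
  by exists c.
have /choice[r hr] : forall it : 'I_3 * 'I_2, exists r : seq K, forall z, root (c it.1 it.2) z -> z \in r.
  move=> [i t]; have [r er] := closed_field_poly_normal (c i t); exists r => z /=.
  have [c0 _] := hc i t.
  by rewrite er rootZ ?lead_coef_eq0 // root_prod_XsubC.
pose pts i := [seq chart_point i (fun t : 'I_2 => if t == 0 then xy.1 else xy.2) |
   xy <- [seq (x, y) | x <- r (i, 0), y <- r (i, 1)]].
apply: (@sub_finite_set _ _ [set` pts 0 ++ pts 1 ++ pts 2%:R]); last exact: finite_seq.
move=> v [[i [vi _]] sv] /=.
suff : v \in pts i.
  by move: i {vi}; apply: ord3_ind => h; rewrite !mem_cat h ?orbT.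
pose a : 'I_2 -> K := fun t => v 0 (lift i t).
have ea : chart_point i a = v.
  by apply/rowP => j; rewrite mxE; case: (unliftP i j) => [t ->|->].
have ra t : a t \in r (i, t).
  apply: hr => /=; have [_ h] := hc i t.
  apply/rootP; rewrite -(inX_ev t (c i t) a).
  by apply: ((singular_chart d_gt0 f_graded i a).1 _ _ h); rewrite ea.
apply/mapP; exists (a 0, a 1); first by apply: allpairs_f.
rewrite -ea; apply/rowP => j; rewrite !mxE; case: unlift => // t.
by move: t; apply: ord2_ind.
Qed.

Lemma locally_in_ideal v : ideal_axiom (LJ v).
Proof.
have [j0 jD jM] := jac_ideal f; split.
- exists 0%N, 1; rewrite mulr0; split=> //; last by rewrite /ev meval1 oner_neq0.
  by rewrite -mpolyC1; apply: gradedC.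
- move=> p q [e [s [gs sv hs]]] [e' [s' [gs' sv' hs']]].
  exists (e + e')%N, (s * s'); split.
  + by rewrite PoszD; apply: gradedM.
  + by rewrite /ev mevalM mulf_neq0.
  + have -> : s * s' * (p + q) = s' * (s * p) + s * (s' * q) by ring.
    by apply: jD; apply: jM.
- move=> p q [e [s [gs sv hs]]]; exists e, s; split=> //.
  have -> : s * (p * q) = p * (s * q) by ring.
  exact: jM.
Qed.

Lemma jac_locally v u : J u -> LJ v u.
Proof.
move=> hu; exists 0%N, 1; rewrite mul1r /ev meval1 oner_neq0; split=> //.
by rewrite -mpolyC1; apply: gradedC.
Qed.

Lemma chart_nilp i (a : 'I_2 -> K) : exists N : 'I_2 -> nat,
  forall t, loc (chart_jac f i) a (('X_t - (a t)%:MP) ^+ N t).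
Proof.
have /choice[N hN] : forall t, exists n, loc (chart_jac f i) a (('X_t - (a t)%:MP) ^+ n).
  move=> t; have [c [c0 hc]] := chart_eliminant d_gt0 f_graded sqfree f_neq0 i t.
  exact: (loc_nilp a (chart_jac_ideal f i) c0 hc).
by exists N.
Qed.

Lemma locally_in_nilp v (D : nat) q : proj_plane v -> graded_piece D q -> ev q v = 0 ->
  exists N, LJ v (q ^+ N).
Proof.
move=> [i [vi _]] gq qv; have vi0 : v 0 i != 0 by rewrite vi oner_neq0.
have [N hN] := chart_nilp i (chart_coord i v).
exists (N 0%R + N 1%R)%N; have gqN := gradedX (N 0%R + N 1%R)%N gq.
apply/(locally_in_tjurina d_gt0 f_graded vi0 gqN)/(tjurina_ideal_loc d_gt0 f_graded).
rewrite dehomogXn; apply: loc_nilp_vanish => //; first exact: chart_jac_ideal.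
by rewrite dehomog_ev chart_pointK // vi invr1 scale1r.
Qed.

(** Let w be a high power of a form that vanishes at the points of vs but not at v:
    it lies in J locally at vs and is a unit at v.  Multiples of w by
    homogenized polynomials of bounded degree then realize every element of the local algebra at v. *)
Lemma local_surjective v i (vs : seq 'rV[K]_3) : proj_plane v -> v 0 i != 0 ->
  (forall w, w \in vs -> proj_plane w /\ w != v) ->
  exists k0 : nat, forall k : nat, (k0 <= k)%N -> forall x, local_ring (chart_coord i v) x ->
    exists u, [/\ graded_piece k u, forall w, w \in vs -> LJ w u
      & tjurina_ideal (dehomog i f) (chart_coord i v) (tofrac (dehomog i u) - x)].
Proof.
move=> pv vi hvs; have [D [q [gq qv qw]]] := isolating_form pv hvs.
have [M hM] : exists M, forall w, w \in vs -> LJ w (q ^+ M).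
  elim: vs hvs qw => [|w vs ih] hvs qw; first by exists 0%N.
  have [||M hM] := ih.
  - by move=> w' hw; apply: hvs; rewrite inE hw orbT.
  - by move=> w' hw; apply: qw; rewrite inE hw orbT.
  have [pw _] := hvs w (mem_head _ _).
  have [N hN] := locally_in_nilp pw gq (qw w (mem_head _ _)).
  exists (M + N)%N => w'; rewrite inE => /orP[/eqP->|/hM h].
    by apply: ideal_exp_le hN; [apply: locally_in_ideal | rewrite leq_addl].
  by apply: ideal_exp_le h; [apply: locally_in_ideal | rewrite leq_addr].
set a := chart_coord i v; have [N hN] := chart_nilp i a.
pose w := q ^+ M; have gw : graded_piece (D * M)%N w := gradedX M gq.
have wa : (dehomog i w).@[a] != 0.
  rewrite dehomog_ev chart_pointK // (ev_scale _ _ gw) mulf_neq0 ?expf_neq0 ?invr_eq0 //.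
  by rewrite /w /ev rmorphXn expf_neq0.
have ib := chart_jac_ideal f i; have il := loc_ideal a ib; have [l0 lD lM] := il.
exists (D * M + (N 0%R + N 1%R).+1)%N => k le x [p [s [sa ->]]].
have swa : (s * dehomog i w).@[a] != 0 by rewrite mevalM mulf_neq0.
have [c hc] := loc_inverse ib hN p swa.
have [c' [szc' hc']] := loc_bounded_rep ib hN c.
have s0 : tofrac s != 0 by rewrite tofrac_eq0; apply: contraNneq sa => ->; rewrite meval0.
exists (rehomog i (k - D * M) c' * w); split.
- have -> : k%:Z = (k - D * M)%N%:Z + (D * M)%N%:Z by lia.
  apply: gradedM => //; apply/rehomog_graded/(leq_trans szc'); lia.
- by move=> w' hw'; have [_ _ h] := locally_in_ideal w'; apply: h; apply: hM.
rewrite dehomogM rehomogK.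
have -> : tofrac (c' * dehomog i w) - tofrac p / tofrac s =
    (tofrac s)^-1 * tofrac (s * (c' * dehomog i w) - p).
  by rewrite tofracB [tofrac (s * _)]tofracM mulrBr mulKf // [tofrac p / _]mulrC.
apply: tjurina_idealM; first exact: local_ring_inv.
apply/(tjurina_ideal_loc d_gt0 f_graded).
have -> : s * (c' * dehomog i w) - p = s * dehomog i w * (c' - c) + (s * dehomog i w * c - p) by ring.
by apply: lD => //; apply: lM.
Qed.

(** The forms of degree k that lie in J locally at the points of vs. *)
Definition local_kernel (vs : seq 'rV[K]_3) (k : int) : set S :=
  [set u | graded_piece k u /\ forall w, w \in vs -> LJ w u].

Lemma subspace_local_kernel vs k : subspace iotaS (local_kernel vs k : set S^o).
Proof.
split=> [|c u v [gu hu] [gv hv]]; split.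
- exact: graded0.
- by move=> w _; have [] := locally_in_ideal w.
- by case: (subspace_graded K k) => _; apply.
- move=> w hw; have [_ hD hM] := locally_in_ideal w; apply: hD; last exact: hv.
  by apply: (hM (iotaS c)); apply: hu.
Qed.

Lemma tjurinaE v : proj_plane v -> exists i, v 0 i != 0 /\
  tjurina f v = affine_tjurina (dehomog i f) (chart_coord i v).
Proof.
move=> [i [vi _]]; rewrite /tjurina; case: pickP => [i' vi'|/(_ i)]; first by exists i'.
by rewrite vi oner_eq0.
Qed.

(** Each further point cuts out a subspace whose quotient is the local algebra at
    that point. *)
Lemma local_filtration (vs : seq 'rV[K]_3) : uniq vs -> (forall v, v \in vs -> proj_plane v) ->
  exists k0 : nat, forall k : nat, (k0 <= k)%N ->
    qdim iotaS (graded_piece k : set S^o) (local_kernel vs k) (\sum_(v <- vs) tjurina f v).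
Proof.
elim: vs => [_ _|v vs ih /= /andP[vvs uvs] hp].
  exists 0%N => k _; rewrite big_nil; apply/qdim0P; first exact: subspace_local_kernel.
  by move=> u gu; split.
have [k1 hk1] := ih uvs (fun w hw => hp w (mem_behead (s := v :: vs) hw)).
have pv := hp v (mem_head _ _); have [i [vi ev]] := tjurinaE pv.
have [|k2 hk2] := @local_surjective v i vs pv vi.
  move=> w hw; split; first by apply: hp; rewrite inE hw orbT.
  by apply: contraNneq vvs => <-.
exists (maxn k1 k2) => k; rewrite geq_max => /andP[/hk1 d1 /hk2 h2].
have sU := subspace_local_kernel vs k; have sW := subspace_local_kernel (v :: vs) k.
have WU : (local_kernel (v :: vs) k : set S^o) `<=` local_kernel vs k.
  by move=> u [gu hu]; split=> // w hw; apply: hu; rewrite inE hw orbT.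
have US : (local_kernel vs k : set S^o) `<=` graded_piece k by move=> u [].
have s0 := @subspace0 _ _ iotaS S^o.
have zU : ([set 0] : set S^o) `<=` local_kernel vs k by move=> _ ->; case: sU.
have zW : ([set 0] : set S^o) `<=` local_kernel (v :: vs) k by move=> _ ->; case: sW.
have [m [_ [dU _ _]]] := qdim_split (subspace_graded K k) sU s0 zU US (qdim_graded K k).
have [_ [p [_ dp _]]] := qdim_split sU sW s0 zW WU dU.
have dl : qdim iotaF (local_ring (chart_coord i v) : set F2^o)
    (tjurina_ideal (dehomog i f) (chart_coord i v)) p.
  have sT := subspace_tjurina (dehomog i f) (chart_coord i v).
  pose rel (u : S^o) (x : F2^o) := graded_piece k u /\
    tjurina_ideal (dehomog i f) (chart_coord i v) (tofrac (dehomog i u) - x).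
  apply: (@qdim_transfer _ _ _ iotaS iotaF _ _ rel) dp.
  - by split; [apply: graded0 | rewrite dehomog0 tofrac0 subr0; case: sT].
  - move=> c u u' x x' [gu hu] [gu' hu']; split; first by case: (subspace_graded K k) => _; apply.
    have [_ h] := sT; have := h c _ _ hu hu'; congr tjurina_ideal.
    rewrite -[LHS]/(iotaF c * (_ - x) + (_ - x')) -[RHS]/(_ - (iotaF c * x + x')).
    have -> : dehomog i (iotaS c *: u + u') = c%:MP * dehomog i u + dehomog i u'.
      by rewrite -[X in dehomog _ (X + _)]/(iotaS c * u) dehomogD dehomogM dehomogC.
    by rewrite tofracD tofracM -[tofrac c%:MP]/(iotaF c) mulrBr opprD addrACA.
  - exact: sU.
  - exact: subspace_local.
  - move=> u [gu _]; exists (tofrac (dehomog i u)); first exact: local_ring_poly.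
    by split=> //; rewrite subrr; case: sT.
  - move=> x hx; have [u [gu hu ux]] := h2 x hx; by exists u.
  - move=> u x [gu hu] hx [_ ux].
    have tD := @tjurina_idealD _ (dehomog i f) (chart_coord i v).
    split=> [[_ h]|tx].
      have /(locally_in_tjurina d_gt0 f_graded vi gu) t := h v (mem_head _ _).
      have := subspaceB sT t ux; congr tjurina_ideal.
      by rewrite -[LHS]/(_ - (_ - x)) opprB addrC subrK.
    split=> // w; rewrite inE => /orP[/eqP ->|]; last exact: hu.
    apply/(locally_in_tjurina d_gt0 f_graded vi gu).
    by have := tD _ _ ux tx; rewrite subrK.
have ep : p = tjurina f v.
  by rewrite ev /affine_tjurina; apply/esym/(quot_dimE (iota := iotaF)) => //; apply: subspace_tjurina.
rewrite big_cons -ep addnC; exact: qdimD d1 dp.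
Qed.

(** By [local_global] the last step of the filtration is the saturation of J, which
    is J itself in large degree. *)
Theorem milnor_total_tjurina :
  (exists k1 : nat, forall k : nat, (k1 <= k)%N -> forall u, graded_piece k u -> saturation J u -> J u) ->
  exists k0 : nat, forall k : nat, (k0 <= k)%N ->
    qdim iotaS (graded_piece k : set S^o) (graded_piece k `&` J) (total_tjurina f).
Proof.
move=> [k1 hk1]; have fin := sing_finite.
pose vs : seq 'rV[K]_3 := finmap.enum_fset (fset_set (sing f)).
have vsP v : v \in vs <-> sing f v.
  have := in_fset_set fin v; rewrite -[(v \in fset_set _)]/(v \in vs) => ->.
  by split=> [/set_mem|/mem_set].
have [||k0 hk0] := @local_filtration vs.
- exact: finmap.fset_uniq.
- by move=> v /vsP[].
exists (maxn k0 k1) => k; rewrite geq_max => /andP[/hk0 h0 /hk1 h1].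
have eT : total_tjurina f = (\sum_(v <- vs) tjurina f v)%N.
  by rewrite /total_tjurina fsbig_finite.
rewrite eT; suff <- : local_kernel vs k = graded_piece k `&` J by [].
apply/seteqP; split=> u [gu hu]; split=> //; last by move=> w _; apply: jac_locally.
apply: h1 => //; apply: (local_global d_gt0 f_graded sqfree f_neq0 gu) => v sv.
by apply/hu/vsP.
Qed.

End GlobalLocal.

(** * Reduced and smooth curves *)

Section Squares.
Variable K : numClosedFieldType.
Local Notation S := {mpoly K[3]}.
Local Notation A2 := {mpoly K[2]}.

(** Homogenizing a square factor of the affine equation in its exact degree gives a
    square factor of f. *)
Lemma squarefree_chart (d : nat) (f : S) : graded_piece d f -> squarefree f ->
  forall i (h q : A2), dehomog i f = h ^+ 2 * q -> exists c, h = c%:MP.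
Proof.
move=> gf [f0 sq] i h q e.
have g0 : dehomog i f != 0.
  apply: contraNneq f0 => e0; apply/eqP; apply: (dehomog_inj (i := i) gf (graded0 _)).
  by rewrite e0 dehomog0.
have h0 : h != 0 by apply: contraNneq g0 => h0; rewrite e h0 expr0n mul0r.
have q0 : q != 0 by apply: contraNneq g0 => q0; rewrite e q0 mulr0.
have := msize_dehomog i gf; rewrite e msizeM ?expf_neq0 // expr2 msizeM //.
have := msize_poly_eq0 h; have := msize_poly_eq0 q; rewrite (negbTE h0) (negbTE q0).
move eb : (msize q) => b; move ea : (msize h) => a nb na le.
have gH : graded_piece a.-1 (rehomog i a.-1 h) by apply: rehomog_graded; rewrite ea; lia.
have gQ : graded_piece (d - 2 * a.-1)%N (rehomog i (d - 2 * a.-1) q).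
  by apply: rehomog_graded; rewrite eb; lia.
have eF : f = rehomog i a.-1 h ^+ 2 * rehomog i (d - 2 * a.-1) q.
  apply: (dehomog_inj (i := i) gf).
    have -> : d%:Z = (a.-1 * 2)%N%:Z + (d - 2 * a.-1)%N%:Z by lia.
    by apply: gradedM => //; apply: gradedX.
  by rewrite dehomogM dehomogXn !rehomogK.
have [c ec] := sq _ _ eF; exists c.
by rewrite -(rehomogK i a.-1 h) ec dehomogC.
Qed.

Lemma poly_nonroot (p : {poly K}) : p != 0 -> exists x, p.[x] != 0.
Proof.
move=> p0; have : size (p * 'X + 1%:P) != 1%N.
  by rewrite -cons_poly_def size_cons_poly oner_eq0 andbF eqSS size_poly_eq0.
move=> /closed_rootP[x /rootP]; rewrite hornerMXaddC => e; exists x.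
by apply/eqP => px; move: e; rewrite px mul0r add0r => /eqP; rewrite oner_eq0.
Qed.

Lemma of_biv_ev j (P : {poly {poly K}}) (a : 'I_2 -> K) :
  (of_biv j P).@[a] = (map_poly (horner_eval (a (lift j ord0))) P).[a j].
Proof.
elim/poly_ind: P => [|P c ih]; first by rewrite /of_biv !rmorph0 !horner0 meval0.
rewrite of_biv_D of_biv_M of_biv_X of_biv_C mevalD mevalM mevalXU inX_ev ih.
by rewrite rmorphD rmorphM /= map_polyX map_polyC /= hornerMXaddC.
Qed.

(** If the main variable occurs in h, choose the other coordinate off the zeros of
    the leading coefficient; if not, choose it to be a root of h. *)
Lemma nonconst_zero (h : A2) : (forall c, h <> c%:MP) -> exists a, h.@[a] = 0.
Proof.
move=> nc; pose j : 'I_2 := 0; pose P := to_biv j h.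
pose pt (x y : K) : 'I_2 -> K := fun t => if t == j then y else x.
have ptj x y : pt x y j = y by rewrite /pt eqxx.
have ptj' x y : pt x y (lift j ord0) = x by rewrite /pt eq_sym (negbTE (neq_lift _ _)).
have ev x y : h.@[pt x y] = (map_poly (horner_eval x) P).[y].
  by rewrite -[h in LHS](to_bivK j) of_biv_ev ptj ptj'.
have [le|lt] := leqP (size P) 1.
  have eP : P = (P`_0)%:P by apply: size1_polyC.
  have : size P`_0 != 1%N.
    apply/negP => /size_poly1P[c c0 ec]; apply: (nc c).
    by rewrite -(to_bivK j h) -/P eP ec of_biv_C inX_C.
  move=> /closed_rootP[x /rootP px]; exists (pt x 0).
  by rewrite ev eP map_polyC hornerC.
have P0 : P != 0 by apply: contraTneq lt => ->; rewrite size_poly0.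
have [x lx] : exists x, (lead_coef P).[x] != 0 by apply: poly_nonroot; rewrite lead_coef_eq0.
have : size (map_poly (horner_eval x) P) != 1%N.
  by rewrite size_map_poly_id0 //; case: (size P) lt => [|[]].
by move=> /closed_rootP[y /rootP py]; exists (pt x y); rewrite ev.
Qed.

(** A zero of h would be a singular point. *)
Lemma smooth_chart (d : nat) (f : S) : (0 < d)%N -> graded_piece d f -> smooth_curve f ->
  forall i (h q : A2), dehomog i f = h ^+ 2 * q -> exists c, h = c%:MP.
Proof.
move=> d0 gf sm i h q e; apply: contrapT => nc.
have [a ha] : exists a, h.@[a] = 0 by apply: nonconst_zero => c ec; apply: nc; exists c.
apply: (sm (chart_point i a)).
  by apply/eqP => /rowP/(_ i); rewrite !mxE unlift_none => /eqP; rewrite oner_eq0.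
apply/(singular_chart d0 gf) => p /(chart_jacP d0 gf)[r [s [t ->]]].
rewrite e expr2 !mderivM !(mevalD, mevalM) ha; ring.
Qed.

Lemma smooth_neq0 (f : S) : smooth_curve f -> f != 0.
Proof.
move=> sm; apply/eqP => f0; apply: (sm (const_mx 1)).
  by apply/eqP => /rowP/(_ 0); rewrite !mxE => /eqP; rewrite oner_eq0.
by rewrite f0; split; rewrite /fx /fy /fz ?mderiv0 /ev meval0.
Qed.

(** With no singular point, [local_global] applies to the constant 1. *)
Lemma smooth_powers (d : nat) (f : S) : (0 < d)%N -> graded_piece d f -> smooth_curve f ->
  exists n, forall i, jacobian_ideal f (Xp K n i).
Proof.
move=> d0 gf sm.
have g1 : graded_piece 0%N (1 : S) by rewrite -mpolyC1; apply: gradedC.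
have [|n hn] := local_global d0 gf (smooth_chart d0 gf sm) (smooth_neq0 sm) g1.
  move=> v [[i [vi _]] sv]; case: (sm v) => //.
  by apply/eqP => v0; move: vi; rewrite v0 mxE => /esym/eqP; rewrite oner_eq0.
exists n => i; have := hn (U_(i) *+ n)%MM; rewrite mulr1 XpE; apply.
by rewrite mdegMn mdeg1 mul1n.
Qed.

End Squares.

(** * Jacobian ideals with three syzygies *)

Section ThreeSyzygies.
Variable K : numClosedFieldType.
Local Notation S := {mpoly K[3]}.
Local Notation iotaS := (@iotaS K).

Lemma mcoeff0M (p q : S) : (p * q)@_0%MM = p@_0%MM * q@_0%MM.
Proof. exact: rmorphM. Qed.

Variables (d : nat) (f : S) (d1 d2 d3 b : int).
Local Notation e := (d%:Z - 1).
Local Notation B := (b + 2 * e).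
Local Notation J := (jacobian_ideal f).
Local Notation dd := (fun i : 'I_3 => tnth [tuple d1; d2; d3] i).
Variables (A1 : 'M[S]_(3, 1)) (A2 : 'M[S]_3) (A3 : 'M[S]_(1, 3)).
Hypothesis res : graded_resolution J (fun _ : 'I_3 => e) (fun i : 'I_3 => tnth [tuple d1; d2; d3] i + e)
  (fun _ : 'I_1 => B) A1 A2 A3.
Lemma milnor_dim k : (dim_milnor f k)%:Z = (dimS k)%:Z - 3 * (dimS (k - e))%:Z
  + ((dimS (k - (d1 + e)))%:Z + (dimS (k - (d2 + e)))%:Z + (dimS (k - (d3 + e)))%:Z) - (dimS (k - B))%:Z.
Proof.
have [p dp ep] := res_dim res k.
rewrite /dim_milnor (quot_dimE (iota := iotaS) _ dp); last exact: subspaceSI (res_subspace res).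
by rewrite ep !sum3E big_ord1 /tnth /=; lia.
Qed.

Hypothesis d_gt0 : (0 < d)%N.
Hypothesis f_graded : graded_piece d f.
Hypothesis f_squarefree : squarefree f.
Hypotheses (min1 : minimal_map A1) (min2 : minimal_map A2) (min3 : minimal_map A3).

Lemma f_neq0 : f != 0. Proof. by case: f_squarefree. Qed.

(** If d = 1, the minimal generators of J would be constants without constant
    term, so all partial derivatives of f would vanish. *)
Lemma e_gt0 : 0 < e.
Proof.
rewrite ltNge; apply/negP => le.
have d1E : d%:Z = 1 by lia.
have J0 g : J g -> g = 0.
  have [[g1 _ _] [hI _ _ _]] := res; move=> /hI[u <-].
  rewrite mxE big1 // => i _; have -> : A1 i 0 = 0; last by rewrite mulr0.
  have := g1 i 0; rewrite d1E => h.
  by rewrite (graded0C h) min1 mpolyC0.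
have d0 : d%:R != 0 :> K by rewrite pnatr_eq0 -lt0n.
have : d%:R *: f = 0.
  rewrite -(euler f_graded) big1 // => j _; rewrite (J0 (f^`M(j))) ?mulr0 //.
  apply/jacP; exists (fun j' => if j' == j then 1 else 0); rewrite (bigD1 j) //= eqxx mul1r.
  by rewrite big1 ?addr0 // => j' /negbTE ->; rewrite mul0r.
by move/eqP; rewrite mscalerI (negbTE d0) (negbTE f_neq0).
Qed.

Lemma sat_in_jac k u : B - 3 < k -> graded_piece k u -> saturation J u -> J u.
Proof. exact: (saturation_high res). Qed.

Lemma milnor_tau : exists k0 : nat, forall k : nat, (k0 <= k)%N -> dim_milnor f k = total_tjurina f.
Proof.
have [|k0 hk0] := milnor_total_tjurina d_gt0 f_graded (squarefree_chart f_graded f_squarefree) f_neq0.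
  by exists (`|B|.+1)%N => k le u; apply: sat_in_jac; lia.
exists k0 => k /hk0 h; rewrite /dim_milnor (quot_dimE (iota := iotaS) _ h) //.
exact: subspaceSI (res_subspace res).
Qed.

(** From here on the six values of dimS are values of one quadratic polynomial. *)
Lemma tau_large : exists k0 : nat, forall k : nat, (k0 <= k)%N -> 
  2 * (total_tjurina f)%:Z = (k%:Z + 1) * (k%:Z + 2) - 3 * ((k%:Z - e + 1) * (k%:Z - e + 2))
   + ((k%:Z - (d1 + e) + 1) * (k%:Z - (d1 + e) + 2) + (k%:Z - (d2 + e) + 1) * (k%:Z - (d2 + e) + 2)
      + (k%:Z - (d3 + e) + 1) * (k%:Z - (d3 + e) + 2)) - (k%:Z - B + 1) * (k%:Z - B + 2).
Proof.
have [k0 hk0] := milnor_tau.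
exists (k0 + `|B| + `|e| + `|(d1 + e)%R| + `|(d2 + e)%R| + `|(d3 + e)%R|)%N => k le.
rewrite -(hk0 k); last by lia.
rewrite milnor_dim.
have h x : -2 <= x -> (x + 1) * (x + 2) = 2 * (dimS x)%:Z by move=> /dimSE <-; rewrite PoszM.
by rewrite !h; lia.
Qed.

(** Two consecutive values of a constant: the linear coefficient is zero. *)
Lemma b_eq : B = d1 + d2 + d3.
Proof.
have [k0 hk0] := tau_large.
have h0 := hk0 k0 (leqnn _); have h1 := hk0 k0.+1 (leqnSn _).
have ek : k0.+1%:Z = k0%:Z + 1 by lia.
rewrite ek in h1; have : 2 * (B - (d1 + d2 + d3)) = 2 * (total_tjurina f)%:Z - 2 * (total_tjurina f)%:Z.
  by rewrite {1}h1 h0; ring.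
by lia.
Qed.

Lemma tau_eq : (total_tjurina f)%:Z = e * (d1 + d2 + d3) - (d1 * d2 + d1 * d3 + d2 * d3).
Proof.
have [k0 hk0] := tau_large; have := hk0 k0 (leqnn _).
rewrite b_eq => h.
have : 2 * (total_tjurina f)%:Z = 2 * (e * (d1 + d2 + d3) - (d1 * d2 + d1 * d3 + d2 * d3)).
  by rewrite h; ring.
by lia.
Qed.

Local Notation g0 := (A3 0 0).
Local Notation g1 := (A3 0 1).
Local Notation g2 := (A3 0 2%:R).
Local Notation e1 := (B - (d1 + e)).
Local Notation e2 := (B - (d2 + e)).
Local Notation e3 := (B - (d3 + e)).

Lemma last_ideal3 : last_ideal A3 = ideal3 g0 g1 g2.
Proof.
apply/seteqP; split=> p; first by move=> [c ->]; exists (c 0), (c 1), (c 2%:R); rewrite sum3E.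
by move=> [x [y [z ->]]]; exists (fun j => [:: x; y; z]`_j); rewrite sum3E.
Qed.

Lemma last_powers : exists n, forall i, ideal3 g0 g1 g2 (Xp K n i).
Proof.
exists (`|B|.+1)%N => i; rewrite -last_ideal3.
apply: (last_ideal_high res (j := (`|B|.+1)%N)); first by lia.
exact: gradedXp.
Qed.

Lemma last_graded j : graded_piece (B - (dd j + e)) (A3 0 j).
Proof. by have [[_ _ h] _] := res; apply: h. Qed.

(** If g_j = 0, the j-th unit vector is a syzygy of g, hence a combination of Koszul
    relations; but these have no constant terms. *)
Lemma last_neq0 j : A3 0 j != 0.
Proof.
have [n hn] := last_powers; have reg := Xp_regular K n.
apply/eqP => gj; pose u : 'rV[S]_3 := \row_t (t == j)%:R.
have u0 : u *m koszul1 g0 g1 g2 = 0.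
  apply/rowP => t; rewrite ord1 koszul1E !mxE.
  by move: j gj {u}; apply: ord3_ind => gj; rewrite gj /= ?mul0r ?mulr0 ?addr0.
have [w ew] := (koszul1_exact reg hn u).1 u0.
have := congr1 (fun v : 'rV[S]_3 => (v 0 j)@_0%MM) ew.
rewrite koszul2E !mxE eqxx mcoeff1 eqxx.
have c0 t : (A3 0 t)@_0%MM = 0 by apply: min3.
have z (p : S) t : (p * A3 0 t)@_0%MM = 0 by rewrite mcoeff0M c0 mulr0.
move: j {gj u u0 ew}; apply: ord3_ind; rewrite /= ?mcoeffD ?mcoeffB ?mcoeffN !z ?subr0 ?addr0 => /esym/eqP;
  by rewrite oner_eq0.
Qed.

Lemma last_deg_pos j : 0 < B - (dd j + e).
Proof. exact: (graded_pos (@last_graded j) (min3 0 j) (last_neq0 j)). Qed.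

Lemma e123_pos : [/\ 0 < e1, 0 < e2 & 0 < e3].
Proof. by split; [apply: (last_deg_pos 0) | apply: (last_deg_pos 1) | apply: (last_deg_pos 2%:R)]. Qed.

(** If the i-th generator of the syzygies were 0, the i-th unit vector would be a
    relation between the generators, against minimality. *)
Lemma syz_row_neq0 i : row i A2 != 0.
Proof.
apply/eqP => r0; have [_ [_ _ ex2 _]] := res.
have [w ew] : exists w : 'rV_1, w *m A3 = delta_mx 0 i.
  by apply/ex2; rewrite -rowE.
have := congr1 (fun v : 'rV[S]_3 => (v 0 i)@_0%MM) ew.
rewrite !mxE big_ord1 mcoeff0M min3 mulr0 !eqxx mcoeff1 eqxx => /esym/eqP.
by rewrite oner_eq0.
Qed.

Lemma syz_deg_pos i : 0 < dd i.
Proof.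
have [j nz] : exists j, A2 i j != 0.
  apply: contrapT => h; have /eqP := syz_row_neq0 i; apply; apply/rowP => j.
  by rewrite !mxE; apply: contrapT => /eqP ?; apply: h; exists j.
have [[_ h _] _] := res; apply: graded_pos (min2 i j) nz.
by have := h i j; rewrite addrK.
Qed.

Lemma d123_pos : [/\ 0 < d1, 0 < d2 & 0 < d3].
Proof. by split; [apply: (syz_deg_pos 0) | apply: (syz_deg_pos 1) | apply: (syz_deg_pos 2%:R)]. Qed.

(** This is the positivity of the degree of g_3. *)
Lemma d_le_d1d2 : d%:Z <= d1 + d2.
Proof. by have [_ _ h] := e123_pos; have := b_eq; lia. Qed.

(** Only the last term of the count departs from its polynomial, from k = B - 3
    downwards, where dim M_k = tau + 1. *)
Lemma st_eq : is_st f (b + 2 * d%:Z - 4).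
Proof.
have [h1 h2 h3] := e123_pos; have [q1 q2 q3] := d123_pos; have e0 := e_gt0.
have t2 : 2 * (total_tjurina f)%:Z = 2 * (e * (d1 + d2 + d3) - (d1 * d2 + d1 * d3 + d2 * d3)).
  by rewrite tau_eq.
have bE := b_eq.
have hh x : -2 <= x -> (x + 1) * (x + 2) = 2 * (dimS x)%:Z by move=> /dimSE <-; rewrite PoszM.
have key k : -2 <= k - (d1 + e) -> -2 <= k - (d2 + e) -> -2 <= k - (d3 + e) ->
    2 * (dim_milnor f k)%:Z = 2 * (total_tjurina f)%:Z - 2 * (dimS (k - B))%:Z + (k - B + 1) * (k - B + 2).
  move=> k1 k2 k3; rewrite milnor_dim t2.
  transitivity (2 * (dimS k)%:Z - 3 * (2 * (dimS (k - e))%:Z) + (2 * (dimS (k - (d1 + e)))%:Z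
     + 2 * (dimS (k - (d2 + e)))%:Z + 2 * (dimS (k - (d3 + e)))%:Z) - 2 * (dimS (k - B))%:Z); first by ring.
  have r0 := hh k; have r1 := hh (k - e); have r2 := hh _ k1; have r3 := hh _ k2; have r4 := hh _ k3.
  rewrite -r0 -?r1 -?r2 -?r3 -?r4; try lia.
have eB : b + 2 * d%:Z - 4 = B - 2 by ring.
rewrite eB; split.
  move=> k le; have r : -2 <= k - B by lia.
  have k1 : -2 <= k - (d1 + e) by lia.
  have k2 : -2 <= k - (d2 + e) by lia.
  have k3 : -2 <= k - (d3 + e) by lia.
  have := key k k1 k2 k3; rewrite (hh _ r).
  by move: (dim_milnor f k) (total_tjurina f) (dimS _) => x y z; lia.
move=> r hr; rewrite leNgt; apply/negP => lt.
have k1 : -2 <= B - 3 - (d1 + e) by lia.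
have k2 : -2 <= B - 3 - (d2 + e) by lia.
have k3 : -2 <= B - 3 - (d3 + e) by lia.
have := key _ k1 k2 k3; rewrite hr; last by lia.
rewrite (dimS_lt0 (k := B - 3 - B)); last by lia.
have -> : (B - 3 - B + 1) * (B - 3 - B + 2) = 2 by ring.
lia.
Qed.

Hypothesis d_sorted : d1 <= d2 <= d3.

(** Write d_i = e + x_i with x_i >= 0; then tau is minus e (x_1 + x_2 + x_3) minus a
    nonnegative quantity. *)
Lemma d1_large : e <= d1 -> [/\ d1 = e, d2 = e, d3 = e & total_tjurina f = 0%N].
Proof.
move=> le; have t := tau_eq; have e0 := e_gt0; have /andP[l12 l23] := d_sorted.
have [x ex] : exists x, d1 = e + x by exists (d1 - e); ring.
have [y ey] : exists y, d2 = e + y by exists (d2 - e); ring.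
have [z ez] : exists z, d3 = e + z by exists (d3 - e); ring.
have et : (total_tjurina f)%:Z + e * (x + y + z) + (x * y + x * z + y * z) = 0.
  by rewrite t ex ey ez; ring.
have x0 : 0 <= x by lia.
have y0 : 0 <= y by lia.
have z0 : 0 <= z by lia.
have p1 : 0 <= x * y by apply: mulr_ge0.
have p2 : 0 <= x * z by apply: mulr_ge0.
have p3 : 0 <= y * z by apply: mulr_ge0.
have p4 : x + y + z <= e * (x + y + z) by apply: ler_peMl; lia.
by split; lia.
Qed.

(** Otherwise tau = 0, so J contains all forms of some degree and has no zero. *)
Lemma d1_small : sing f !=set0 -> d1 < e.
Proof.
move=> [v [[i [vi _]] sv]]; rewrite ltNge; apply/negP => /d1_large[_ _ _ t0].
have [k0 hk0] := milnor_tau; have := hk0 k0 (leqnn _); rewrite t0.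
have [p dp _] := res_dim res k0.
have sJ := subspaceSI k0 (res_subspace res).
rewrite /dim_milnor (quot_dimE (iota := iotaS) _ dp) // => p0.
move: dp; rewrite p0 => /(qdim0P _ sJ) h.
have gX : graded_piece k0 (Xp K k0 i) by apply: gradedXp.
have [_ hX] := h _ gX.
have := (singular_jac d_gt0 f_graded v).1 sv _ hX.
by rewrite /ev /Xp rmorphXn /= mevalXU vi expr1n => /eqP; rewrite oner_eq0.
Qed.

(** Up to degree d_1 + e - 1 neither resolution sees a syzygy; in degree d_1 + e the
    first syzygy of f makes the dimension jump, before the Koszul syzygies. *)
Lemma ct_eq (fs : S) : d1 < e ->
  (forall k : int, (dim_milnor fs k)%:Z = (dimS k)%:Z - 3 * (dimS (k - e))%:Z
     + 3 * (dimS (k - 2 * e))%:Z - (dimS (k - 3 * e))%:Z) ->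
  is_ct f fs (d1 + d%:Z - 2).
Proof.
move=> d1e hs; have e0 := e_gt0; have [h1 h2 h3] := e123_pos; have /andP[l12 l23] := d_sorted.
split=> [k le|r hr].
  suff : (dim_milnor f k)%:Z = (dim_milnor fs k)%:Z by lia.
  rewrite milnor_dim hs !(dimS_lt0 (k := k - (d1 + e))) ?(dimS_lt0 (k := k - (d2 + e))) ?(dimS_lt0 (k := k - (d3 + e)))
    ?(dimS_lt0 (k := k - 2 * e)) ?(dimS_lt0 (k := k - 3 * e)) ?(dimS_lt0 (k := k - B)) //; lia.
rewrite leNgt; apply/negP => lt.
have : (dim_milnor f (d1 + e))%:Z = (dim_milnor fs (d1 + e))%:Z by rewrite hr //; lia.
rewrite milnor_dim hs ?(dimS_lt0 (k := d1 + e - 2 * e)) ?(dimS_lt0 (k := d1 + e - 3 * e)) ?(dimS_lt0 (k := d1 + e - B)); try lia.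
have -> : d1 + e - (d1 + e) = 0 by ring.
have -> : dimS 0 = 1%N by []. 
by lia.
Qed.

(** When d_1 >= e both Hilbert functions coincide in all degrees, so there is no
    coincidence threshold. *)
Lemma ct_uniq (fs : S) ct :
  (forall k : int, (dim_milnor fs k)%:Z = (dimS k)%:Z - 3 * (dimS (k - e))%:Z
     + 3 * (dimS (k - 2 * e))%:Z - (dimS (k - 3 * e))%:Z) ->
  is_ct f fs ct -> ct = d1 + d%:Z - 2.
Proof.
move=> hs [hct mct]; have [d1e|ed1] := ltrP d1 e.
  by have [c1 c2] := ct_eq d1e hs; apply/eqP; rewrite eq_le c2 //= mct.
have [d1E d2E d3E _] := d1_large ed1; have bE := b_eq.
have := mct (ct + 1); have -> : (ct + 1 <= ct) = false by lia.
move=> h; suff : false by []; apply: h => k _.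
suff : (dim_milnor f k)%:Z = (dim_milnor fs k)%:Z by lia.
rewrite milnor_dim hs d1E d2E d3E.
have -> : k - B = k - 3 * e by rewrite bE d1E d2E d3E; ring.
have -> : k - (e + e) = k - 2 * e by ring.
by move: (dimS k) (dimS (k - e)) (dimS (k - 2 * e)) (dimS (k - 3 * e)) => ? ? ? ?; lia.
Qed.

Lemma jac_hcomp k u : J u -> J (hcomp k u).
Proof.
move=> /jacP[P ->]; apply/jacP; exists (fun j => hcomp (k - e) (P j)).
rewrite hcomp_sum; apply: eq_bigr => j _; apply: hcompM.
exact: graded_deriv.
Qed.

Lemma deriv_jac j : J (f^`M(j)).
Proof.
apply/jacP; exists (fun j' => if j' == j then 1 else 0); rewrite (bigD1 j) //= eqxx mul1r.
by rewrite big1 ?addr0 // => j' /negbTE ->; rewrite mul0r.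
Qed.

Definition grad : 'M[S]_(3, 1) := \matrix_(j, _) f^`M(j).

(** Both families are bases of the forms of degree e in J, so they differ by an
    invertible constant matrix; minimality of the syzygies gives the
    invertibility. *)
Lemma base_change : exists P Q : 'M[S]_3,
  [/\ grad = P *m A1, A1 = Q *m grad, forall i j, graded_piece 0 (P i j),
      forall i j, graded_piece 0 (Q i j) & Q *m P = 1%:M].
Proof.
have [[gA1 _ _] [hI ex1 _ _]] := res.
have /choice[P hP] : forall j, exists u : 'rV[S]_3, (forall l, graded_piece 0 (u 0 l)) /\ u *m A1 = row j grad.
  move=> j; have /hI[u eu] := deriv_jac j; exists (compv (fun _ : 'I_3 => e) e u); split.
    by move=> l; rewrite mxE subrr; apply: hcomp_graded.
  rewrite -(compv_mulmx _ _ gA1); apply/rowP => t; rewrite ord1 mxE eu subr0 !mxE hcomp_id //.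
  exact: graded_deriv.
have /choice[Q hQ] : forall j, exists u : 'rV[S]_3, (forall l, graded_piece 0 (u 0 l)) /\ u *m grad = row j A1.
  move=> j; have /jacP[u eu] : J (A1 j 0).
    by apply/hI; exists (delta_mx 0 j); rewrite -rowE mxE.
  exists (\row_l hcomp 0 (u l)); split; first by move=> l; rewrite mxE; apply: hcomp_graded.
  apply/rowP => t; rewrite ord1 !mxE; have gA := gA1 j 0; rewrite subr0 in gA.
  rewrite -[RHS](hcomp_id gA) eu hcomp_sum; apply: eq_bigr => l _.
  by rewrite !mxE (hcompM _ _ (graded_deriv (j := l) f_graded)) subrr.
pose Pm := \matrix_(i, j) P i 0 j; pose Qm := \matrix_(i, j) Q i 0 j.
have rP i : row i Pm = P i by apply/rowP => j; rewrite !mxE.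
have rQ i : row i Qm = Q i by apply/rowP => j; rewrite !mxE.
have e1' : grad = Pm *m A1.
  by apply/row_matrixP => i; rewrite row_mul rP; have [_ ->] := hP i.
have e2' : A1 = Qm *m grad.
  by apply/row_matrixP => i; rewrite row_mul rQ; have [_ ->] := hQ i.
have gP i j : graded_piece 0 (Pm i j) by rewrite mxE; have [h _] := hP i; apply: h.
have gQ i j : graded_piece 0 (Qm i j) by rewrite mxE; have [h _] := hQ i; apply: h.
exists Pm, Qm; split=> //; apply/eqP; rewrite -subr_eq0; apply/eqP/row_matrixP => i; rewrite row0.
have [w ew] : exists w : 'rV_3, w *m A2 = row i (Qm *m Pm - 1%:M).
  by apply/ex1; rewrite -row_mul mulmxBl -mulmxA -e1' -e2' mul1mx subrr row0.
apply/rowP => j; have g : graded_piece 0 ((row i (Qm *m Pm - 1%:M)) 0 j).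
  rewrite !mxE; apply: gradedB.
    by apply: graded_sum => l _; rewrite -[0]addr0; apply: gradedM.
  by case: eqP => _; [rewrite -mpolyC1; apply: gradedC | apply: graded0].
rewrite (graded0C g) -ew !mxE raddf_sum /= big1 ?mpolyC0 // => l _.
by rewrite mcoeff0M min2 mulr0.
Qed.

Lemma syzygyP x y z : syzygy f x y z <-> (\row_j [:: x; y; z]`_j : 'rV[S]_3) *m grad = 0.
Proof.
rewrite /syzygy; split=> [h|/rowP/(_ 0)]; first apply/rowP => t.
  by rewrite ord1 mxE sum3E !mxE /= -[RHS]h.
by rewrite mxE sum3E !mxE.
Qed.

(** Koszul relations start in degree e > d_1, so in degree d_1 every nonzero syzygy
    is essential. *)
Lemma mdr_eq : d1 < e -> is_mdr f d1.
Proof.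
move=> d1e; have [P [Q [eP eQ gP gQ QP]]] := base_change.
have PQ := mulmx1C QP; have [[gA1 gA2 _] [_ ex1 _ _]] := res.
have /andP[l12 l23] := d_sorted.
split.
  pose r := row 0 A2 *m Q.
  have rg : r *m grad = 0.
    by rewrite -mulmxA -eQ; apply/ex1; exists (delta_mx 0 0); rewrite -rowE.
  have gr j : graded_piece d1 (r 0 j).
    rewrite mxE; apply: graded_sum => l _; rewrite -[d1]addr0; apply: gradedM => //.
    by have := gA2 0 l; rewrite /tnth /= addrK mxE.
  have er : r = \row_j [:: r 0 0; r 0 1; r 0 2%:R]`_j by apply: row3P; rewrite !mxE.
  exists (r 0 0), (r 0 1), (r 0 2%:R); split=> //; first by apply/syzygyP; rewrite -er.
  move=> [u [v [w [e0' e1' e2']]]].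
  have z (p : S) j : hcomp d1 (p * f^`M(j)) = 0.
    rewrite (hcompM _ _ (graded_deriv (j := j) f_graded)) (_ : hcomp _ p = 0) ?mul0r //.
    by apply: graded_lt0 (hcomp_graded _ _); lia.
  have r0 : r = 0.
    apply: row3P; rewrite [RHS]mxE.
    - by rewrite -(hcomp_id (gr 0)) e0' hcompD !z addr0.
    - by rewrite -(hcomp_id (gr 1)) e1' hcompB !z subr0.
    - by rewrite -(hcomp_id (gr 2%:R)) e2' hcompB hcompN !z oppr0 addr0.
  have : r *m P = 0 by rewrite r0 mul0mx.
  by rewrite -mulmxA QP mulmx1 => /eqP; rewrite (negbTE (syz_row_neq0 0)).
move=> q [x [y [z [gx gy gz sy nk]]]]; rewrite leNgt; apply/negP => lt; apply: nk.
pose u : 'rV[S]_3 := \row_j [:: x; y; z]`_j.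
have gu j : graded_piece q (u 0 j) by move: j; apply: ord3_ind; rewrite mxE.
have : (u *m P) *m A1 = 0 by rewrite -mulmxA -eP; apply/syzygyP.
move=> /ex1[w ew].
have gv : gvec (fun _ : 'I_3 => e) (q + e) (u *m P).
  move=> j; rewrite addrK mxE; apply: graded_sum => l _; rewrite -[q]addr0.
  by apply: gradedM.
have uP0 : u *m P = 0.
  rewrite -(compv_id gv) -ew (compv_mulmx _ _ gA2) (_ : compv _ _ _ = 0) ?mul0mx //.
  apply/rowP => j; rewrite !mxE; apply: graded_lt0 (hcomp_graded _ _).
  by move: j; apply: ord3_ind; rewrite /tnth /=; lia.
have u0 : u = 0 by rewrite -[u]mulmx1 -PQ mulmxA uP0 mul0mx.
have := congr1 (fun v : 'rV[S]_3 => v 0 0) u0; have := congr1 (fun v : 'rV[S]_3 => v 0 1) u0.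
have := congr1 (fun v : 'rV[S]_3 => v 0 2%:R) u0; rewrite !mxE /= => -> -> ->.
by exists 0, 0, 0; split; ring.
Qed.

(** The Hilbert function of S / (g_1, g_2, g_3), read off from its Koszul
    complex. *)
Lemma last_quot_dim j : exists2 p, qdim iotaS (graded_piece j : set S^o) (graded_piece j `&` last_ideal A3) p &
  p%:Z = (dimS j)%:Z - ((dimS (j - e1))%:Z + (dimS (j - e2))%:Z + (dimS (j - e3))%:Z)
    + ((dimS (j - (e1 + e2)))%:Z + (dimS (j - (e1 + e3)))%:Z + (dimS (j - (e2 + e3)))%:Z)
    - (dimS (j - (e1 + e2 + e3)))%:Z.
Proof.
have [n hn] := last_powers.
have kr := koszul_resolution hn (@last_graded 0) (@last_graded 1) (@last_graded 2%:R).
have [p dp ep] := res_dim kr j; exists p; first by rewrite last_ideal3.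
by rewrite ep !sum3E big_ord1 /tnth /=; lia.
Qed.

Lemma sat_quot_dim k p :
  qdim iotaS (graded_piece (B - 3 - k) : set S^o) (graded_piece (B - 3 - k) `&` last_ideal A3) p ->
  qdim iotaS ((graded_piece k `&` saturation J) : set S^o) (graded_piece k `&` J) p.
Proof. exact: (saturation_dim res). Qed.

Lemma e_sorted : e1 >= e2 /\ e2 >= e3.
Proof. by have /andP[l12 l23] := d_sorted; split; lia. Qed.

(** By duality dim (S/g)_1 <= 1, so at least two of the three forms g_i are linear;
    the degrees e_1 >= e_2 >= e_3 are ordered. *)
Lemma nearly_free_degrees : nearly_free f -> e2 = 1 /\ e3 = 1.
Proof.
move=> [_ nf]; have [p dp ep] := last_quot_dim 1.
have : (p <= 1)%N.
  have := nf (B - 4); have eB : B - 3 - (B - 4) = 1 by ring.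
  have := sat_quot_dim (k := B - 4) (p := p); rewrite eB => /(_ dp) dq.
  by rewrite /dim_N_piece (quot_dimE (iota := iotaS) _ dq) //; exact: subspaceSI (res_subspace res).
have [h1 h2 h3] := e123_pos; have [s12 s23] := e_sorted.
move: ep; rewrite (dimS_lt0 (k := 1 - (e1 + e2))) ?(dimS_lt0 (k := 1 - (e1 + e3)))
  ?(dimS_lt0 (k := 1 - (e2 + e3))) ?(dimS_lt0 (k := 1 - (e1 + e2 + e3))); try lia.
have hx x : 0 < x -> (dimS (1 - x))%:Z = (x == 1)%:Z.
  move=> x0; have [->|ne] := eqVneq x 1; first by rewrite subrr.
  by rewrite dimS_lt0 //; lia.
rewrite !hx //; have -> : (dimS 1)%:Z = 3 by [].
move: e1 e2 e3 h1 h2 h3 s12 s23 => x y z ? ? ? ? ?.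
by case: eqP; case: eqP; case: eqP => ? ? ?; lia.
Qed.

Section TwoLinearForms.
Hypotheses (e2_1 : e2 = 1) (e3_1 : e3 = 1).

(** S / g is a truncated polynomial ring in one variable: the second difference of
    dimS is the indicator of k >= 0. *)
Lemma last_quot_dim1 (j : int) : 0 <= j ->
  qdim iotaS (graded_piece j : set S^o) (graded_piece j `&` last_ideal A3) (j < e1)%R.
Proof.
move=> j0; have [p dp ep] := last_quot_dim j; have [h1 _ _] := e123_pos.
suff <- : p = (j < e1)%R by [].
have dif (x : int) : -2 <= x -> (dimS x)%:Z - 2 * (dimS (x - 1))%:Z + (dimS (x - 2))%:Z = Posz (0 <= x)%R.
  have [lt|ge] := ltrP x 0.
    by rewrite !dimS_lt0 //; lia.
  have hh y : -2 <= y -> 2 * (dimS y)%:Z = (y + 1) * (y + 2) by move=> /dimSE <-; rewrite PoszM.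
  move=> _; have q0 := hh x; have q1 := hh (x - 1); have q2 := hh (x - 2).
  have : 2 * ((dimS x)%:Z - 2 * (dimS (x - 1))%:Z + (dimS (x - 2))%:Z) = 2.
    rewrite mulrDr mulrBr (mulrCA 2 2) q0 ?q1 ?q2; try lia.
  by lia.
have difn (x : int) : x < 0 -> (dimS x)%:Z - 2 * (dimS (x - 1))%:Z + (dimS (x - 2))%:Z = 0.
  by move=> lt; rewrite !dimS_lt0 //; lia.
move: ep; rewrite e2_1 e3_1.
have -> : j - (e1 + 1) = j - e1 - 1 by ring.
have -> : j - (e1 + 1 + 1) = j - e1 - 2 by ring.
have -> : j - (1 + 1) = j - 2 by ring.
have j2 : -2 <= j by lia.
have := dif j j2; rewrite j0.
have [lt|le] := ltrP j e1.
  have je : j - e1 < 0 by lia.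
  have := difn _ je.
  by move: (dimS j) (dimS (j - e1)) (dimS (j - 1)) (dimS (j - 2)) (dimS (j - e1 - 1)) (dimS (j - e1 - 2)) => ? ? ? ? ? ? /=; lia.
have je : 0 <= j - e1 by lia.
have je2 : -2 <= j - e1 by lia.
have := dif _ je2; rewrite je.
by move: (dimS j) (dimS (j - e1)) (dimS (j - 1)) (dimS (j - 2)) (dimS (j - e1 - 1)) (dimS (j - e1 - 2)) => ? ? ? ? ? ? /=; lia.
Qed.

Lemma sat_quot_dim1 (t : nat) : t%:Z <= B - 3 ->
  qdim iotaS ((graded_piece t `&` saturation J) : set S^o) (graded_piece t `&` J) (B - 3 - t%:Z < e1)%R.
Proof. by move=> le; apply: sat_quot_dim; apply: last_quot_dim1; lia. Qed.

Lemma sat_hcomp k u : saturation J u -> saturation J (hcomp k u).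
Proof.
move=> [n hn]; exists n => m hm; rewrite mulrC.
have -> : hcomp k u = hcomp (k + n%:Z - n%:Z) u by congr hcomp; ring.
rewrite -hm -(hcompM _ _ (gradedMon m)) mulrC; apply: jac_hcomp.
exact: hn.
Qed.

(** Filters the saturation of J by the degree from which on the components lie in
    J, which reduces the ungraded dim_N to its graded pieces. *)
Definition sat_filtration (t : nat) : set S :=
  [set u | saturation J u /\ forall k : int, t%:Z <= k -> J (hcomp k u)].

Lemma subspace_filtration t : subspace iotaS (sat_filtration t : set S^o).
Proof.
have [s0 sD] := subspace_saturation res; have [j0 jD] := res_subspace res.
split=> [|c u v [su hu] [sv hv]].
  by split=> // k _; rewrite hcomp0.
split; first exact: sD.
move=> k le; have := jD c _ _ (hu k le) (hv k le); congr J.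
by rewrite -[LHS]/(iotaS c * _ + _) -[X in hcomp k (X + _)]/(iotaS c * u) !iotaSE hcompD hcompZ.
Qed.

(** The pieces N(f)_t are one-dimensional exactly for
    B - 2 - e_1 <= t < B - 2. *)
Lemma filtration_dim (t : nat) : t%:Z <= B - 2 ->
  qdim iotaS (sat_filtration t : set S^o) J (t - (`|(B - 2)%R| - `|e1|))%N.
Proof.
have [h1 _ _] := e123_pos; have [q1 _ _] := d123_pos; have e0 := e_gt0.
have [j0 jD jM] := jac_ideal f; have sJ := res_subspace res.
elim: t => [_|t ih le].
  apply/(qdim0P _ sJ) => u [_ hu]; have [N ->] := sum_hcomp u.
  by apply: ideal_sum; [exact: jac_ideal | move=> i _; apply: hu].
have step := @sat_quot_dim1 t.
have -> : (t.+1 - (`|(B - 2)%R| - `|e1|) = (B - 3 - t%:Z < e1)%R + (t - (`|(B - 2)%R| - `|e1|)))%N.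
  by case: ltrP => ?; lia.
apply: (@qdimD K S iotaS S^o (sat_filtration t.+1) (sat_filtration t) J) => //.
- exact: subspace_filtration.
- move=> u hu; split; last by move=> k _; apply: jac_hcomp.
  by exists 0%N => m _; apply: jM.
- by move=> u [su hu]; split=> // k lk; apply: hu; lia.
- pose rel (v u : S^o) := hcomp t%:Z u = v.
  apply: (@qdim_transfer _ _ _ iotaS iotaS S^o S^o rel) (step _); last by lia.
  + by rewrite /rel hcomp0.
  + move=> c v v' u u'; rewrite /rel => <- <-.
    rewrite -[RHS]/(iotaS c * _ + _) -[X in hcomp _ (X + _)]/(iotaS c * u) !iotaSE.
    by rewrite hcompD hcompZ.
  + apply: subspaceI; [exact: subspace_graded | exact: (subspace_saturation res)].
  + exact: subspace_filtration.
  + move=> v [gv sv]; exists v; last by rewrite /rel hcomp_id.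
    split=> // k lk; rewrite (graded_homog0 gv) //.
    by apply/eqP; lia.
  + move=> u [su hu]; exists (hcomp t%:Z u); last by [].
    by split; [exact: hcomp_graded | exact: sat_hcomp].
  + move=> v u [gv sv] [su hu] r; split=> [[_ jv]|[_ h]].
      split=> // k; rewrite le_eqVlt => /orP[/eqP <-|lt]; first by rewrite r.
      by apply: hu; lia.
    by split=> //; rewrite -r; apply: h.
- by apply: ih; lia.
Qed.

Lemma dim_N_eq : (dim_N f)%:Z = e1.
Proof.
have [h1 _ _] := e123_pos; have [q1 q2 q3] := d123_pos; have e0 := e_gt0; have bE := b_eq.
have dT := filtration_dim (t := `|(B - 2)%R|).
have eF : sat_filtration `|(B - 2)%R| = saturation J.
  apply/seteqP; split=> u; first by case.
  move=> su; split=> // k le; apply: (sat_in_jac (k := k)); [lia | exact: hcomp_graded | exact: sat_hcomp].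
rewrite eF in dT; rewrite /dim_N (quot_dimE (iota := iotaS) _ (dT _)); [lia | exact: res_subspace res | lia].
Qed.

End TwoLinearForms.

Lemma nearly_free_numbers : nearly_free f ->
  [/\ d1 + d2 = d%:Z, d2 = d3, b = d2 - d%:Z + 2 & (dim_N f)%:Z = d2 - d1 + 1].
Proof.
move=> /nearly_free_degrees[h2 h3]; have := dim_N_eq h2 h3; have := b_eq; move=> h hN.
by split; lia.
Qed.

End ThreeSyzygies.

(** * The thresholds and the Tjurina number of the curve *)

Section SmoothCurve.
Variable K : numClosedFieldType.
Local Notation S := {mpoly K[3]}.

Lemma smooth_milnor_dim (d : nat) (f : S) k : (0 < d)%N -> graded_piece d f -> smooth_curve f ->
  (dim_milnor f k)%:Z = (dimS k)%:Z - 3 * (dimS (k - (d%:Z - 1)))%:Z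
     + 3 * (dimS (k - 2 * (d%:Z - 1)))%:Z - (dimS (k - 3 * (d%:Z - 1)))%:Z.
Proof.
move=> d0 gf sm; have [n hn] := smooth_powers d0 gf sm.
have gd j := @graded_deriv K d f j gf.
have kr := koszul_resolution (hn : forall i, ideal3 _ _ _ _) (gd 0) (gd 1) (gd 2%:R).
have [p dp ep] := res_dim kr k.
rewrite /dim_milnor (quot_dimE (iota := @iotaS K) _ dp); last exact: subspaceSI (res_subspace kr).
rewrite ep !sum3E big_ord1 /=.
have -> : k - (d%:Z - 1 + (d%:Z - 1)) = k - 2 * (d%:Z - 1) by ring.
have -> : k - (d%:Z - 1 + (d%:Z - 1) + (d%:Z - 1)) = k - 3 * (d%:Z - 1) by ring.
lia.
Qed.

End SmoothCurve.

Theorem theorem3p2 (R : realType) (d : nat) (f fs : {mpoly R[i][3]})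
    (d1 d2 d3 b : int)
    (f_reduced : reduced_curve d f)
    (f_not_pencil : ~ concurrent_lines f)
    (fs_homog : fs \is d.-homog) (fs_smooth : smooth_curve fs)
    (d_sorted : d1 <= d2 <= d3)
    (f_resolution :
       has_minimal_resolution (jacobian_ideal f)
         (fun _ : 'I_3 => d%:Z - 1)
         (fun i : 'I_3 => tnth [tuple d1; d2; d3] i + (d%:Z - 1))
         (fun _ : 'I_1 => b + 2 * (d%:Z - 1))) :
  [/\ d%:Z <= d1 + d2,
      b = d1 + d2 + d3 - 2 * (d%:Z - 1),
      (total_tjurina f)%:Z =
        (d%:Z - 1) * (d1 + d2 + d3) - (d1 * d2 + d1 * d3 + d2 * d3),
      (sing f !=set0 -> is_mdr f d1 /\ is_ct f fs (d1 + d%:Z - 2))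
    & is_st f (b + 2 * d%:Z - 4)]
  /\
  (nearly_free f ->
    [/\ [/\ d1 + d2 = d%:Z, d2 = d3 & b = d2 - d%:Z + 2],
        (total_tjurina f)%:Z = (d%:Z - 1) ^+ 2 - d1 * (d2 - 1) - 1,
        is_st f (d2 + d%:Z - 2),
        (let T := 3 * (d%:Z - 2) in
         forall ct st : int, is_ct f fs ct -> is_st f st ->
           ct + st = T + 2 /\ T + 2 = 3 * d%:Z - 4)
      & (almost_free d f <-> (if odd d then d2 = d1 + 1 else d2 = d1))]).
Proof.
have [d_gt0 /graded_posE gf sqf] := f_reduced.
have gfs : graded_piece d fs by apply/graded_posE.
have [A1 [A2 [A3 [gA [min1 min2 min3] exA]]]] := f_resolution.
have res := conj gA exA.
have e_pos := e_gt0 res d_gt0 gf sqf min1.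
have bE := b_eq res d_gt0 gf sqf.
have tauE := tau_eq res d_gt0 gf sqf.
have stE := st_eq res d_gt0 gf sqf min1 min2 min3.
have fsE k := smooth_milnor_dim k d_gt0 gfs fs_smooth.
split.
  split; [| |exact: tauE| |exact: stE].
  - exact: (d_le_d1d2 res d_gt0 gf sqf min3).
  - by rewrite -bE; ring.
  move=> /(d1_small res d_gt0 gf sqf min1 d_sorted) d1e.
  split; first exact: (mdr_eq res d_gt0 gf min2 min3 d_sorted d1e).
  exact: (ct_eq res d_gt0 gf sqf min1 min3 d_sorted d1e fsE).
move=> nf.
have [dE d23 b2 dimN] := nearly_free_numbers res d_gt0 gf sqf min1 min2 min3 d_sorted nf.
have stE' : b + 2 * d%:Z - 4 = d2 + d%:Z - 2 by lia.
rewrite stE' in stE; split; [by split| |exact: stE| |].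
- rewrite tauE -d23; have -> : d%:Z = d1 + d2 by []; ring.
- move=> T ct st isct isst; split; last by rewrite /T; ring.
  have -> : st = d2 + d%:Z - 2.
    apply/eqP; rewrite eq_le; have [s1 s2] : _ /\ _ := stE; have [t1 t2] : _ /\ _ := isst.
    by rewrite t2 //= s2.
  by rewrite (ct_uniq res d_gt0 gf sqf min1 min3 d_sorted fsE isct) /T; lia.
- rewrite /almost_free; move: (dim_N f) dimN => N dimN.
  by case: (odd d); split=> h; lia.
Qed.
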